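(* For each $n\ge1$ let $A_n=(a_{ij})_{1\le i,j\le n}$ be an $n\times n$ random Hermitian matrix (the law of the entries may depend on $n$) whose entries are independent up to symmetry, such that: (i) $\mathbb E[a_{ij}]=0$ and $\mathbb E[|a_{ij}|^2]=s_{ij}$; (ii) $\frac1n\sum_{j=1}^ns_{ij}=1+o(1)$ for all $1\le i\le n$ (with $o(1)\to0$ as $n\to\infty$, uniformly in $i$); (iii) for every constant $\eta>0$, $\lim_{n\to\infty}\frac1{n^2}\sum_{1\le i,j\le n}\mathbb E\big[|a_{ij}|^2\mathbf 1(|a_{ij}|\ge\eta\sqrt n)\big]=0$; (iv) $\sup_{ij}s_{ij}\le C$ for a constant $C>0$ (not depending on $n$). Then the empirical spectral distribution of $M_n:=\frac{A_n}{\sqrt n}$ converges weakly almost surely to the semicircle law.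
   Context: The empirical spectral distribution of an $n\times n$ Hermitian matrix $A$ with eigenvalues $\lambda_1,\dots,\lambda_n$ is $F^A(x)=\frac1n\sum_{i=1}^n\mathbf 1_{\{\lambda_i\le x\}}$. The semicircle law is the probability measure with density $\frac1{2\pi}\sqrt{4-x^2}$ on $[-2,2]$; its $2k$-th moment is the Catalan number $\frac1{k+1}\binom{2k}k$ and its odd moments vanish. All $A_n$ are defined on a common probability space. *)

(* Defs.v *)
From HB Require Import structures.
From mathcomp Require Import all_boot all_order all_algebra.
From mathcomp Require Import complex.
From mathcomp Require Import all_classical all_reals all_analysis.

Set Implicit Arguments.
Unset Strict Implicit.
Unset Printing Implicit Defensive.

Import Order.TTheory GRing.Theory Num.Theory.
Import numFieldNormedType.Exports.

Local Open Scope classical_set_scope.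
Local Open Scope ring_scope.
Local Open Scope complex_scope.

(* The modulus of a complex number as an element of [R] (the norm [`|z|] of
   [R[i]] takes its values in [R[i]]). *)
Definition cmod (R : realType) (z : R[i]) : R := ComplexField.Normc.normc z.

(* [R[i]] carries no measurable structure in the library; its Borel sets are
   those of the plane under this identification. *)
Definition to_plane (R : realType) (z : R[i]) : (R * R)%type :=
  (complex.Re z, complex.Im z).

Definition mutually_independent d d' (T : measurableType d)
    (T' : measurableType d') (R : realType) (P : probability T R)
    (I : finType) (D : pred I) (X : I -> T -> T') : Prop :=
  forall J : {set I}, {subset J <= D} ->
  forall B : I -> set T', (forall i, measurable (B i)) ->
    P (\bigcap_(i in [set` J]) (X i @^-1` B i)) =
    (\prod_(i in J) P (X i @^-1` B i))%E.

(* [spectral_diag A] is the vector of the eigenvalues of [A], repeated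
   according to multiplicity, whenever [A] is normal (see [char_poly_spectral]);
   they are real when [A] is Hermitian, and [<=] on [R[i]] restricts to the
   usual order on the reals. *)
Definition esd (R : realType) (n : nat) (A : 'M[R[i]]_n) (x : R) : R :=
  n%:R^-1 * \sum_(i < n) (spectral_diag A 0 i <= x%:C)%R%:R.

Lemma char_poly_spectral (R : realType) (n : nat) (A : 'M[R[i]]_n) :
  A \is hermsymmx ->
  char_poly A = \prod_(i < n) ('X - (spectral_diag A 0 i)%:P).
Proof.
move=> /hermitian_normalmx /orthomx_spectralP; set Q := spectralmx A.
set D := spectral_diag A => AE.
have Qu : Q \in unitmx by exact: spectral_unit.
have AQ : char_poly_mx A = map_mx polyC (invmx Q) *m
    char_poly_mx (diag_mx D) *m map_mx polyC Q.
  rewrite /char_poly_mx mulmxBr mulmxBl -!map_mxM -AE; congr (_ - _).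
  by rewrite scalar_mxC -mulmxA -map_mxM mulVmx// map_mx1 mulmx1.
rewrite /char_poly AQ !det_mulmx mulrAC -det_mulmx -map_mxM mulVmx//.
rewrite map_mx1 det1 mul1r -/(char_poly (diag_mx D)).
rewrite char_poly_trig ?diag_mx_is_trig//; apply: eq_bigr => i _.
by rewrite !mxE eqxx.
Qed.

Definition semicircle_pdf (R : realType) (x : R) : R :=
  if -2 <= x <= 2 then (2 * pi)^-1 * Num.sqrt (4 - x ^+ 2) else 0.

Definition semicircle_law (R : realType) (U : set R) : \bar R :=
  (\int[lebesgue_measure]_(x in U) (semicircle_pdf x)%:E)%E.

Definition semicircle_cdf (R : realType) (x : R) : R :=
  fine (semicircle_law `]-oo, x]).

(* Weak convergence of distribution functions. *)
Definition weak_cvg (R : realType) (F_ : nat -> R -> R) (F : R -> R) : Prop :=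
  forall x : R, {for x, continuous F} -> F_ n x @[n --> \oo] --> F x.

(* Main.v *)
(** With [G = (M - z)^-1] the resolvent of [M = A_n / sqrt n], no truncation is
    needed: expanding [E [M i j * G j i]] to second order in the entry [(i, j)]
    leaves [- S i j * E [G i i * G j j]] and a remainder controlled by
    [E [|M i j|^2 * min 1 |M i j|]], which the Lindeberg condition makes small on
    average.  Hence [g i = E (G i i)] satisfies
    [1 + z * g i + g i * \sum_j S i j * g j = 0] up to an error that is small on
    average, where [S i j = s i j / n].  As the rows of [S] sum to nearly [1], the
    only nearby solution is the constant one, the root of [1 + z * m + m^2 = 0]
    with [|m| < 1]: this is a Schur test whose weights come from the imaginary
    part of the equation, and it works for every [z] in the upper half plane.

    The normalized trace of [G] changes by O(1/n) when one row and column of [M]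
    is modified, so integrating out the rows one after the other gives exponential
    concentration, and Borel-Cantelli makes the convergence to [m] almost sure,
    simultaneously for countably many [z].

    Substituting [t = 2 cos u] and expanding in the functions [sin (k u)] shows
    that [m] is the Stieltjes transform of the semicircle law.  The imaginary
    parts give convergence of the means of Cauchy kernels; Riemann sums of these
    in their centre are differences of arctangents, which at small height squeeze
    the indicators of half-lines. *)

Require Import Defs.
From HB Require Import structures.
From mathcomp Require Import all_boot all_order all_algebra.
From mathcomp Require Import complex.
From mathcomp Require Import all_classical all_reals all_analysis.
From mathcomp Require Import measurable_realfun ring lra.
Import Order.TTheory GRing.Theory Num.Theory.
Import numFieldNormedType.Exports.
Local Open Scope classical_set_scope.
Local Open Scope ring_scope.
Local Open Scope complex_scope.
Set Implicit Arguments.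
Unset Strict Implicit.
Unset Printing Implicit Defensive.

(** * Integration over independent coordinates *)

(** Independence is given only as a product formula for events. One fact turns it into analysis:
    resampling any set of coordinates from a second copy of the probability space leaves the law of
    the array unchanged. Fubini on [P \x P] then gives both the factorization of expectations and
    the integration of one block at a time. Two features make the expansion close. Nothing controls
    [E [M i j ^ 2]] beyond its size, but it multiplies [G j i ^ 2], whose sum over [j] is bounded by
    the Ward identity, and each variance is O(1/n). And [E [G i i * G j j]] is decoupled only after
    summation against [S i j], where concentration of a weighted trace is enough. For stability put
    [b i = z + \sum_j S i j * g j]. An exact solution has [g i = - 1 / b i], so
    [Im (g i) = Im (b i) / |b i| ^ 2] and hence [\sum_j S i j * Im (g j) < |b i| ^ 2 * Im (g i)].
    This makes the quadratic form of [S] at most that of the diagonal matrix of the [|b i|], while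
    [(g i - m) * b i = - m * \sum_j S i j * (g j - m)] brings the extra factor [|m| < 1]. *)

Section independence.
Context (R : realType) d (T : measurableType d) (P : probability T R).
Context (I : finType) dV (V : measurableType dV).
Variable (D : pred I).
Implicit Types (X : I -> T -> V) (K : pred I) (x y : I -> V).

(** Only coordinates in [D] are constrained: the lower triangle of a Hermitian array is a function
    of the upper one, so the sigma-algebra used for independence must not see it. *)
Definition rect (B : I -> set V) : set (I -> V) :=
  [set x | forall i, D i -> B i (x i)].

Definition rects : set (set (I -> V)) :=
  [set A | exists2 B, (forall i, measurable (B i)) & A = rect B].

Definition rects_sigma : measurableType _ := g_sigma_algebraType rects.

(* Measurability with respect to the product sigma-algebra of the coordinates
   in [D], tested against all measurable families. *)
Definition mfunc d' (V' : measurableType d') (F : (I -> V) -> V') :=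
  forall d1 (T1 : measurableType d1) (Y : I -> T1 -> V),
    (forall i, D i -> measurable_fun setT (Y i)) ->
    measurable_fun setT (fun t => F (Y^~ t)).

Definition mix K x y : I -> V := fun i => if K i then x i else y i.

Lemma measurable_coord i : D i ->
  measurable_fun setT (fun x : rects_sigma => x i).
Proof.
move=> Di _ B mB; rewrite setTI; apply: sub_sigma_algebra.
exists (fun j => if j == i then B else setT).
  by move=> j; case: ifP.
apply/seteqP; split => x /=.
  by move=> Bx j Dj; case: eqP => // ->.
by move=> /(_ i Di); rewrite eqxx.
Qed.

Lemma mfunc_sigma d' (V' : measurableType d') (F : (I -> V) -> V') :
  mfunc F -> measurable_fun setT (F : rects_sigma -> V').
Proof.
move=> mF; apply: (mF _ rects_sigma (fun i x => x i)) => i Di.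
exact: measurable_coord.
Qed.

Lemma preimage_rect (T1 : Type) (Y : I -> T1 -> V) B :
  (fun t => Y^~ t) @^-1` rect B = \bigcap_(i in [set` D]) (Y i @^-1` B i).
Proof. by apply/seteqP; split => t /= Yt i /Yt. Qed.

Lemma measurable_sigma d1 (T1 : measurableType d1) (Y : I -> T1 -> V) :
  (forall i, D i -> measurable_fun setT (Y i)) ->
  measurable_fun setT (fun t => Y^~ t : rects_sigma).
Proof.
move=> mY; apply: (@measurability _ _ _ rects_sigma _ _ rects) => // _ [_ [B mB ->] <-].
rewrite setTI preimage_rect; apply: fin_bigcap_measurable => // i Di.
by rewrite -[X in measurable X]setTI; exact: mY.
Qed.

Variable X : I -> T -> V.
Hypothesis mX : forall i, D i -> measurable_fun setT (X i).
Hypothesis indX : mutually_independent P D X.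

Lemma mutually_independentE (J : {set I}) B : {subset J <= D} ->
  (forall i, measurable (B i)) ->
  P (\bigcap_(i in [set` J]) (X i @^-1` B i)) =
  (\prod_(i in J) P (X i @^-1` B i))%E.
Proof. by move=> JD mB; exact: indX. Qed.

Definition mixX K (w : T * T) : I -> V := mix K (X^~ w.1) (X^~ w.2).

Lemma measurable_mixcoord K i : D i ->
  measurable_fun setT (fun w => mixX K w i).
Proof.
move=> Di; rewrite /mixX /mix; case: (K i).
  exact: (measurableT_comp (mX Di) measurable_fst).
exact: (measurableT_comp (mX Di) measurable_snd).
Qed.

(** Both laws are probabilities, so it is enough to compare them on the boxes, which are stable
    under intersection. On a box the product measure splits into the factors indexed by [K] and by
    its complement, and independence recombines them. *)
Lemma mixX_law K (A : set rects_sigma) : measurable A ->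
  pushforward P (fun w => X^~ w : rects_sigma) A =
  pushforward (P \x P)%E (fun w => mixX K w : rects_sigma) A.
Proof.
pose mXs := measurable_sigma mX.
have mMs := measurable_sigma (@measurable_mixcoord K).
move=> mA.
pose pushM := measure_function_pushforward__canonical__measure_function_Measure.
apply: (@measure_unique _ R rects_sigma rects (fun=> setT) _ _ _ _
  (pushM _ _ _ _ _ P _ mXs) (pushM _ _ _ _ _ (P \x P)%E _ mMs)) => //.
- move=> _ _ [B1 mB1 ->] [B2 mB2 ->].
  exists (fun i => B1 i `&` B2 i).
    by move=> i; exact: measurableI.
  apply/seteqP; split => x /=.
    by move=> [h1 h2] i Di; split; [exact: h1|exact: h2].
  by move=> h; split => i Di; have [] := h i Di.
- move=> _; exists (fun=> setT) => //.
  by apply/seteqP; split.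
- by rewrite bigcup_const.
- move=> _ [B mB ->]; rewrite /pushforward /mixX.
  pose J1 := [set i | D i && K i]%SET; pose J2 := [set i | D i && ~~ K i]%SET.
  have mXB i : D i -> measurable (X i @^-1` B i).
    by move=> Di; rewrite -[X in measurable X]setTI; exact: mX.
  have mJ (J : {set I}) : {subset J <= D} ->
      measurable (\bigcap_(i in [set` J]) (X i @^-1` B i)).
    by move=> JD; apply: fin_bigcap_measurable => // i /= /JD Di; exact: mXB.
  have J1D : {subset J1 <= D} by move=> i; rewrite inE => /andP[].
  have J2D : {subset J2 <= D} by move=> i; rewrite inE => /andP[].
  transitivity (P (\bigcap_(i in [set` [set i | D i]%SET]) (X i @^-1` B i))).
    congr (P _).
    apply/seteqP; split => t Yt i.
      by move=> /= iD; apply: Yt; rewrite inE in iD.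
    by move=> Di; apply: Yt; rewrite /= inE.
  transitivity ((P \x P)%E ((\bigcap_(i in [set` J1]) (X i @^-1` B i)) `*`
     (\bigcap_(i in [set` J2]) (X i @^-1` B i)))); last first.
    congr ((P \x P)%E _).
    apply/seteqP; split => [[t t'] /= [h1 h2] i Di|[t t'] /= h].
      rewrite /mix /=; case: ifPn => Ki.
        by apply: (h1 i); rewrite /= inE Di Ki.
      by apply: (h2 i); rewrite /= inE Di Ki.
    split => i /=; rewrite inE => /andP[Di Ki]; have := h i Di; rewrite /mix/=.
      by rewrite Ki.
    by rewrite (negbTE Ki).
  rewrite product_measure1E; [|exact: mJ|exact: mJ].
  have J0D : {subset [set i | D i]%SET <= D} by move=> i; rewrite inE.
  rewrite (mutually_independentE J0D mB) (bigID K)/=.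
  congr (_ * _)%E; apply/esym.
    etransitivity; first exact: (mutually_independentE J1D mB).
    by apply: eq_bigl => i; rewrite !inE.
  etransitivity; first exact: (mutually_independentE J2D mB).
  by apply: eq_bigl => i; rewrite !inE.
- by move=> k; rewrite [X in (X < _)%E](_ : _ = 1%E) ?ltry//; exact: probability_setT.
Qed.

Definition reads K U (F : (I -> V) -> U) :=
  forall x y, (forall i, D i -> K i -> x i = y i) -> F x = F y.

Lemma integrable_mixX K (F : (I -> V) -> R) : mfunc F ->
  P.-integrable setT (fun w => (F (X^~ w))%:E) ->
  (P \x P)%E.-integrable setT (fun w => (F (mixX K w))%:E) /\
  (\int[P]_w (F (X^~ w))%:E = \int[(P \x P)%E]_w (F (mixX K w))%:E)%E.
Proof.
move=> mF iF.
have mXs := measurable_sigma mX.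
have mMs := measurable_sigma (@measurable_mixcoord K).
pose pushM := measure_function_pushforward__canonical__measure_function_Measure.
pose m1 : {measure set rects_sigma -> \bar R} := pushM _ _ _ _ _ P _ mXs.
pose m2 : {measure set rects_sigma -> \bar R} := pushM _ _ _ _ _ (P \x P)%E _ mMs.
have m12 (f : rects_sigma -> \bar R) : (\int[m1]_x f x = \int[m2]_x f x)%E.
  by apply: eq_measure_integral => A mA _; exact: mixX_law.
pose FE : rects_sigma -> \bar R := fun x => (F x)%:E.
have mFE : measurable_fun setT FE by apply: measurableT_comp; [exact: EFin_measurable|exact: mfunc_sigma].
have maFE : measurable_fun setT (abse \o FE) by exact: measurableT_comp.
have iM : (P \x P)%E.-integrable setT (fun w => (F (mixX K w))%:E).
  apply/integrableP; split; first exact: (measurableT_comp mFE mMs).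
  have h2 : (\int[m2]_x (abse \o FE) x = \int[(P \x P)%E]_w `|(F (mixX K w))%:E|)%E.
    have := @ge0_integral_pushforward _ _ _ _ R _ mMs (P \x P)%E setT _
      measurableT maFE; rewrite preimage_setT; apply.
    by move=> y _ /=.
  have h1 : (\int[m1]_x (abse \o FE) x = \int[P]_w `|(F (X^~ w))%:E|)%E.
    have := @ge0_integral_pushforward _ _ _ _ R _ mXs P setT _
      measurableT maFE; rewrite preimage_setT; apply.
    by move=> y _ /=.
  rewrite -h2 -m12 h1.
  by case/integrableP : iF.
split=> //.
have h1 : (\int[m1]_x FE x = \int[P]_w (F (X^~ w))%:E)%E.
  have := @integral_pushforward _ _ _ _ R _ mXs P setT _ mFE.
  by rewrite preimage_setT; apply.
have h2 : (\int[m2]_x FE x = \int[(P \x P)%E]_w (F (mixX K w))%:E)%E.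
  have := @integral_pushforward _ _ _ _ R _ mMs (P \x P)%E setT _ mFE.
  by rewrite preimage_setT; apply.
by rewrite -h1 -h2 m12.
Qed.

End independence.

(** * Integrals and exponential moments of bounded variables *)

Section bounded_integrals.
Context (R : realType) d (T : measurableType d) (P : probability T R).
Implicit Types f g : T -> R.

Lemma bounded_integrable f (B : R) : measurable_fun setT f ->
  (forall w, `|f w| <= B) -> P.-integrable setT (EFin \o f).
Proof.
move=> mf fB; apply: measurable_bounded_integrable => //.
  by apply: (le_lt_trans (probability_le1 P measurableT)); rewrite ltry.
exists B; split; first exact: num_real.
by move=> M BM w _ /=; rewrite (le_trans (fB w))// ltW.
Qed.

Lemma Rintegral_const (c : R) : \int[P]_w c = c.
Proof. by rewrite Rintegral_cst//= probability_setT mulr1. Qed.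

Lemma Rintegral_fineK f : P.-integrable setT (EFin \o f) ->
  (\int[P]_w (f w)%:E)%E = (\int[P]_w f w)%:E.
Proof. by move=> fi; rewrite /Rintegral fineK//; exact: integrable_fin_num. Qed.

Lemma EFin_integrableD f g : P.-integrable setT (EFin \o f) ->
  P.-integrable setT (EFin \o g) ->
  P.-integrable setT (EFin \o (fun w => f w + g w)).
Proof. by move=> fi gi; have := integrableD measurableT fi gi; exact: eq_integrable. Qed.

Lemma EFin_integrableB f g : P.-integrable setT (EFin \o f) ->
  P.-integrable setT (EFin \o g) ->
  P.-integrable setT (EFin \o (fun w => f w - g w)).
Proof. by move=> fi gi; have := integrableB measurableT fi gi; exact: eq_integrable. Qed.

Lemma EFin_integrableZ c f : P.-integrable setT (EFin \o f) ->
  P.-integrable setT (EFin \o (fun w => c * f w)).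
Proof. by move=> fi; have := integrableZl measurableT c fi; exact: eq_integrable. Qed.

Lemma Rintegral_le f g : P.-integrable setT (EFin \o f) ->
  P.-integrable setT (EFin \o g) -> (forall w, f w <= g w) ->
  \int[P]_w f w <= \int[P]_w g w.
Proof. by move=> fi gi fg; apply: le_Rintegral. Qed.

Lemma Rintegral_bound f c : P.-integrable setT (EFin \o f) ->
  (forall w, `|f w| <= c) -> `|\int[P]_w f w| <= c.
Proof.
move=> fi fc; rewrite (le_trans (le_normr_Rintegral measurableT fi))//.
rewrite -[leRHS](Rintegral_const c); apply: Rintegral_le => //.
  exact: integrable_norm.
exact: finite_measure_integrable_cst.
Qed.

(** Since [1 - u <= expR (- u)], it suffices that [(1 + u + 2 * u ^+ 2) * (1 - u) = 1 + u ^+ 2 * (1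
    - 2 * u)] is at least 1, which is where the bound on [u] comes from. *)
Lemma expR_le_quadratic (u : R) : u <= 2^-1 -> expR u <= 1 + u + 2 * u ^+ 2.
Proof.
move=> u2; have u1 : 0 < 1 - u by lra.
rewrite -(ler_pM2r u1); apply: (@le_trans _ _ 1); last by nra.
have := expRxMexpNx_1 u => e1.
rewrite -[leRHS]e1 ler_pM2l ?expR_gt0//.
exact: expR_ge1Dx.
Qed.

(** A weak form of Hoeffding's lemma: the linear term of the quadratic bound on [expR] integrates to
    zero. *)
Lemma centered_mgf f c l : measurable_fun setT f -> (forall w, `|f w| <= c) ->
  \int[P]_w f w = 0 -> `|l| * c <= 2^-1 ->
  \int[P]_w expR (l * f w) <= expR (2 * (l * c) ^+ 2).
Proof.
move=> mf fc f0 lc.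
have lf w : `|l * f w| <= `|l| * c by rewrite normrM ler_wpM2l.
have fi : P.-integrable setT (EFin \o (fun w => l * f w)).
  apply: (@bounded_integrable _ (`|l| * c)) => //.
  exact: measurable_funM.
apply: (@le_trans _ _ (\int[P]_w ((1 + 2 * (l * c) ^+ 2) + l * f w))).
  apply: Rintegral_le.
  - apply: (@bounded_integrable _ (expR (`|l| * c))) => [|w].
      apply: measurableT_comp => //; exact: measurable_funM.
    by rewrite ger0_norm ?expR_ge0// ler_expR (le_trans (ler_norm _)).
  - apply: (@bounded_integrable _ (`|1 + 2 * (l * c) ^+ 2| + `|l| * c)) => [|w].
      by apply: measurable_funD => //; exact: measurable_funM.
    by rewrite (le_trans (ler_normD _ _))// lerD2l.
  - move=> w; apply: (le_trans (expR_le_quadratic _)).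
      by rewrite (le_trans (ler_norm _))// (le_trans (lf w)).
    have : (l * f w) ^+ 2 <= (l * c) ^+ 2.
      rewrite !exprMn ler_wpM2l ?sqr_ge0// -[leLHS]real_normK ?num_real//.
      rewrite ler_sqr ?nnegrE//.
      exact: le_trans (fc w).
    by lra.
rewrite RintegralD//; last exact: finite_measure_integrable_cst.
rewrite Rintegral_const RintegralZl//; last first.
  exact: (bounded_integrable mf fc).
by rewrite f0 mulr0 addr0 expR_ge1Dx.
Qed.

End bounded_integrals.

(** * Factorization, and integration of one block of coordinates at a time *)

Section independent_blocks.
Context (R : realType) d (T : measurableType d) (P : probability T R).
Context (I : finType) dV (V : measurableType dV).
Variables (D : pred I) (X : I -> T -> V).
Hypothesis mX : forall i, D i -> measurable_fun setT (X i).
Hypothesis indX : mutually_independent P D X.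
Implicit Types (F : (I -> V) -> R) (K : pred I) (x y : I -> V).

Lemma mfuncX F : mfunc D F -> measurable_fun setT (fun w => F (X^~ w)).
Proof. by move=> mF; exact: mF. Qed.

(** After resampling the coordinates outside [K], [f] sees only the first copy and [g] only the
    second, so Fubini splits the integral. Only [g] is bounded, because [f] will be an entry of the
    matrix or its square. *)
Lemma Rintegral_mul_indep K (f g : (I -> V) -> R) (B : R) :
  mfunc D f -> mfunc D g ->
  P.-integrable setT (fun w => (f (X^~ w))%:E) ->
  (forall x, `|g x| <= B) ->
  reads D K f -> reads D (predC K) g ->
  \int[P]_w (f (X^~ w) * g (X^~ w)) =
  \int[P]_w f (X^~ w) * \int[P]_w g (X^~ w).
Proof.
move=> mf mg fi gB rf rg.
have gi : P.-integrable setT (EFin \o (fun w => g (X^~ w))).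
  by apply: (@bounded_integrable _ _ _ _ _ B); [exact: mfuncX|move=> w; exact: gB].
have mfg : mfunc D (fun x => f x * g x).
  by move=> d1 T1 Y mY; apply: measurable_funM; [exact: mf|exact: mg].
have fgi : P.-integrable setT (fun w => (f (X^~ w) * g (X^~ w))%:E).
  have bg : [bounded g (X^~ w) | w in setT].
    exists B; split; first exact: num_real.
    by move=> M BM w _ /=; rewrite (le_trans (gB _))// ltW.
  have := integrableMl measurableT fi (mfuncX mg) bg.
  by apply: eq_integrable.
have [iM eM] := integrable_mixX mX indX K mfg fgi.
rewrite /Rintegral eM -integral12_prod_meas1//=.
under eq_integral => w _.
  have -> : fubini_F P (fun z => (f (mixX X K z) * g (mixX X K z))%:E) w =
      (f (X^~ w) * \int[P]_w g (X^~ w))%:E.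
    rewrite /fubini_F /=.
    under eq_integral => w' _.
      rewrite (rf _ (X^~ w)); last by move=> i _ Ki; rewrite /mixX /mix Ki.
      rewrite (rg _ (X^~ w')); last first.
        by move=> i _ /negbTE Ki; rewrite /mixX /mix Ki.
      rewrite EFinM.
      over.
    by rewrite integralZl// Rintegral_fineK.
  rewrite EFinM.
  over.
by rewrite integralZr// fineM//; exact: integrable_fin_num.
Qed.

(** A version of the conditional expectation given the coordinates outside [K], defined at every
    array and not merely almost surely, so that bounded differences make sense pointwise. *)
Definition integrate_out K F : (I -> V) -> R :=
  fun x => \int[P]_w F (mix K (X^~ w) x).

Lemma mfunc_mix K F x : mfunc D F ->
  measurable_fun setT (fun w => F (mix K (X^~ w) x)).
Proof.
move=> mF; apply: (mF _ _ (fun i w => if K i then X i w else x i)) => i Di.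
by case: (K i) => //; exact: mX.
Qed.

Lemma integrable_mix K F x (B : R) : mfunc D F -> (forall x, `|F x| <= B) ->
  P.-integrable setT (EFin \o (fun w => F (mix K (X^~ w) x))).
Proof.
move=> mF FB; apply: (@bounded_integrable _ _ _ _ _ B) => //.
exact: mfunc_mix.
Qed.

Lemma integrate_out_bound K F B x : mfunc D F -> (forall x, `|F x| <= B) ->
  `|integrate_out K F x| <= B.
Proof. by move=> mF FB; apply: Rintegral_bound => //; exact: integrable_mix FB. Qed.

Lemma mfunc_integrate_out K F (B : R) : mfunc D F -> (forall x, `|F x| <= B) ->
  mfunc D (integrate_out K F).
Proof.
move=> mF FB d1 T1 Y mY.
(* The shift by [B] makes the integrand nonnegative, so that Tonelli gives measurability of the
   inner integral. *)
pose f (p : T1 * T) : \bar R := (F (mix K (X^~ p.2) (Y^~ p.1)) + B)%:E.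
have mf : measurable_fun setT f.
  apply: measurableT_comp; first exact: EFin_measurable.
  apply: measurable_funD => //.
  apply: (mF _ _ (fun i p => if K i then X i p.2 else Y i p.1)) => i Di.
  case: (K i); first exact: (measurableT_comp (mX Di) measurable_snd).
  exact: (measurableT_comp (mY i Di) measurable_fst).
have f0 p : (0 <= f p)%E.
  by rewrite /f lee_fin -lerBlDr sub0r; have := FB (mix K (X^~ p.2) (Y^~ p.1));
    rewrite ler_norml => /andP[].
have mg : measurable_fun setT (fubini_F P f).
  by apply: measurable_fun_fubini_tonelli_F.
 rewrite (_ : (fun t => _) =
    fun t => fine (fubini_F P f t) - B); last first.
  apply/funext => t; rewrite /fubini_F /f /integrate_out.
  rewrite -[fine _]/(\int[P]_w (F (mix K (X^~ w) (Y^~ t)) + B)).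
  rewrite RintegralD ?Rintegral_const ?addrK//.
    exact: integrable_mix FB.
  exact: finite_measure_integrable_cst.
apply: measurable_funB => //.
exact: measurableT_comp mg.
Qed.

Lemma Rintegral_integrate_out K F (B : R) : mfunc D F -> (forall x, `|F x| <= B) ->
  \int[P]_w F (X^~ w) = \int[P]_w integrate_out K F (X^~ w).
Proof.
move=> mF FB.
have iF : P.-integrable setT (fun w => (F (X^~ w))%:E).
  by apply: (@bounded_integrable _ _ _ _ _ B); [exact: mfuncX|].
have [iM eM] := integrable_mixX mX indX K mF iF.
rewrite /Rintegral eM -integral21_prod_meas1//=; congr fine.
apply: eq_integral => w _; rewrite /fubini_G /integrate_out.
by rewrite -Rintegral_fineK//; exact: integrable_mix FB.
Qed.

Variable (beta : I -> nat).

(** The condition of McDiarmid's inequality, with the coordinates grouped into blocks by [beta]. *)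
Definition bounded_difference c F := forall (k : nat) x y,
  (forall i, D i -> beta i != k -> x i = y i) -> `|F x - F y| <= c.

(* Blocks are integrated out one at a time, each costing a factor
   [expR (2 * (l * c) ^+ 2)] by [centered_mgf]. *)
Lemma bounded_difference_mgf N F (B c l : R) : mfunc D F -> (forall x, `|F x| <= B) ->
  reads D [pred i | (beta i < N)%N] F -> bounded_difference c F ->
  `|l| * c <= 2^-1 ->
  \int[P]_w expR (l * (F (X^~ w) - \int[P]_w F (X^~ w))) <=
  expR (2 * N%:R * (l * c) ^+ 2).
Proof.
move=> + + + + lc; elim: N F => [|N IH] F mF FB rF bF.
  have Fc x y : F x = F y by exact: rF.
  under eq_Rintegral => w _.
    rewrite (_ : _ - _ = 0); last first.
      apply/eqP; rewrite subr_eq0; apply/eqP.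
      rewrite -[LHS](Rintegral_const P); apply: eq_Rintegral => w' _; exact: Fc.
    rewrite mulr0 expR0.
    over.
  by rewrite Rintegral_const mulr0 mul0r expR0.
pose K := [pred i | beta i == N]; pose F' := integrate_out K F.
have mF' : mfunc D F' by exact: mfunc_integrate_out FB.
have F'B x : `|F' x| <= B by exact: integrate_out_bound.
have rF' : reads D [pred i | (beta i < N)%N] F'.
  move=> x y xy; rewrite /F' /integrate_out; apply: eq_Rintegral => w _.
  apply: rF => i Di /=; rewrite ltnS leq_eqVlt /mix /=; case: eqP => //= _.
  exact: xy.
have bF' : bounded_difference c F'.
  move=> k x y xy; rewrite /F' /integrate_out -RintegralB//; last 2 first.
  - exact: integrable_mix FB.
  - exact: integrable_mix FB.
  apply: Rintegral_bound.
    by apply: EFin_integrableB => //; exact: integrable_mix FB.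
  move=> w; apply: (bF k) => i Di ik; rewrite /mix; case: ifP => // _.
  exact: xy.
set e := \int[P]_w F (X^~ w).
have eF' : e = \int[P]_w F' (X^~ w) by exact: Rintegral_integrate_out FB.
have eB : `|e| <= B.
  by apply: Rintegral_bound => //; apply: (@bounded_integrable _ _ _ _ _ B) => //;
    exact: mfuncX.
have mE (G : (I -> V) -> R) : mfunc D G -> mfunc D (fun x => expR (l * (G x - e))).
  move=> mG d1 T1 Y mY; apply: measurableT_comp => //.
  apply: measurable_funM => //; apply: measurable_funB => //; exact: mG.
have bE (G : (I -> V) -> R) : (forall x, `|G x| <= B) ->
    forall x, `|expR (l * (G x - e))| <= expR (`|l| * (B + B)).
  move=> GB x; rewrite ger0_norm ?expR_ge0// ler_expR (le_trans (ler_norm _))//.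
  by rewrite normrM ler_wpM2l// (le_trans (ler_normB _ _))// lerD.
rewrite (Rintegral_integrate_out K (mE _ mF) (bE _ FB)).
apply: (@le_trans _ _ (\int[P]_w (expR (2 * (l * c) ^+ 2) *
    expR (l * (F' (X^~ w) - e))))).
  apply: Rintegral_le.
  - apply: (@bounded_integrable _ _ _ _ _ (expR (`|l| * (B + B)))).
      by apply: mfuncX; apply: mfunc_integrate_out (mE _ mF) (bE _ FB).
    by move=> w; apply: integrate_out_bound (mE _ mF) (bE _ FB).
  - apply: (@bounded_integrable _ _ _ _ _
      (expR (2 * (l * c) ^+ 2) * expR (`|l| * (B + B)))) => [|w].
      by apply: measurable_funM => //; exact: (mfuncX (mE _ mF')).
    by rewrite normrM ger0_norm ?expR_ge0// ler_wpM2l ?expR_ge0// bE.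
  - move=> w; rewrite /integrate_out; set x := X^~ w.
    (* With all blocks but [N] frozen, [Y] is centered; it is bounded by [c] because [F' x] averages
       [F] over arrays that differ from the given one in block [N] only. *)
    pose Y w' := F (mix K (X^~ w') x) - F' x.
    under eq_Rintegral => w' _.
      rewrite (_ : l * _ = l * (F' x - e) + l * Y w'); last by rewrite /Y; ring.
      rewrite expRD; over.
    have mY : measurable_fun setT Y by apply: measurable_funB => //; exact: mfunc_mix.
    have Yc w' : `|Y w'| <= c.
      rewrite /Y /F' /integrate_out -[X in X - _](Rintegral_const P) -RintegralB//.
      + apply: Rintegral_bound.
          apply: EFin_integrableB => //; last exact: integrable_mix FB.
          exact: finite_measure_integrable_cst.
        move=> w''; apply: (bF N) => i Di; rewrite /mix /= => /negbTE ->//.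
      + exact: finite_measure_integrable_cst.
      + exact: integrable_mix FB.
    have Y0 : \int[P]_w' Y w' = 0.
      rewrite RintegralB//; last 2 first.
      + exact: integrable_mix FB.
      + exact: finite_measure_integrable_cst.
      by rewrite Rintegral_const subrr.
    rewrite RintegralZl//; last first.
      apply: (@bounded_integrable _ _ _ _ _ (expR (`|l| * c))) => [|w'].
        by apply: measurableT_comp => //; exact: measurable_funM.
      rewrite ger0_norm ?expR_ge0// ler_expR (le_trans (ler_norm _))//.
      by rewrite normrM ler_wpM2l.
    by rewrite mulrC ler_wpM2r ?expR_ge0// (centered_mgf mY Yc).
rewrite RintegralZl//; last first.
  apply: (@bounded_integrable _ _ _ _ _ (expR (`|l| * (B + B)))); last by move=> w; exact: bE.
  exact: (mfuncX (mE _ mF')).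
rewrite (_ : 2 * N.+1%:R * _ = 2 * (l * c) ^+ 2 + 2 * N%:R * (l * c) ^+ 2); last first.
  by rewrite -natr1; ring.
by rewrite expRD ler_wpM2l ?expR_ge0// eF' IH.
Qed.

End independent_blocks.

(** * Complex modulus and resolvents *)

Section modulus.
Variable R : realType.
Implicit Types (u v z : R[i]).
Local Notation Re := complex.Re.
Local Notation Im := complex.Im.

Lemma sqr_cmod z : cmod z ^+ 2 = Re z ^+ 2 + Im z ^+ 2.
Proof. by case: z => a b; rewrite /cmod /= sqr_sqrtr// addr_ge0 ?sqr_ge0. Qed.

Lemma cmod_ge0 z : 0 <= cmod z.
Proof. by case: z => a b; rewrite sqrtr_ge0. Qed.

Lemma cmod0 : cmod (0 : R[i]) = 0.
Proof. exact: ComplexField.Normc.normc0. Qed.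

Lemma cmod_eq0 z : (cmod z == 0) = (z == 0).
Proof.
by apply/eqP/eqP => [/ComplexField.Normc.eq0_normc//|->]; exact: cmod0.
Qed.

Lemma cmod_gt0 z : (0 < cmod z) = (z != 0).
Proof. by rewrite lt_def cmod_ge0 andbT cmod_eq0. Qed.

Lemma cmodM u v : cmod (u * v) = cmod u * cmod v.
Proof. exact: ComplexField.Normc.normcM. Qed.

Lemma cmodX z n : cmod (z ^+ n) = cmod z ^+ n.
Proof.
elim: n => [|n IH]; first by rewrite !expr0; exact: ComplexField.Normc.normc1.
by rewrite !exprS cmodM IH.
Qed.

Lemma cmodV z : cmod z^-1 = (cmod z)^-1.
Proof. exact: ComplexField.Normc.normcV. Qed.

Lemma cmodN z : cmod (- z) = cmod z.
Proof. exact: normcN. Qed.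

Lemma cmodD u v : cmod (u + v) <= cmod u + cmod v.
Proof. exact: le_normcD. Qed.

Lemma cmodB u v : cmod (u - v) <= cmod u + cmod v.
Proof. by rewrite (le_trans (cmodD _ _))// cmodN. Qed.

Lemma cmod_sum (I : Type) (s : seq I) (P : pred I) (F : I -> R[i]) :
  cmod (\sum_(i <- s | P i) F i) <= \sum_(i <- s | P i) cmod (F i).
Proof.
elim/big_ind2 : _ => //; first by rewrite cmod0.
by move=> u a v b ua vb; rewrite (le_trans (cmodD _ _))// lerD.
Qed.

Lemma cmod_conj z : cmod (conjc z) = cmod z.
Proof. by case: z => a b; rewrite /cmod /= sqrrN. Qed.

Lemma cmod_real (r : R) : cmod r%:C = `|r|.
Proof. by rewrite /cmod /= expr0n addr0 sqrtr_sqr. Qed.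

Lemma conjM_cmod z : conjc z * z = (cmod z ^+ 2)%:C.
Proof.
rewrite sqr_cmod; case: z => a b; simpc; congr (_ +i* _); ring.
Qed.

Lemma Re_cmod z : `|Re z| <= cmod z.
Proof.
rewrite -[leRHS]ger0_norm ?cmod_ge0// -ler_sqr ?nnegrE// !real_normK ?num_real//.
by rewrite sqr_cmod lerDl sqr_ge0.
Qed.

Lemma Im_cmod z : `|Im z| <= cmod z.
Proof.
rewrite -[leRHS]ger0_norm ?cmod_ge0// -ler_sqr ?nnegrE// !real_normK ?num_real//.
by rewrite sqr_cmod lerDr sqr_ge0.
Qed.

Lemma cmod_ReIm z : cmod z <= `|Re z| + `|Im z|.
Proof.
rewrite -ler_sqr ?nnegrE ?cmod_ge0 ?addr_ge0// sqr_cmod sqrrD !real_normK ?num_real//.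
by rewrite -addrA lerD2l lerDr mulrn_wge0// mulr_ge0.
Qed.

Lemma Im_zero : Im (0 : R[i]) = 0. Proof. by []. Qed.
Lemma Re_add u v : Re (u + v) = Re u + Re v. Proof. by case: u v => [? ?] [? ?]. Qed.
Lemma Im_add u v : Im (u + v) = Im u + Im v. Proof. by case: u v => [? ?] [? ?]. Qed.
Lemma Re_opp u : Re (- u) = - Re u. Proof. by case: u. Qed.
Lemma Im_opp u : Im (- u) = - Im u. Proof. by case: u. Qed.
Lemma Re_mul u v : Re (u * v) = Re u * Re v - Im u * Im v.
Proof. by case: u v => [? ?] [? ?]. Qed.
Lemma Im_mul u v : Im (u * v) = Re u * Im v + Im u * Re v.
Proof. by case: u v => [? ?] [? ?]. Qed.
Lemma Im_scale (r : R) v : Im (r%:C * v) = r * Im v.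
Proof. by rewrite Im_mul /= mul0r addr0. Qed.
Lemma Re_inv u : Re u^-1 = Re u / cmod u ^+ 2.
Proof. by rewrite sqr_cmod; case: u. Qed.
Lemma Im_inv u : Im u^-1 = - Im u / cmod u ^+ 2.
Proof. by rewrite sqr_cmod; case: u => a b /=; rewrite mulNr. Qed.

Lemma Im_sum (I : Type) (s : seq I) (P : pred I) (F : I -> R[i]) :
  Im (\sum_(i <- s | P i) F i) = \sum_(i <- s | P i) Im (F i).
Proof. by elim/big_rec2 : _ => // i a u _ <-; rewrite Im_add. Qed.

Lemma complex_ext u v : Re u = Re v -> Im u = Im v -> u = v.
Proof. by case: u v => [a b] [c e] /= -> ->. Qed.

End modulus.

(** * Resolvents: spectral form, Ward identity, removal of a row and column *)

Section resolvent.
Variables (R : realType) (n : nat).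
Implicit Types (M : 'M[R[i]]_n) (z : R[i]).
Local Notation Re := complex.Re.
Local Notation Im := complex.Im.

Definition herm M := forall i j, M i j = conjc (M j i).

Definition resolvent z M : 'M[R[i]]_n := invmx (M - z%:M).

Lemma hermsymmx_herm M : M \is hermsymmx -> herm M.
Proof.
move=> /is_hermitianmxP; rewrite expr0 scale1r => ME i j.
by rewrite {1}ME !mxE; apply: complex_ext; case: (M j i).
Qed.

Lemma herm_hermsymmx M : herm M -> M \is hermsymmx.
Proof.
move=> hM; apply/is_hermitianmxP; rewrite expr0 scale1r; apply/matrixP => i j.
by rewrite {1}hM !mxE; apply: complex_ext; case: (M j i).
Qed.

Section spectral.
Variables (M : 'M[R[i]]_n) (z : R[i]).
Hypotheses (hM : herm M) (z0 : 0 < Im z).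

Lemma spectral_diag_real i : Im (spectral_diag M 0 i) = 0.
Proof.
have /mxOverP /(_ 0 i) := hermitian_spectral_diag_real (herm_hermsymmx hM).
by case: (spectral_diag M 0 i) => a b; rewrite complex_real => /eqP.
Qed.

Lemma spectral_subr_neq0 i : spectral_diag M 0 i - z != 0.
Proof.
apply/eqP => /(congr1 (@complex.Im R)); rewrite Im_add Im_opp spectral_diag_real Im_zero sub0r => /eqP.
by rewrite oppr_eq0 gt_eqF.
Qed.

Let Q := spectralmx M.
Let D := spectral_diag M - const_mx z.

Let subrE : M - z%:M = invmx Q *m diag_mx D *m Q.
Proof.
have /hermitian_normalmx /orthomx_spectralP ME := herm_hermsymmx hM.
rewrite {1}ME raddfB /= mulmxBr mulmxBl -/Q; congr (_ - _).
rewrite diag_const_mx.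
by rewrite scalar_mxC -mulmxA mulVmx ?mulmx1// spectral_unit.
Qed.

Let D_unit : diag_mx D \in unitmx.
Proof.
rewrite unitmxE det_diag unitfE; apply/prodf_neq0 => i _.
by rewrite !mxE spectral_subr_neq0.
Qed.

Lemma resolvent_unit : M - z%:M \in unitmx.
Proof. by rewrite subrE !unitmx_mul unitmx_inv spectral_unit D_unit. Qed.

Lemma mxtrace_resolvent :
  \tr (resolvent z M) = \sum_(i < n) (spectral_diag M 0 i - z)^-1.
Proof.
rewrite /resolvent subrE.
have Qu : Q \in unitmx by exact: spectral_unit.
pose E : 'rV[R[i]]_n := \row_i (D 0 i)^-1.
have -> : invmx (invmx Q *m diag_mx D *m Q) = invmx Q *m diag_mx E *m Q.
  apply: (can_inj (mulKmx (_ : invmx Q *m diag_mx D *m Q \in unitmx))).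
    by rewrite !unitmx_mul unitmx_inv Qu D_unit.
  rewrite mulmxV ?unitmx_mul ?unitmx_inv ?Qu ?D_unit//.
  rewrite !mulmxA (mulmxK Qu) -(mulmxA (invmx Q)).
  rewrite mulmx_diag (_ : \row_j _ = const_mx 1).
    by rewrite diag_const_mx mulmx1 mulVmx.
  by apply/rowP => j; rewrite !mxE mulfV// spectral_subr_neq0.
rewrite -mulmxA mxtrace_mulC -mulmxA mulmxV// mulmx1 mxtrace_diag.
by apply: eq_bigr => i _; rewrite !mxE.
Qed.

End spectral.

Lemma Im_iR (r : R) : Im (r%:C * 'i) = r.
Proof. by rewrite /=; ring. Qed.

Lemma Im_iRR (r t : R) : Im (r%:C * 'i * t%:C) = r * t.
Proof. by rewrite /=; ring. Qed.

Lemma scale1i_conj z : z - conjc z = (2 * Im z)%:C * 'i.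
Proof. by case: z => a b; apply: complex_ext; rewrite /=; ring. Qed.

Section bounds.
Variables (M : 'M[R[i]]_n) (z : R[i]).
Hypotheses (hM : herm M) (z0 : 0 < Im z).
Local Notation G := (resolvent z M).
Local Notation y := (Im z).

Lemma mulVresolvent : G *m (M - z%:M) = 1%:M.
Proof. by rewrite mulVmx// resolvent_unit. Qed.

Lemma mulresolventV : (M - z%:M) *m G = 1%:M.
Proof. by rewrite mulmxV// resolvent_unit. Qed.

Definition adjmx (A : 'M[R[i]]_n) : 'M[R[i]]_n := \matrix_(i, j) conjc (A j i).

Lemma adjmxM (A B : 'M[R[i]]_n) : adjmx (A *m B) = adjmx B *m adjmx A.
Proof.
apply/matrixP => i j; rewrite !mxE rmorph_sum; apply: eq_bigr => k _.
by rewrite !mxE rmorphM mulrC.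
Qed.

Lemma adjmx1 : adjmx 1%:M = 1%:M.
Proof. by apply/matrixP => i j; rewrite !mxE eq_sym rmorph_nat. Qed.

Lemma adjmx_shift : adjmx (M - z%:M) = M - (conjc z)%:M.
Proof.
apply/matrixP => i j; rewrite !mxE rmorphB /= -hM rmorphMn /=.
by rewrite eq_sym.
Qed.

(** The resolvent identity between [G] and its adjoint, which is the resolvent at [conjc z]. One
    order of the product controls the columns of [G], the other its rows. *)
Lemma ward_mx : G - adjmx G = (z - conjc z) *: (adjmx G *m G) /\
  G - adjmx G = (z - conjc z) *: (G *m adjmx G).
Proof.
have a1 : (M - (conjc z)%:M) *m adjmx G = 1%:M.
  by rewrite -adjmx_shift -adjmxM mulVresolvent adjmx1.
have a2 : adjmx G *m (M - (conjc z)%:M) = 1%:M.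
  by rewrite -adjmx_shift -adjmxM mulresolventV adjmx1.
have e : (M - (conjc z)%:M) = (M - z%:M) + (z - conjc z)%:M.
  by rewrite raddfB /= addrA subrK.
split.
  have : adjmx G *m (M - (conjc z)%:M) *m G = G by rewrite a2 mul1mx.
  rewrite e mulmxDr mulmxDl -(mulmxA _ (M - z%:M)) mulresolventV mulmx1.
  by rewrite mul_mx_scalar -scalemxAl => {1}<-; rewrite addrAC subrr add0r.
have : G *m (M - (conjc z)%:M) *m adjmx G = G by rewrite -mulmxA a1 mulmx1.
rewrite e mulmxDr mulmxDl mulVresolvent mul1mx.
by rewrite mul_mx_scalar -scalemxAl => {1}<-; rewrite addrAC subrr add0r.
Qed.

Lemma ward_col i : \sum_k cmod (G k i) ^+ 2 = Im (G i i) / y.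
Proof.
have /matrixP /(_ i i) := (ward_mx).1.
rewrite !mxE !scale1i_conj.
rewrite (eq_bigr (fun k => (cmod (G k i) ^+ 2)%:C)); last first.
  by move=> k _; rewrite mxE conjM_cmod.
rewrite -rmorph_sum /= => /(congr1 (@complex.Im R)).
rewrite Im_iR Im_iRR -mulrA => /(mulfI _) -> //.
by rewrite mulrAC mulfV ?mul1r// gt_eqF.
Qed.

Lemma ward_row i : \sum_k cmod (G i k) ^+ 2 = Im (G i i) / y.
Proof.
have /matrixP /(_ i i) := (ward_mx).2.
rewrite !mxE !scale1i_conj.
rewrite (eq_bigr (fun k => (cmod (G i k) ^+ 2)%:C)); last first.
  by move=> k _; rewrite mxE mulrC conjM_cmod.
rewrite -rmorph_sum /= => /(congr1 (@complex.Im R)).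
rewrite Im_iR Im_iRR -mulrA => /(mulfI _) -> //.
by rewrite mulrAC mulfV ?mul1r// gt_eqF.
Qed.

(** The Ward identity stands in for an operator norm: [cmod (G i i) ^+ 2] is one term of a sum equal
    to [Im (G i i) / y], itself at most [cmod (G i i) / y]. *)
Lemma cmod_resolvent_diag i : cmod (G i i) <= y^-1.
Proof.
have [->|g0] := eqVneq (cmod (G i i)) 0; first by rewrite invr_ge0 ltW.
have gp : 0 < cmod (G i i) by rewrite lt_def g0 cmod_ge0.
have : cmod (G i i) ^+ 2 <= cmod (G i i) / y.
  apply: (@le_trans _ _ (\sum_k cmod (G k i) ^+ 2)).
    rewrite (bigD1 i)//= lerDl; apply: sumr_ge0 => k _; exact: sqr_ge0.
  rewrite ward_col ler_pM2r ?invr_gt0//.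
  exact: le_trans (ler_norm _) (Im_cmod _).
by rewrite expr2 ler_pM2l.
Qed.

Lemma sum_sqr_resolvent_col i : \sum_k cmod (G k i) ^+ 2 <= y ^- 2.
Proof.
rewrite ward_col -exprVn expr2 ler_pM2r ?invr_gt0//.
exact: le_trans (le_trans (ler_norm _) (Im_cmod _)) (cmod_resolvent_diag i).
Qed.

Lemma cmod_resolvent i j : cmod (G i j) <= y^-1.
Proof.
rewrite -ler_sqr ?nnegrE ?cmod_ge0 ?invr_ge0 ?(ltW z0)// exprVn.
apply: le_trans (sum_sqr_resolvent_col j).
by rewrite (bigD1 i)//= lerDl; apply: sumr_ge0 => k _; exact: sqr_ge0.
Qed.

Lemma Im_resolvent_ge0 i : 0 <= Im (G i i).
Proof.
have : 0 <= Im (G i i) / y.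
  by rewrite -ward_col; apply: sumr_ge0 => k _; exact: sqr_ge0.
by rewrite pmulr_lge0// invr_gt0.
Qed.

(** If [G k k] vanished, the Ward identity would make the whole column [k] of [G] zero, against the
    invertibility of [G]. *)
Lemma resolvent_diag_neq0 k : G k k != 0.
Proof.
apply/eqP => Gk0; have : \sum_l cmod (G l k) ^+ 2 = 0.
  by rewrite ward_col Gk0 Im_zero mul0r.
move/eqP; rewrite psumr_eq0; last by move=> l _; exact: sqr_ge0.
move=> /allP G0; have := mulresolventV => /matrixP /(_ k k).
rewrite !mxE eqxx big1 => [/eqP|l _]; first by rewrite eq_sym oner_eq0.
have := G0 l (mem_index_enum _); rewrite implyTb sqrf_eq0 cmod_eq0 => /eqP ->.
by rewrite mulr0.
Qed.

(* The resolvent of the minor of [M] without index [k], padded by zeros. *)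
Definition minor_resolvent k : 'M[R[i]]_n :=
  \matrix_(i, j) (G i j - G i k * G k j / G k k).

Lemma minor_resolvent_row k j : minor_resolvent k k j = 0.
Proof. by rewrite mxE mulrAC mulfV ?resolvent_diag_neq0// mul1r subrr. Qed.

Lemma mulmx_minor_resolvent k i j : i != k ->
  ((M - z%:M) *m minor_resolvent k) i j = (i == j)%:R.
Proof.
move=> ik; have e : minor_resolvent k = G - (col k G *m row k G) *m (G k k)^-1%:M.
  apply/matrixP => a b; rewrite mul_mx_scalar !mxE big_ord1 !mxE.
  by rewrite [X in _ - X]mulrC.
rewrite e mulmxBr !mulmxA colE !mulmxA mulresolventV mul1mx.
rewrite mul_mx_scalar !mxE big_ord1 !mxE (negbTE ik) mul0r mulr0 subr0.
by [].
Qed.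

End bounds.

Lemma resolvent_sub M M' z : herm M -> herm M' -> 0 < Im z ->
  resolvent z M - resolvent z M' =
  - (resolvent z M *m (M - M') *m resolvent z M').
Proof.
move=> hM hM' z0.
have -> : M - M' = (M - z%:M) - (M' - z%:M) by rewrite opprB addrA subrK.
rewrite mulmxBr mulVresolvent// mulmxBl mul1mx -mulmxA mulresolventV// mulmx1.
by rewrite opprB.
Qed.

(** Off row [k], both padded matrices solve the same linear system, so [M' - z] maps their
    difference to a matrix supported on row [k]. The difference is thus column [k] of the resolvent
    times a row; its own row [k] is zero, and since the [(k, k)] entry of the resolvent is not, that
    row vanishes. *)
Lemma minor_resolvent_eq M M' z k : herm M -> herm M' -> 0 < Im z ->
  (forall i j, i != k -> j != k -> M i j = M' i j) ->
  minor_resolvent M z k = minor_resolvent M' z k.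
Proof.
move=> hM hM' z0 MM'.
set H := minor_resolvent M z k; set H' := minor_resolvent M' z k.
have B'H i j : i != k -> ((M' - z%:M) *m H) i j = (i == j)%:R.
  move=> ik; rewrite -(mulmx_minor_resolvent hM z0 j ik) !mxE.
  apply: eq_bigr => l _; have [->|lk] := eqVneq l k.
    by rewrite /H minor_resolvent_row// !mulr0.
  by rewrite !mxE MM'.
have BD i j : i != k -> ((M' - z%:M) *m (H - H')) i j = 0.
  move=> ik; rewrite mulmxBr mxE B'H// mxE mulmx_minor_resolvent// subrr//.
have DE i j : (H - H') i j = resolvent z M' i k * ((M' - z%:M) *m (H - H')) k j.
  rewrite -[in LHS](mul1mx (H - H')) -(mulVresolvent hM' z0) -mulmxA mxE.
  rewrite (bigD1 k)//= big1 ?addr0// => l lk.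
  by rewrite BD// mulr0.
have r0 j : ((M' - z%:M) *m (H - H')) k j = 0.
  have e0 : (H - H') k j = 0.
    have -> : (H - H') k j = H k j - H' k j by rewrite mxE [X in _ + X]mxE.
    by rewrite /H /H' !minor_resolvent_row// subr0.
  have := DE k j; rewrite e0 => /esym/eqP.
  by rewrite mulf_eq0 (negbTE (resolvent_diag_neq0 hM' z0 k)) => /eqP.
apply/eqP; rewrite -subr_eq0; apply/eqP/matrixP => i j.
by rewrite DE r0 mulr0 mxE.
Qed.

(** The difference is [\sum_j w j * G j k * G k j / G k k]. Bounding each product by squares and
    summing with both Ward identities leaves [W / Im z * (Im (G k k) / |G k k|)]. Eigenvalue
    interlacing would treat constant weights only. *)
Lemma weighted_trace_minor M z k (w : 'I_n -> R) (W : R) :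
  herm M -> 0 < Im z -> (forall j, `|w j| <= W) ->
  cmod (\sum_j (w j)%:C * (resolvent z M j j - minor_resolvent M z k j j)) <= W / Im z.
Proof.
move=> hM z0 wW; set G := resolvent z M.
have W0 : 0 <= W by exact: le_trans (wW k).
have gk : 0 < cmod (G k k) by rewrite cmod_gt0 resolvent_diag_neq0.
apply: (le_trans (cmod_sum _ _ _)).
apply: (@le_trans _ _ (\sum_j (W / cmod (G k k) / 2) *
    (cmod (G j k) ^+ 2 + cmod (G k j) ^+ 2))).
  apply: ler_sum => j _; rewrite mxE -/G opprB addrC subrK.
  rewrite cmodM cmod_real !cmodM cmodV.
  rewrite (_ : _ / 2 * _ = W * ((cmod (G j k) ^+ 2 + cmod (G k j) ^+ 2) / 2 / cmod (G k k))); last by field; rewrite gt_eqF.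
  apply: ler_pM => //; first by rewrite !mulr_ge0 ?cmod_ge0// invr_ge0 cmod_ge0.
  rewrite ler_pM2r ?invr_gt0//.
  have := sqr_ge0 (cmod (G j k) - cmod (G k j)); rewrite sqrrB; lra.
rewrite -mulr_sumr big_split/= ward_col// ward_row// -/G.
have : Im (G k k) <= cmod (G k k) by exact: le_trans (ler_norm _) (Im_cmod _).
move=> ImG.
rewrite (_ : _ * _ = W / Im z * (Im (G k k) / cmod (G k k))); last first.
  by field; rewrite !gt_eqF.
by rewrite ler_piMr ?divr_ge0 ?(ltW z0)// ler_pdivrMr// mul1r.
Qed.

(** Both traces are compared with that of the common minor, hence the factor 2. *)
Lemma weighted_trace_row_change M M' z k (w : 'I_n -> R) (W : R) :
  herm M -> herm M' -> 0 < Im z -> (forall j, `|w j| <= W) ->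
  (forall i j, i != k -> j != k -> M i j = M' i j) ->
  cmod (\sum_j (w j)%:C * resolvent z M j j -
        \sum_j (w j)%:C * resolvent z M' j j) <= 2 * W / Im z.
Proof.
move=> hM hM' z0 wW MM'.
have h := weighted_trace_minor k hM z0 wW.
have h' := weighted_trace_minor k hM' z0 wW.
rewrite (_ : 2 * W / Im z = W / Im z + W / Im z); last by rewrite -mulrA mulr_natl mulr2n.
apply: le_trans (lerD h h'); apply: le_trans (cmodB _ _).
rewrite (minor_resolvent_eq hM hM' z0 MM') -sumrB -sumrB le_eqVlt; apply/orP; left.
by apply/eqP; congr cmod; apply: eq_bigr => j _; ring.
Qed.

End resolvent.

(** * Second-order expansion of the resolvent in one entry *)

Section entry_expansion.
Variables (R : realType) (n : nat).
Implicit Types (M : 'M[R[i]]_n) (z : R[i]).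
Local Notation Re := complex.Re.
Local Notation Im := complex.Im.

Lemma subr_mxE (U V : 'M[R[i]]_n) i j : (U - V) i j = U i j - V i j.
Proof. by rewrite !mxE. Qed.

(** The mirrored entry is cleared as well: the matrix stays Hermitian and no longer depends on the
    variable behind [M i j]. *)
Definition clear_entry M (i j : 'I_n) : 'M[R[i]]_n := \matrix_(k, l)
  if ((k == i) && (l == j)) || ((k == j) && (l == i)) then 0 else M k l.

Lemma herm_clear_entry M i j : herm M -> herm (clear_entry M i j).
Proof.
move=> hM k l; rewrite !mxE orbC ![_ && (k == _)]andbC.
by case: ifP => _; [rewrite rmorph0|exact: hM].
Qed.

(** The factor [(i != j)%:R] keeps a diagonal entry from being counted twice. *)
Lemma mulmx_clear_entry M (U V : 'M[R[i]]_n) i j k l : herm M ->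
  (U *m (M - clear_entry M i j) *m V) k l =
  M i j * U k i * V j l + (i != j)%:R * (conjc (M i j) * U k j * V i l).
Proof.
move=> hM.
have -> : M - clear_entry M i j =
    M i j *: delta_mx i j + ((i != j)%:R * conjc (M i j)) *: delta_mx j i.
  apply/matrixP => a b; rewrite !mxE.
  case: (eqVneq i j) => [<-{j}|ij] /=.
    rewrite !mul0r addr0 orbb; case: andP => [[/eqP -> /eqP ->]|_].
      by rewrite subr0 mulr1.
    by rewrite mulr0 subrr.
  case: (eqVneq a i) => [->|ai] /=.
    rewrite (negbTE ij) /= orbF mulr0 addr0; case: eqVneq => [->|_] /=.
      by rewrite subr0 mulr1.
    by rewrite mulr0 subrr.
  rewrite mulr0 add0r mul1r; case: andP => [[/eqP -> /eqP ->]|_].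
    by rewrite subr0 mulr1 -hM.
  by rewrite mulr0 subrr.
have dE a b : (U *m delta_mx a b *m V) k l = U k a * V b l.
  rewrite -(mul_delta_mx (0 : 'I_1)) mulmxA -colE -mulmxA -rowE.
  by rewrite !mxE big_ord1 !mxE.
rewrite mulmxDr mulmxDl -!scalemxAr -!scalemxAl.
by rewrite mxE [X in X + _]mxE [X in _ + X]mxE !dE !mulrA.
Qed.

Variables (M : 'M[R[i]]_n) (z : R[i]) (i j : 'I_n).
Hypotheses (hM : herm M) (z0 : 0 < Im z).
Local Notation G := (resolvent z M).
Local Notation M0 := (clear_entry M i j).
Local Notation G0 := (resolvent z M0).
Local Notation a := (M i j).
Local Notation y := (Im z).

Let hM0 : herm M0. Proof. exact: herm_clear_entry. Qed.

Let cmod_sandwich (U V : 'M[R[i]]_n) (u v : R) k l :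
  (forall k l, cmod (U k l) <= u) -> (forall k l, cmod (V k l) <= v) ->
  cmod ((U *m (M - M0) *m V) k l) <= 2 * cmod a * (u * v).
Proof.
move=> Uu Vv; have u0 := le_trans (cmod_ge0 _) (Uu i i).
rewrite mulmx_clear_entry// (le_trans (cmodD _ _))//.
have h p q r s : cmod (U p q) * cmod (V r s) <= u * v.
  by apply: ler_pM; rewrite ?cmod_ge0.
have -> : 2 * cmod a * (u * v) = cmod a * (u * v) + cmod a * (u * v) by ring.
apply: lerD.
  by rewrite !cmodM -mulrA ler_wpM2l ?cmod_ge0.
case: (i != j); last by rewrite mul0r cmod0 !mulr_ge0 ?cmod_ge0 ?(le_trans (cmod_ge0 _) (Vv i i)).
by rewrite mul1r !cmodM cmod_conj -mulrA ler_wpM2l ?cmod_ge0.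
Qed.

Lemma cmod_resolvent_clear_entry k l :
  cmod (G k l - G0 k l) <= 2 * cmod a * y ^- 2.
Proof.
rewrite -subr_mxE.
rewrite resolvent_sub// mxE cmodN -exprVn expr2.
by apply: cmod_sandwich => p q; exact: cmod_resolvent.
Qed.

(** The part of [a * G j i] of order at most two in the entry, read off from
    [G = G0 - G0 * (M - M0) * G0 + ...]. On the diagonal [a] is real, so the single second-order
    term fits the same formula. *)
Definition entry_main : R[i] := a * G0 j i - (cmod a ^+ 2)%:C * (G0 i i * G0 j j)
  - (i != j)%:R * (a ^+ 2 * G0 j i ^+ 2).

(** The remainder of [G j i] has two bounds: one linear in [|a|], from estimating [G - G0] and the
    first-order term separately, for large entries; one quadratic, from applying the resolvent
    identity twice, for small entries. Together they ask for no more than two moments. *)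
Lemma entry_expansion : cmod (a * G j i - entry_main) <=
  (4 * y ^- 2 + 4 * y ^- 3) * (cmod a ^+ 2 * Num.min 1 (cmod a)).
Proof.
set Q := G0 *m (M - M0) *m G0.
have QE : entry_main = a * (G0 j i - Q j i).
  rewrite /entry_main /Q mulmx_clear_entry//.
  have [ij|ij] /= := eqVneq i j.
    have ra : a = conjc a by rewrite {1}hM ij.
    by rewrite !mul0r subr0 -conjM_cmod -ra -ij; ring.
  by rewrite -conjM_cmod; ring.
have a0 := cmod_ge0 a; have y0 : 0 <= y by exact: ltW.
rewrite QE -mulrBr cmodM.
have Q1 : cmod (Q j i) <= 2 * cmod a * y ^- 2.
  by rewrite -exprVn expr2; apply: cmod_sandwich => p q; exact: cmod_resolvent.
have G1 := cmod_resolvent_clear_entry j i.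
have b1 : cmod (G j i - (G0 j i - Q j i)) <= 4 * y ^- 2 * cmod a.
  rewrite opprB addrCA addrC (le_trans (cmodD _ _))//; lra.
have b2 : cmod (G j i - (G0 j i - Q j i)) <= 4 * y ^- 3 * cmod a ^+ 2.
  have -> : G j i - (G0 j i - Q j i) = (G *m (M - M0) *m (G0 *m (M - M0) *m G0)) j i.
    have e : G - G0 = - (G *m (M - M0) *m G0) by exact: resolvent_sub.
    rewrite -!subr_mxE; congr (fun_of_matrix _ j i).
    rewrite opprB addrCA e /Q -!mulmxBl.
    by rewrite -[G0 - G]opprB e opprK !mulmxA.
  rewrite (_ : _ * _ = 2 * cmod a * (y^-1 * (2 * cmod a * y ^- 2))); last first.
    by field; rewrite gt_eqF.
  apply: cmod_sandwich => p q; first exact: cmod_resolvent.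
  by rewrite -exprVn expr2; apply: cmod_sandwich => p' q'; exact: cmod_resolvent.
have y2 : 0 <= 4 * y ^- 2 by rewrite mulr_ge0// invr_ge0 exprn_ge0.
have y3 : 0 <= 4 * y ^- 3 by rewrite mulr_ge0// invr_ge0 exprn_ge0.
case: (leP 1 (cmod a)) => a1.
  rewrite mulr1 (le_trans (ler_wpM2l a0 b1))// mulrCA -expr2.
  by rewrite ler_wpM2r ?sqr_ge0// lerDl.
rewrite (le_trans (ler_wpM2l a0 b2))// mulrCA [X in _ * X <= _]mulrC.
by rewrite ler_wpM2r ?mulr_ge0 ?sqr_ge0// lerDr.
Qed.

End entry_expansion.

(** * Complex expectations *)

Section complex_measurability.
Context (R : realType) d (T : measurableType d).
Implicit Types f g : T -> R[i].
Local Notation Re := complex.Re.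
Local Notation Im := complex.Im.

Definition cmeas f := measurable_fun setT (fun w => Re (f w)) /\
  measurable_fun setT (fun w => Im (f w)).

Lemma cmeas_cst (c : R[i]) : cmeas (fun=> c).
Proof. by split; exact: measurable_cst. Qed.

Lemma cmeasD f g : cmeas f -> cmeas g -> cmeas (fun w => f w + g w).
Proof.
move=> [f1 f2] [g1 g2]; split.
  by under eq_fun do rewrite Re_add; exact: measurable_funD.
by under eq_fun do rewrite Im_add; exact: measurable_funD.
Qed.

Lemma cmeasN f : cmeas f -> cmeas (fun w => - f w).
Proof.
move=> [f1 f2]; split.
  by under eq_fun do rewrite Re_opp; exact: measurableT_comp.
by under eq_fun do rewrite Im_opp; exact: measurableT_comp.
Qed.

Lemma cmeasB f g : cmeas f -> cmeas g -> cmeas (fun w => f w - g w).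
Proof. by move=> mf mg; apply: cmeasD => //; exact: cmeasN. Qed.

Lemma cmeasM f g : cmeas f -> cmeas g -> cmeas (fun w => f w * g w).
Proof.
move=> [f1 f2] [g1 g2]; split.
  under eq_fun do rewrite Re_mul.
  by apply: measurable_funB; exact: measurable_funM.
under eq_fun do rewrite Im_mul.
by apply: measurable_funD; exact: measurable_funM.
Qed.

Lemma cmeas_conj f : cmeas f -> cmeas (fun w => conjc (f w)).
Proof.
move=> [f1 f2]; split.
  by rewrite (_ : (fun w => _) = fun w => Re (f w))//; apply/funext => w; case: (f w).
rewrite (_ : (fun w => _) = fun w => - Im (f w)); last by apply/funext => w; case: (f w).
exact: measurableT_comp.
Qed.

Lemma measurable_sqr_cmod f : cmeas f -> measurable_fun setT (fun w => cmod (f w) ^+ 2).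
Proof.
move=> [f1 f2]; under eq_fun do rewrite sqr_cmod.
by apply: measurable_funD; exact: measurable_funX.
Qed.

Lemma measurable_cmod f : cmeas f -> measurable_fun setT (fun w => cmod (f w)).
Proof.
move=> mf; rewrite (_ : (fun w => _) = fun w => (cmod (f w) ^+ 2) `^ 2^-1).
  by apply: (measurableT_comp (measurable_powR _)); exact: measurable_sqr_cmod.
apply/funext => w.
by rewrite powR12_sqrt ?sqr_ge0// sqrtr_sqr ger0_norm ?cmod_ge0.
Qed.

Lemma measurable_ge0_inv (f : T -> R) : (forall w, 0 <= f w) ->
  measurable_fun setT f -> measurable_fun setT (fun w => (f w)^-1).
Proof.
move=> f0 mf; rewrite (_ : (fun w => _) = fun w => f w `^ (-1)).
  exact: (measurableT_comp (measurable_powR _)).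
by apply/funext => w; rewrite powR_inv1.
Qed.

Lemma cmeasV f : cmeas f -> cmeas (fun w => (f w)^-1).
Proof.
move=> mf; have [f1 f2] := mf; split.
  under eq_fun do rewrite Re_inv.
  by apply: measurable_funM => //; apply: measurable_ge0_inv => [w|]; [exact: sqr_ge0|exact: measurable_sqr_cmod].
under eq_fun do rewrite Im_inv.
apply: measurable_funM; first exact: measurableT_comp.
by apply: measurable_ge0_inv => [w|]; [exact: sqr_ge0|exact: measurable_sqr_cmod].
Qed.

Lemma cmeas_sum (J : Type) (s : seq J) (p : pred J) (F : J -> T -> R[i]) :
  (forall j, cmeas (F j)) -> cmeas (fun w => \sum_(j <- s | p j) F j w).
Proof.
move=> mF; elim: s => [|j s IH].
  by under eq_fun do rewrite big_nil; exact: cmeas_cst.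
under eq_fun do rewrite big_cons.
by case: (p j) => //; exact: cmeasD.
Qed.

Lemma cmeas_prod (J : Type) (s : seq J) (p : pred J) (F : J -> T -> R[i]) :
  (forall j, cmeas (F j)) -> cmeas (fun w => \prod_(j <- s | p j) F j w).
Proof.
move=> mF; elim: s => [|j s IH].
  by under eq_fun do rewrite big_nil; exact: cmeas_cst.
under eq_fun do rewrite big_cons.
by case: (p j) => //; exact: cmeasM.
Qed.

Definition mxmeas m n (F : T -> 'M[R[i]]_(m, n)) := forall i j, cmeas (fun w => F w i j).

Lemma cmeas_det n (F : T -> 'M[R[i]]_n) : mxmeas F -> cmeas (fun w => \det (F w)).
Proof.
move=> mF; rewrite /determinant; apply: cmeas_sum => s.
by apply: cmeasM; [exact: cmeas_cst|apply: cmeas_prod => i; exact: mF].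
Qed.

Lemma mxmeas_resolvent n (F : T -> 'M[R[i]]_n) z : 0 < Im z ->
  (forall w, herm (F w)) -> mxmeas F -> mxmeas (fun w => resolvent z (F w)).
Proof.
move=> z0 hF mF i j.
have mB : mxmeas (fun w => F w - z%:M).
  move=> k l; under eq_fun do rewrite !mxE.
  by apply: cmeasB; [exact: mF|exact: cmeas_cst].
(* Cramer's rule: the entries of the inverse are rational functions of those of the matrix. *)
under eq_fun => w.
  rewrite /resolvent /invmx resolvent_unit// !mxE; over.
apply: cmeasM; first by apply: cmeasV; exact: cmeas_det.
apply: cmeasM; first exact: cmeas_cst.
by apply: cmeas_det => k l; under eq_fun do rewrite !mxE; apply: cmeasB;
  [exact: mF|exact: cmeas_cst].
Qed.

End complex_measurability.

Section complex_expectation.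
Context (R : realType) d (T : measurableType d) (P : probability T R).
Implicit Types (f g : T -> R[i]) (h : T -> R).
Local Notation Re := complex.Re.
Local Notation Im := complex.Im.

Definition cE f : R[i] := (\int[P]_w Re (f w)) +i* (\int[P]_w Im (f w)).

Definition cint f := P.-integrable setT (EFin \o (fun w => Re (f w))) /\
  P.-integrable setT (EFin \o (fun w => Im (f w))).

Lemma integrable_dominated (h k : T -> R) : measurable_fun setT h ->
  P.-integrable setT (EFin \o k) -> (forall w, `|h w| <= k w) ->
  P.-integrable setT (EFin \o h).
Proof.
move=> mh ik hk; apply: (le_integrable measurableT _ _ ik).
  exact/measurable_EFinP.
by move=> w _ /=; rewrite lee_fin (le_trans (hk w))// ler_norm.
Qed.

Lemma cint_dominated f h : cmeas f -> P.-integrable setT (EFin \o h) ->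
  (forall w, cmod (f w) <= h w) -> cint f.
Proof.
move=> [f1 f2] ih fh; split; apply: (integrable_dominated _ ih) => // w.
  exact: le_trans (Re_cmod _) (fh w).
exact: le_trans (Im_cmod _) (fh w).
Qed.

Lemma integrable_const (c : R) : P.-integrable setT (EFin \o (fun=> c)).
Proof. exact: finite_measure_integrable_cst. Qed.

Lemma cint_bounded f B : cmeas f -> (forall w, cmod (f w) <= B) -> cint f.
Proof. by move=> mf fB; apply: (cint_dominated mf (integrable_const B)). Qed.

Lemma cintD f g : cint f -> cint g -> cint (fun w => f w + g w).
Proof.
move=> [f1 f2] [g1 g2]; split.
  by under eq_fun do rewrite Re_add; exact: EFin_integrableD.
by under eq_fun do rewrite Im_add; exact: EFin_integrableD.
Qed.

Lemma cintN f : cint f -> cint (fun w => - f w).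
Proof.
move=> [f1 f2]; split.
  by under eq_fun do rewrite Re_opp -mulN1r; exact: EFin_integrableZ.
by under eq_fun do rewrite Im_opp -mulN1r; exact: EFin_integrableZ.
Qed.

Lemma cintB f g : cint f -> cint g -> cint (fun w => f w - g w).
Proof. by move=> fi gi; apply: cintD => //; exact: cintN. Qed.

Lemma cintZ (c : R[i]) f : cint f -> cint (fun w => c * f w).
Proof.
move=> [f1 f2]; split.
  by under eq_fun do rewrite Re_mul; apply: EFin_integrableB; exact: EFin_integrableZ.
by under eq_fun do rewrite Im_mul; apply: EFin_integrableD; exact: EFin_integrableZ.
Qed.

Lemma cint_sum (J : Type) (s : seq J) (p : pred J) (F : J -> T -> R[i]) :
  (forall j, cint (F j)) -> cint (fun w => \sum_(j <- s | p j) F j w).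
Proof.
move=> mF; elim: s => [|j s IH].
  by under eq_fun do rewrite big_nil; split; exact: integrable_const.
under eq_fun do rewrite big_cons.
by case: (p j) => //; exact: cintD.
Qed.

Lemma eq_cE f g : f =1 g -> cE f = cE g.
Proof. by move=> /funext ->. Qed.

Lemma cE_cst c : cE (fun=> c) = c.
Proof. by rewrite /cE !Rintegral_const; case: c. Qed.

Lemma cED f g : cint f -> cint g -> cE (fun w => f w + g w) = cE f + cE g.
Proof.
move=> [f1 f2] [g1 g2]; apply: complex_ext; rewrite ?Re_add ?Im_add /=.
  by rewrite -RintegralD//; under eq_Rintegral do rewrite Re_add.
by rewrite -RintegralD//; under eq_Rintegral do rewrite Im_add.
Qed.

Lemma cEZ (c : R[i]) f : cint f -> cE (fun w => c * f w) = c * cE f.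
Proof.
move=> [f1 f2]; apply: complex_ext; rewrite ?Re_mul ?Im_mul /=.
  rewrite -!RintegralZl// -RintegralB//; [|exact: EFin_integrableZ..].
  by under eq_Rintegral do rewrite Re_mul.
rewrite -!RintegralZl// -RintegralD//; [|exact: EFin_integrableZ..].
by under eq_Rintegral do rewrite Im_mul.
Qed.

Lemma cEN f : cint f -> cE (fun w => - f w) = - cE f.
Proof.
move=> fi; rewrite -mulN1r -cEZ//.
by apply: eq_cE => w; rewrite mulN1r.
Qed.

Lemma cEB f g : cint f -> cint g -> cE (fun w => f w - g w) = cE f - cE g.
Proof. by move=> fi gi; rewrite cED ?cEN//; exact: cintN. Qed.

Lemma cE_sum (J : Type) (s : seq J) (p : pred J) (F : J -> T -> R[i]) :
  (forall j, cint (F j)) ->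
  cE (fun w => \sum_(j <- s | p j) F j w) = \sum_(j <- s | p j) cE (F j).
Proof.
move=> mF; elim: s => [|j s IH].
  by under eq_cE do rewrite big_nil; rewrite cE_cst big_nil.
under eq_cE do rewrite big_cons.
rewrite big_cons; case: (p j) => //; rewrite cED ?IH//; exact: cint_sum.
Qed.

(* The factor [2] avoids the rotation argument for the sharp bound. *)
Lemma cE_bound f h : cmeas f -> P.-integrable setT (EFin \o h) ->
  (forall w, cmod (f w) <= h w) -> cmod (cE f) <= 2 * \int[P]_w h w.
Proof.
move=> mf ih fh; have [f1 f2] := cint_dominated mf ih fh.
rewrite (le_trans (cmod_ReIm _))//= mulr_natl mulr2n; apply: lerD.
  apply: (le_trans (le_normr_Rintegral measurableT f1)).
  apply: Rintegral_le => //; first exact: integrable_norm.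
  by move=> w; exact: le_trans (Re_cmod _) (fh w).
apply: (le_trans (le_normr_Rintegral measurableT f2)).
apply: Rintegral_le => //; first exact: integrable_norm.
by move=> w; exact: le_trans (Im_cmod _) (fh w).
Qed.

Lemma cE_boundc f c : cmeas f -> (forall w, cmod (f w) <= c) ->
  cmod (cE f) <= 2 * c.
Proof.
move=> mf fc; rewrite -(Rintegral_const P c).
exact: cE_bound (integrable_const c) fc.
Qed.

End complex_expectation.

Section complex_independence.
Context (R : realType) d (T : measurableType d) (P : probability T R).
Context (I : finType) dV (V : measurableType dV).
Variables (D : pred I) (X : I -> T -> V).
Hypothesis mX : forall i, D i -> measurable_fun setT (X i).
Hypothesis indX : mutually_independent P D X.
Local Notation Re := complex.Re.
Local Notation Im := complex.Im.

Definition cmfunc (F : (I -> V) -> R[i]) :=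
  forall d1 (T1 : measurableType d1) (Y : I -> T1 -> V),
    (forall i, D i -> measurable_fun setT (Y i)) -> cmeas (fun t => F (Y^~ t)).

Lemma cmfunc_Re F : cmfunc F -> mfunc D (fun x => Re (F x)).
Proof. by move=> mF d1 T1 Y mY; have [] := mF _ _ Y mY. Qed.

Lemma cmfunc_Im F : cmfunc F -> mfunc D (fun x => Im (F x)).
Proof. by move=> mF d1 T1 Y mY; have [] := mF _ _ Y mY. Qed.

Lemma cE_mul_indep K (f g : (I -> V) -> R[i]) B : cmfunc f -> cmfunc g ->
  cint P (fun w => f (X^~ w)) -> (forall x, cmod (g x) <= B) ->
  reads D K f -> reads D (predC K) g ->
  cE P (fun w => f (X^~ w) * g (X^~ w)) =
  cE P (fun w => f (X^~ w)) * cE P (fun w => g (X^~ w)).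
Proof.
move=> mf mg [f1 f2] gB rf rg.
have rRe (F : (I -> V) -> R[i]) K' : reads D K' F -> reads D K' (fun x => Re (F x)).
  by move=> rF x y xy; rewrite (rF _ _ xy).
have rIm (F : (I -> V) -> R[i]) K' : reads D K' F -> reads D K' (fun x => Im (F x)).
  by move=> rF x y xy; rewrite (rF _ _ xy).
have gR x : `|Re (g x)| <= B by exact: le_trans (Re_cmod _) (gB x).
have gI x : `|Im (g x)| <= B by exact: le_trans (Im_cmod _) (gB x).
have bg (h k : (I -> V) -> R) : mfunc D k -> (forall x, `|k x| <= B) ->
    P.-integrable setT (EFin \o (fun w => h (X^~ w))) ->
    P.-integrable setT (EFin \o (fun w => h (X^~ w) * k (X^~ w))).
  move=> mk kB ih.
  have bk : [bounded k (X^~ w) | w in setT].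
    exists B; split; first exact: num_real.
    by move=> M BM w _ /=; rewrite (le_trans (kB _))// ltW.
  have := integrableMl measurableT ih (mfuncX mX mk) bk.
  by apply: eq_integrable.
have [mf1 mf2] := (cmfunc_Re mf, cmfunc_Im mf).
have [mg1 mg2] := (cmfunc_Re mg, cmfunc_Im mg).
have /= eRR := Rintegral_mul_indep mX indX mf1 mg1 f1 gR (rRe _ _ rf) (rRe _ _ rg).
have /= eRI := Rintegral_mul_indep mX indX mf1 mg2 f1 gI (rRe _ _ rf) (rIm _ _ rg).
have /= eIR := Rintegral_mul_indep mX indX mf2 mg1 f2 gR (rIm _ _ rf) (rRe _ _ rg).
have /= eII := Rintegral_mul_indep mX indX mf2 mg2 f2 gI (rIm _ _ rf) (rIm _ _ rg).
apply: complex_ext; rewrite ?Re_mul ?Im_mul /=.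
  rewrite -eRR -eII -RintegralB//; last 2 first.
  - exact: (bg (fun x => Re (f x)) (fun x => Re (g x))).
  - exact: (bg (fun x => Im (f x)) (fun x => Im (g x))).
  by under eq_Rintegral do rewrite Re_mul.
rewrite -eRI -eIR -RintegralD//; last 2 first.
- exact: (bg (fun x => Re (f x)) (fun x => Im (g x))).
- exact: (bg (fun x => Im (f x)) (fun x => Re (g x))).
by under eq_Rintegral do rewrite Im_mul.
Qed.

End complex_independence.

(** * Concentration *)

Section concentration.
Context (R : realType) d (T : measurableType d) (P : probability T R).
Context (I : finType) dV (V : measurableType dV).
Variables (D : pred I) (X : I -> T -> V).
Hypothesis mX : forall i, D i -> measurable_fun setT (X i).
Hypothesis indX : mutually_independent P D X.
Variables (beta : I -> nat) (N : nat) (F : (I -> V) -> R) (B c l : R).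
Hypotheses (mF : mfunc D F) (FB : forall x, `|F x| <= B).
Hypothesis (rF : reads D [pred i | (beta i < N)%N] F).
Hypothesis (bF : bounded_difference D beta c F).
Hypotheses (l0 : 0 < l) (lc : l * c <= 2^-1).

Let e := \int[P]_w F (X^~ w).
Let b := expR (2 * N%:R * (l * c) ^+ 2).

Let iF : P.-integrable setT (EFin \o (fun w => F (X^~ w))).
Proof.
by apply: (@bounded_integrable _ _ _ _ _ B); [exact: (mfuncX mX mF)|move=> w; exact: FB].
Qed.

Let dev_bound w : `|l * (F (X^~ w) - e)| <= l * (B + B).
Proof.
rewrite normrM gtr0_norm// ler_wpM2l ?(ltW l0)// (le_trans (ler_normB _ _))// lerD//.
exact: Rintegral_bound.
Qed.

Let measurable_dev : measurable_fun setT (fun w => l * (F (X^~ w) - e)).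
Proof. by apply: measurable_funM => //; apply: measurable_funB => //; exact: (mfuncX mX mF). Qed.

Let integrable_exp : P.-integrable setT (EFin \o
   (fun w => expR (l * (F (X^~ w) - e)) + expR (- (l * (F (X^~ w) - e))))).
Proof.
apply: (@bounded_integrable _ _ _ _ _ (expR (l * (B + B)) + expR (l * (B + B)))) => [|w].
  by apply: measurable_funD; apply: measurableT_comp => //; exact: measurableT_comp.
rewrite ger0_norm ?addr_ge0 ?expR_ge0//.
have := dev_bound w; rewrite ler_norml => /andP[h1 h2].
by apply: lerD; rewrite ler_expR// lerNl.
Qed.

Lemma two_sided_mgf :
  \int[P]_w (expR (l * (F (X^~ w) - e)) + expR (- (l * (F (X^~ w) - e)))) <= 2 * b.
Proof.
have bexp (s : R) : `|s| <= 1 -> P.-integrable setT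
    (EFin \o (fun w => expR (s * (l * (F (X^~ w) - e))))).
  move=> s1; apply: (@bounded_integrable _ _ _ _ _ (expR (l * (B + B)))) => [|w].
    by apply: measurableT_comp => //; exact: measurable_funM.
  rewrite ger0_norm ?expR_ge0// ler_expR (le_trans (ler_norm _))// normrM.
  by rewrite (le_trans _ (dev_bound w))// ler_piMl.
have b1 : P.-integrable setT (EFin \o (fun w => expR (l * (F (X^~ w) - e)))).
  have := bexp 1; rewrite normr1 => /(_ (lexx _)); apply: eq_integrable => // w _.
  by rewrite /= mul1r.
have b2 : P.-integrable setT (EFin \o (fun w => expR (- (l * (F (X^~ w) - e))))).
  have := bexp (-1); rewrite normrN normr1 => /(_ (lexx _)).
  by apply: eq_integrable => // w _; rewrite /= mulN1r.
rewrite RintegralD//.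
rewrite mulr_natl mulr2n; apply: lerD.
  by apply: (bounded_difference_mgf mX indX mF FB rF bF); rewrite gtr0_norm.
rewrite /b -[l * c]opprK -mulNr sqrrN.
under eq_Rintegral do rewrite -mulNr.
by apply: (bounded_difference_mgf mX indX mF FB rF bF); rewrite normrN gtr0_norm.
Qed.

(** Integrates [l * |v| <= expR (l * v) + expR (- (l * v))]. This mean deviation serves to decouple
    expectations of products; the tail bound below serves Borel-Cantelli. *)
Lemma bounded_difference_L1 : \int[P]_w `|F (X^~ w) - e| <= 2 * b / l.
Proof.
have iFe : P.-integrable setT (EFin \o (fun w => `|F (X^~ w) - e|)).
  apply: integrable_norm; apply: EFin_integrableB => //.
  exact: finite_measure_integrable_cst.
rewrite ler_pdivlMr// mulrC -RintegralZl//.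
apply: le_trans two_sided_mgf; apply: Rintegral_le => //.
  exact: EFin_integrableZ.
move=> w; set v := F _ - e.
have e1 := expR_ge1Dx (l * v); have e2 := expR_ge1Dx (- (l * v)).
have p1 := expR_gt0 (l * v); have p2 := expR_gt0 (- (l * v)).
by case: (lerP 0 v) => v0; [rewrite ger0_norm|rewrite ltr0_norm]; nra.
Qed.

Lemma bounded_difference_tail (eps : R) :
  (P [set w | (eps <= `|F (X^~ w) - e|)%R] <=
    (2 * expR (2 * N%:R * (l * c) ^+ 2 - l * eps))%:E)%E.
Proof.
set A := [set w | _].
have mA : measurable A.
  rewrite /A -[X in measurable X]setTI.
  apply: (@measurable_fun_ler _ _ _ _ (fun=> eps)) => //.
  by apply: measurableT_comp => //; apply: measurable_funB => //; exact: (mfuncX mX mF).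
have PA : (P A = (\int[P]_w (\1_A w : R))%:E)%E.
  rewrite -Rintegral_fineK ?integral_indic ?setIT//.
  exact: integrable_indic.
rewrite PA lee_fin expRB mulrA ler_pdivlMr ?expR_gt0// mulrC -RintegralZl//; last first.
  exact: integrable_indic.
apply: le_trans two_sided_mgf; apply: Rintegral_le => //.
  by apply: EFin_integrableZ; exact: integrable_indic.
move=> w; rewrite indicE; case: (boolP (w \in A)) => [|_]; last first.
  by rewrite mulr0 addr_ge0// expR_ge0.
rewrite inE /A /= mulr1 => eA; set v := F _ - e in eA *.
case: (lerP 0 v) => v0.
  by rewrite ger0_norm// in eA; rewrite -[leLHS]addr0 lerD ?expR_ge0// ler_expR ler_pM2l.
rewrite ltr0_norm// in eA; rewrite -[leLHS]add0r lerD ?expR_ge0// ler_expR -mulrN.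
by rewrite ler_pM2l.
Qed.

End concentration.

(** * The self-consistent equation *)

Section hermitian_array.
Variables (R : realType) (n : nat) (c : R).
Local Notation Re := complex.Re.
Local Notation Im := complex.Im.
Local Notation idx := ('I_n * 'I_n)%type.
Local Notation arr := (idx -> R * R).
Local Notation D := (fun p : idx => (p.1 <= p.2)%N).

Definition of_plane (p : R * R) : R[i] := p.1 +i* p.2.

(** Reading only the upper triangle and the real parts of the diagonal makes the matrix Hermitian
    for every array, in particular for mixtures of two samples. *)
Definition matx (x : arr) : 'M[R[i]]_n := \matrix_(i, j) (c%:C *
  (if (i < j)%N then of_plane (x (i, j))
   else if (j < i)%N then conjc (of_plane (x (j, i))) else (x (i, i)).1%:C)).

Lemma herm_matx x : herm (matx x).
Proof.
have cM u v : conjc (u * v) = conjc u * conjc v :> R[i] by rewrite rmorphM.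
move=> i j; rewrite !mxE cM conjc_real; congr (_ * _).
by case: ltngtP => // [_|/val_inj ->]; rewrite ?conjcK// conjc_real.
Qed.

Lemma matx_eq x y i j :
  (forall p, D p -> (p == (i, j)) || (p == (j, i)) -> x p = y p) ->
  matx x i j = matx y i j.
Proof.
move=> xy; rewrite !mxE; case: ltngtP => ij.
- by rewrite xy ?eqxx//= ltnW.
- by rewrite xy ?eqxx ?orbT//= ltnW.
- by rewrite (xy (i, i))//= (val_inj ij) eqxx.
Qed.

Lemma cmfunc_matx i j : cmfunc D (fun x => matx x i j).
Proof.
move=> d1 T1 Y mY; under eq_fun do rewrite mxE.
have mpl p : D p -> cmeas (fun t => of_plane (Y p t)).
  by move=> Dp; split; [exact: (measurableT_comp measurable_fst (mY p Dp))|
    exact: (measurableT_comp measurable_snd (mY p Dp))].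
apply: cmeasM; first exact: cmeas_cst.
case: ltngtP => ij.
- by apply: mpl => /=; exact: ltnW.
- by apply: cmeas_conj; apply: mpl => /=; exact: ltnW.
- split; last exact: measurable_cst.
  by apply: (measurableT_comp measurable_fst); exact: mY.
Qed.

Lemma clear_entry_matx x y i j :
  (forall p, D p -> ~~ ((p == (i, j)) || (p == (j, i))) -> x p = y p) ->
  clear_entry (matx x) i j = clear_entry (matx y) i j.
Proof.
move=> xy; apply/matrixP => k l; rewrite mxE [RHS]mxE.
case: ifPn => // kl; apply: matx_eq => p Dp pkl; apply: xy => //.
apply: contra kl; move: pkl => /orP[]/eqP ->; rewrite !xpair_eqE //.
by rewrite orbC ![(l == _) && _]andbC.
Qed.

Lemma cmfunc_resolvent (F : arr -> 'M[R[i]]_n) z i j : 0 < Im z ->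
  (forall x, herm (F x)) -> (forall k l, cmfunc D (fun x => F x k l)) ->
  cmfunc D (fun x => resolvent z (F x) i j).
Proof.
move=> z0 hF mF d1 T1 Y mY; apply: mxmeas_resolvent => // k l.
exact: mF.
Qed.

Lemma cmfunc_clear_entry i j k l : cmfunc D (fun x => clear_entry (matx x) i j k l).
Proof.
move=> d1 T1 Y mY; under eq_fun do rewrite mxE.
by case: (_ || _); [exact: cmeas_cst|exact: cmfunc_matx].
Qed.

(* Block [k] collects the entries [(k, j)] with [k <= j]: modifying it only
   affects row and column [k]. *)
Definition row_block (p : idx) : nat := p.1.

Lemma matx_row_block x y (k : nat) (i j : 'I_n) :
  (forall p, D p -> row_block p != k -> x p = y p) ->
  (i : nat) != k -> (j : nat) != k -> matx x i j = matx y i j.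
Proof.
by move=> xy ik jk; apply: matx_eq => p Dp /orP[]/eqP pE; apply: xy => //; rewrite pE.
Qed.

Lemma weighted_trace_bounded_difference z (w : 'I_n -> R) W (x y : arr) k :
  0 < Im z -> (forall j, `|w j| <= W) -> 0 <= W ->
  (forall p, D p -> row_block p != k -> x p = y p) ->
  cmod (\sum_j (w j)%:C * resolvent z (matx x) j j -
        \sum_j (w j)%:C * resolvent z (matx y) j j) <= 2 * W / Im z.
Proof.
move=> z0 wW W0 xy; have [kn|nk] := ltnP k n.
  apply: (@weighted_trace_row_change _ _ _ _ _ (Ordinal kn)) => //; try exact: herm_matx.
  by move=> i j ik jk; apply: (matx_row_block xy).
(* A block with index at least [n] contains no coordinate. *)
have -> : matx x = matx y.
  apply/matrixP => i j; apply: (matx_row_block xy).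
    by rewrite ltn_eqF// (leq_trans (ltn_ord i)).
  by rewrite ltn_eqF// (leq_trans (ltn_ord j)).
by rewrite subrr cmod0 divr_ge0// ?mulr_ge0// ltW.
Qed.

Lemma cmod_weighted_trace z (w : 'I_n -> R) (x : arr) : 0 < Im z ->
  (forall j, 0 <= w j) ->
  cmod (\sum_j (w j)%:C * resolvent z (matx x) j j) <= (\sum_j w j) / Im z.
Proof.
move=> z0 w0; rewrite (le_trans (cmod_sum _ _ _))// mulr_suml.
apply: ler_sum => j _; rewrite cmodM cmod_real ger0_norm// ler_wpM2l//.
by apply: cmod_resolvent => //; exact: herm_matx.
Qed.

Lemma cmfunc_weighted_trace z (w : 'I_n -> R) : 0 < Im z ->
  cmfunc D (fun x => \sum_j (w j)%:C * resolvent z (matx x) j j).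
Proof.
move=> z0 d1 T1 Y mY; apply: cmeas_sum => j; apply: cmeasM; first exact: cmeas_cst.
apply: cmfunc_resolvent => //; first by move=> x; exact: herm_matx.
by move=> k l; exact: cmfunc_matx.
Qed.

End hermitian_array.

Section self_consistent_equation.
Context (R : realType) d (T : measurableType d) (P : probability T R).
Variables (n : nat) (c : R).
Local Notation Re := complex.Re.
Local Notation Im := complex.Im.
Local Notation idx := ('I_n * 'I_n)%type.
Local Notation D := (fun p : idx => (p.1 <= p.2)%N).
Variable X : idx -> T -> R * R.
Hypothesis mX : forall p, D p -> measurable_fun setT (X p).
Hypothesis indX : mutually_independent P D X.

Definition rmx (w : T) : 'M[R[i]]_n := matx c (X^~ w).
Local Notation M := rmx.

Hypothesis sqr_integrable : forall i j,
  P.-integrable setT (EFin \o (fun w => cmod (M w i j) ^+ 2)).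
Hypothesis centered : forall i j, cE P (fun w => M w i j) = 0.

Variable z : R[i].
Hypothesis z0 : 0 < Im z.
Local Notation y := (Im z).
Local Notation G := (fun w => resolvent z (M w)).

Definition rvar i j : R := \int[P]_w cmod (M w i j) ^+ 2.
Definition rtail i j : R :=
  \int[P]_w (cmod (M w i j) ^+ 2 * Num.min 1 (cmod (M w i j))).
Definition rdiag i : R[i] := cE P (fun w => G w i i).

Let hM w : herm (M w). Proof. exact: herm_matx. Qed.

Lemma cmeas_rmx i j : cmeas (fun w => M w i j).
Proof. exact: cmfunc_matx. Qed.

Lemma cmeas_rmx_resolvent i j : cmeas (fun w => G w i j).
Proof. by apply: mxmeas_resolvent => // k l; exact: cmeas_rmx. Qed.

Lemma cint_rmx_resolvent i j : cint P (fun w => G w i j).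
Proof.
by apply: (cint_bounded _ (cmeas_rmx_resolvent i j)) => w; exact: cmod_resolvent.
Qed.

Lemma cint_rmx i j : cint P (fun w => M w i j).
Proof.
apply: (cint_dominated (cmeas_rmx i j) (h := fun w => 1 + cmod (M w i j) ^+ 2)).
  by apply: EFin_integrableD => //; exact: integrable_const.
move=> w; have := sqr_ge0 (cmod (M w i j) - 1); have := cmod_ge0 (M w i j); nra.
Qed.

Let y0 : 0 <= y. Proof. exact: ltW. Qed.

Lemma rvar_ge0 i j : 0 <= rvar i j.
Proof. by apply: Rintegral_ge0 => w _; exact: sqr_ge0. Qed.

(** Young's inequality in place of the square root from Cauchy-Schwarz: a small [tau] is fixed
    first, and the quotient by [tau] vanishes as the variance does. *)
Lemma Rintegral_cmod_rmx i j tau : 0 < tau ->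
  \int[P]_w cmod (M w i j) <= (tau + rvar i j / tau) / 2.
Proof.
move=> t0; have icm : P.-integrable setT (EFin \o (fun w => cmod (M w i j))).
  apply: (integrable_dominated (k := fun w => 1 + cmod (M w i j) ^+ 2)).
  - exact/measurable_cmod/cmeas_rmx.
  - by apply: EFin_integrableD => //; exact: integrable_const.
  - move=> w; rewrite ger0_norm ?cmod_ge0//.
    have := sqr_ge0 (cmod (M w i j) - 1); have := cmod_ge0 (M w i j); nra.
apply: (@le_trans _ _ (\int[P]_w (tau / 2 + (tau * 2)^-1 * cmod (M w i j) ^+ 2))).
  apply: Rintegral_le => //.
    by apply: EFin_integrableD; [exact: integrable_const|exact: EFin_integrableZ].
  move=> w; set a := cmod _.
  have -> : tau / 2 + (tau * 2)^-1 * a ^+ 2 = (tau ^+ 2 + a ^+ 2) / 2 / tau.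
    by field; rewrite gt_eqF.
  by rewrite ler_pdivlMr//; have := sqr_ge0 (tau - a); nra.
rewrite RintegralD//; [|exact: integrable_const|exact: EFin_integrableZ].
rewrite Rintegral_const RintegralZl// -/(rvar i j).
by rewrite le_eqVlt; apply/orP; left; apply/eqP; field; rewrite gt_eqF.
Qed.

Section entry.
Variables (i j : 'I_n) (tau : R).
Hypothesis tau0 : 0 < tau.
Local Notation G0 := (fun w => resolvent z (clear_entry (M w) i j)).

Let hM0 w : herm (clear_entry (M w) i j). Proof. exact: herm_clear_entry. Qed.

Let cmeasG0 k l : cmeas (fun w => G0 w k l).
Proof.
apply: mxmeas_resolvent => // k' l'; exact: cmfunc_clear_entry.
Qed.

Let G0_bound w k l : cmod (G0 w k l) <= y^-1.
Proof. exact: cmod_resolvent. Qed.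

Let G_bound w k l : cmod (G w k l) <= y^-1.
Proof. exact: cmod_resolvent. Qed.

Let K : pred idx := [pred p | (p == (i, j)) || (p == (j, i))].

Let cE_indep (f : R[i] -> R[i]) (g : 'M[R[i]]_n -> R[i]) B :
  cmfunc D (fun x => f (matx c x i j)) ->
  cmfunc D (fun x => g (resolvent z (clear_entry (matx c x) i j))) ->
  cint P (fun w => f (M w i j)) ->
  (forall x, cmod (g (resolvent z (clear_entry (matx c x) i j))) <= B) ->
  cE P (fun w => f (M w i j) * g (G0 w)) =
  cE P (fun w => f (M w i j)) * cE P (fun w => g (G0 w)).
Proof.
move=> mf mg fi gB.
apply: (cE_mul_indep mX indX mf mg fi gB (K := K)).
  by move=> x x' xx; congr f; apply: matx_eq => p Dp Kp; exact: xx.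
move=> x x' xx; congr (g (resolvent z _)); apply: clear_entry_matx => p Dp Kp.
exact: xx.
Qed.

Let mG0 k l : cmfunc D (fun x => resolvent z (clear_entry (matx c x) i j) k l).
Proof.
apply: cmfunc_resolvent => //.
  by move=> x; apply: herm_clear_entry; exact: herm_matx.
by move=> k' l'; exact: cmfunc_clear_entry.
Qed.

Let bG0 x k l : cmod (resolvent z (clear_entry (matx c x) i j) k l) <= y^-1.
Proof. by apply: cmod_resolvent => //; apply: herm_clear_entry; exact: herm_matx. Qed.

Let cmfuncM (f g : (idx -> R * R) -> R[i]) : cmfunc D f -> cmfunc D g ->
  cmfunc D (fun x => f x * g x).
Proof. by move=> mf mg d1 T1 Y mY; apply: cmeasM; [exact: mf|exact: mg]. Qed.

Let sqr_cint : cint P (fun w => M w i j ^+ 2).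
Proof.
apply: (cint_dominated _ (sqr_integrable i j)).
  by under eq_fun do rewrite expr2; apply: cmeasM; exact: cmeas_rmx.
by move=> w; rewrite cmodX.
Qed.

Let cmod_cint : cint P (fun w => (cmod (M w i j) ^+ 2)%:C).
Proof.
by split => //=; exact: integrable_const.
Qed.

Let cE_linear_term : cE P (fun w => M w i j * G0 w j i) = 0.
Proof.
have := @cE_indep id (fun A => A j i) y^-1.
move=> -> //; first by rewrite centered mul0r.
- exact: cmfunc_matx.
- exact: cint_rmx.
Qed.

Let cE_square_term : cE P (fun w => M w i j ^+ 2 * G0 w j i ^+ 2) =
  cE P (fun w => M w i j ^+ 2) * cE P (fun w => G0 w j i ^+ 2).
Proof.
apply: (@cE_indep (fun a => a ^+ 2) (fun A => A j i ^+ 2) (y^-1 ^+ 2)) => //.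
- by move=> d1 T1 Y mY; under eq_fun do rewrite expr2; apply: cmeasM; exact: cmfunc_matx.
- by move=> d1 T1 Y mY; under eq_fun do rewrite expr2; apply: cmeasM; exact: mG0.
- by move=> x; rewrite cmodX lerXn2r ?nnegrE ?cmod_ge0 ?invr_ge0.
Qed.

Let cE_diagonal_term :
  cE P (fun w => (cmod (M w i j) ^+ 2)%:C * (G0 w i i * G0 w j j)) =
  (rvar i j)%:C * cE P (fun w => G0 w i i * G0 w j j).
Proof.
have := @cE_indep (fun a => (cmod a ^+ 2)%:C) (fun A => A i i * A j j) (y^-1 * y^-1).
move=> -> //.
- congr (_ * _); rewrite /cE /= Rintegral_const; congr (_ +i* _).
- move=> d1 T1 Y mY; split; last exact: measurable_cst.
  by apply: measurable_sqr_cmod; exact: cmfunc_matx.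
- exact: cmfuncM.
- by move=> x; rewrite cmodM ler_pM ?cmod_ge0.
Qed.

Let integrable_tail : P.-integrable setT (EFin \o
  (fun w => cmod (M w i j) ^+ 2 * Num.min 1 (cmod (M w i j)))).
Proof.
apply: (integrable_dominated (k := fun w => cmod (M w i j) ^+ 2)) => //.
  apply: measurable_funM; first exact/measurable_sqr_cmod/cmeas_rmx.
  by apply: measurable_minr => //; exact/measurable_cmod/cmeas_rmx.
move=> w; rewrite normrM ger0_norm ?sqr_ge0// ler_piMr ?sqr_ge0//.
rewrite ger0_norm; first by rewrite ge_min lexx.
by rewrite le_min ler01 cmod_ge0.
Qed.

(** One summand for each source of error: the remainder of the expansion, the return from [G0] to
    [G] in the product of diagonal entries, and the term with the expectation of [M i j ^+ 2]. *)
Definition entry_error : R := 2 * (4 * y ^- 2 + 4 * y ^- 3) * rtail i j +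
  rvar i j * (4 * y ^- 3) * (tau + rvar i j / tau) +
  2 * rvar i j * (4 * \int[P]_w cmod (G w j i) ^+ 2 + 16 * y ^- 4 * rvar i j).

Lemma entry_expectation :
  cmod (cE P (fun w => M w i j * G w j i) +
    (rvar i j)%:C * cE P (fun w => G w i i * G w j j)) <= entry_error.
Proof.
pose Q w := entry_main (M w) z i j.
have cG k l := cint_rmx_resolvent k l.
have mGG k l k' l' : cmeas (fun w => G w k l * G w k' l').
  by apply: cmeasM; exact: cmeas_rmx_resolvent.
have bGG w k l k' l' : cmod (G w k l * G w k' l') <= y^-1 * y^-1.
  by rewrite cmodM ler_pM ?cmod_ge0.
have bG0G0 w k l k' l' : cmod (G0 w k l * G0 w k' l') <= y^-1 * y^-1.
  by rewrite cmodM ler_pM ?cmod_ge0.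
have iGG k l k' l' : cint P (fun w => G w k l * G w k' l').
  exact: (cint_bounded _ (mGG k l k' l')).
have mG0G0 k l k' l' : cmeas (fun w => G0 w k l * G0 w k' l') by exact: cmeasM.
have iG0G0 k l k' l' : cint P (fun w => G0 w k l * G0 w k' l').
  exact: (cint_bounded _ (mG0G0 k l k' l')).
have cM_bounded (f : T -> R[i]) : cmeas f -> (forall w, cmod (f w) <= y^-1) ->
    cint P (fun w => M w i j * f w).
  move=> mf fb; have mMf := cmeasM (cmeas_rmx i j) mf.
  apply: (cint_dominated mMf (h := fun w => y^-1 * (1 + cmod (M w i j) ^+ 2))).
    by apply: EFin_integrableZ; apply: EFin_integrableD => //; exact: integrable_const.
  move=> w; rewrite cmodM mulrC ler_pM ?cmod_ge0//.
  have := sqr_ge0 (cmod (M w i j) - 1); have := cmod_ge0 (M w i j); nra.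
have iMG : cint P (fun w => M w i j * G w j i).
  by apply: cM_bounded => //; exact: cmeas_rmx_resolvent.
have i1 : cint P (fun w => M w i j * G0 w j i) by exact: cM_bounded.
have i2 : cint P (fun w => (cmod (M w i j) ^+ 2)%:C * (G0 w i i * G0 w j j)).
  apply: (cint_dominated _ (h := fun w => y^-1 * y^-1 * cmod (M w i j) ^+ 2)).
  - apply: cmeasM => //; split; last exact: measurable_cst.
    exact/measurable_sqr_cmod/cmeas_rmx.
  - exact: EFin_integrableZ.
  - by move=> w; rewrite cmodM cmod_real ger0_norm ?sqr_ge0// mulrC ler_wpM2r ?sqr_ge0.
have i3 : cint P (fun w => M w i j ^+ 2 * G0 w j i ^+ 2).
  apply: (cint_dominated _ (h := fun w => y^-1 * y^-1 * cmod (M w i j) ^+ 2)).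
  - under eq_fun do rewrite !expr2.
    by apply: cmeasM => //; apply: cmeasM; exact: cmeas_rmx.
  - exact: EFin_integrableZ.
  - by move=> w; rewrite cmodM cmodX mulrC ler_wpM2r ?sqr_ge0// expr2.
have i3' : cint P (fun w => (i != j)%:R * (M w i j ^+ 2 * G0 w j i ^+ 2)) by exact: cintZ.
have iQ : cint P Q by apply: cintB => //; exact: cintB.
have EQ : cE P Q = - ((rvar i j)%:C * cE P (fun w => G0 w i i * G0 w j j)) -
    (i != j)%:R * (cE P (fun w => M w i j ^+ 2) * cE P (fun w => G0 w j i ^+ 2)).
  rewrite /Q /entry_main cEB//; last exact: cintB.
  rewrite cEB// cEZ//.
  by rewrite cE_linear_term cE_diagonal_term cE_square_term sub0r.
have Erem : cmod (cE P (fun w => M w i j * G w j i - Q w)) <=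
    2 * (4 * y ^- 2 + 4 * y ^- 3) * rtail i j.
  rewrite -mulrA /rtail -RintegralZl//.
  apply: cE_bound; last by move=> w; exact: entry_expansion.
    by apply: cmeasB; [apply: cmeasM; [exact: cmeas_rmx|exact: cmeas_rmx_resolvent]|];
      have [] := iQ => /integrableP[/measurable_EFinP ? _] /integrableP[/measurable_EFinP ? _].
  exact: EFin_integrableZ.
have Ediag : cmod (cE P (fun w => G w i i * G w j j) - cE P (fun w => G0 w i i * G0 w j j)) <=
    4 * y ^- 3 * (tau + rvar i j / tau).
  rewrite -cEB//.
  have icm : P.-integrable setT (EFin \o (fun w => cmod (M w i j))).
    apply: (integrable_dominated (k := fun w => 1 + cmod (M w i j) ^+ 2)).
    - exact/measurable_cmod/cmeas_rmx.
    - by apply: EFin_integrableD => //; exact: integrable_const.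
    - move=> w; rewrite ger0_norm ?cmod_ge0//.
      have := sqr_ge0 (cmod (M w i j) - 1); have := cmod_ge0 (M w i j); nra.
  apply: (@le_trans _ _ (2 * \int[P]_w (4 * y ^- 3 * cmod (M w i j)))).
    apply: cE_bound => [||w]; first exact: cmeasB.
      exact: EFin_integrableZ.
    have e1 := cmod_resolvent_clear_entry i j (hM w) z0 i i.
    have e2 := cmod_resolvent_clear_entry i j (hM w) z0 j j.
    have -> : G w i i * G w j j - G0 w i i * G0 w j j =
        (G w i i - G0 w i i) * G w j j + G0 w i i * (G w j j - G0 w j j) by ring.
    rewrite (le_trans (cmodD _ _))// !cmodM.
    have -> : 4 * y ^- 3 * cmod (M w i j) = 2 * cmod (M w i j) * y ^- 2 * y^-1 +
        y^-1 * (2 * cmod (M w i j) * y ^- 2) by field; rewrite gt_eqF.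
    by apply: lerD; apply: ler_pM; rewrite ?cmod_ge0.
  rewrite RintegralZl//.
  have := Rintegral_cmod_rmx i j tau0.
  have y3 : 0 <= y ^- 3 by rewrite invr_ge0 exprn_ge0.
  by move=> /(ler_wpM2l y3); lra.
have Esq : cmod (cE P (fun w => M w i j ^+ 2)) <= 2 * rvar i j.
  apply: cE_bound => [||w]; last by rewrite cmodX.
    by under eq_fun do rewrite expr2; apply: cmeasM; exact: cmeas_rmx.
  exact: sqr_integrable.
have iG2 : P.-integrable setT (EFin \o (fun w => cmod (G w j i) ^+ 2)).
  apply: (@bounded_integrable _ _ _ _ _ (y^-1 ^+ 2)) => [|w].
    exact/measurable_sqr_cmod/cmeas_rmx_resolvent.
  by rewrite ger0_norm ?sqr_ge0// lerXn2r ?nnegrE ?cmod_ge0 ?invr_ge0.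
(* Expressed through [G], which unlike [G0] is the same for all [j], so that the Ward identity can
   later sum it over [j]. *)
have EG2 : cmod (cE P (fun w => G0 w j i ^+ 2)) <=
    4 * \int[P]_w cmod (G w j i) ^+ 2 + 16 * y ^- 4 * rvar i j.
  apply: (@le_trans _ _ (2 * \int[P]_w (2 * cmod (G w j i) ^+ 2 +
      8 * y ^- 4 * cmod (M w i j) ^+ 2))).
    apply: cE_bound => [||w].
    - by under eq_fun do rewrite expr2; exact: mG0G0.
    - by apply: EFin_integrableD; exact: EFin_integrableZ.
    - rewrite cmodX.
      have e1 := cmod_resolvent_clear_entry i j (hM w) z0 j i.
      have e2 : cmod (G0 w j i) <= cmod (G w j i) + 2 * cmod (M w i j) * y ^- 2.
        have -> : G0 w j i = G w j i - (G w j i - G0 w j i) by ring.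
        by rewrite (le_trans (cmodB _ _))// lerD2l.
      apply: (@le_trans _ _ ((cmod (G w j i) + 2 * cmod (M w i j) * y ^- 2) ^+ 2)).
        by rewrite lerXn2r ?nnegrE ?cmod_ge0 ?(le_trans (cmod_ge0 _) e2).
      set u := cmod (G w j i); set v := 2 * cmod (M w i j) * y ^- 2.
      have -> : 8 * y ^- 4 * cmod (M w i j) ^+ 2 = 2 * v ^+ 2.
        by rewrite /v; field; rewrite gt_eqF.
      by have := sqr_ge0 (u - v); nra.
  rewrite RintegralD//; [|exact: EFin_integrableZ..].
  by rewrite !RintegralZl// -/(rvar i j); lra.
set GG := cE P (fun w => G w i i * G w j j).
set GG0 := cE P (fun w => G0 w i i * G0 w j j) in EQ Ediag.
rewrite cEB// EQ in Erem.
have -> : cE P (fun w => M w i j * G w j i) + (rvar i j)%:C * GG =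
    (cE P (fun w => M w i j * G w j i) - (- ((rvar i j)%:C * GG0) -
      (i != j)%:R * (cE P (fun w => M w i j ^+ 2) * cE P (fun w => G0 w j i ^+ 2)))) +
    (rvar i j)%:C * (GG - GG0) -
    (i != j)%:R * (cE P (fun w => M w i j ^+ 2) * cE P (fun w => G0 w j i ^+ 2)).
  by ring.
rewrite (le_trans (cmodB _ _))// /entry_error; apply: lerD.
  rewrite (le_trans (cmodD _ _))//; apply: lerD => //.
  by rewrite cmodM cmod_real ger0_norm ?rvar_ge0// -mulrA ler_wpM2l ?rvar_ge0.
case: (i != j).
  by rewrite mul1r cmodM ler_pM ?cmod_ge0.
rewrite mul0r cmod0 mulr_ge0 ?mulr_ge0 ?rvar_ge0//.
exact: le_trans (cmod_ge0 _) EG2.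
Qed.

End entry.
End self_consistent_equation.

Section integral_of_sum.
Context (R : realType) d (T : measurableType d) (P : probability T R).
Variables (J : Type) (F : J -> T -> R).
Hypothesis iF : forall j, P.-integrable setT (EFin \o F j).

Lemma EFin_integrable_sum (s : seq J) :
  P.-integrable setT (EFin \o (fun w => \sum_(j <- s) F j w)).
Proof.
elim: s => [|j s IH]; first by under eq_fun do rewrite big_nil; exact: integrable_const.
by under eq_fun do rewrite big_cons; exact: EFin_integrableD.
Qed.

Lemma Rintegral_sum (s : seq J) :
  \int[P]_w \sum_(j <- s) F j w = \sum_(j <- s) \int[P]_w F j w.
Proof.
elim: s => [|j s IH].
  by under eq_Rintegral do rewrite big_nil; rewrite Rintegral_const big_nil.
under eq_Rintegral do rewrite big_cons.
by rewrite big_cons -IH RintegralD//; exact: EFin_integrable_sum.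
Qed.

End integral_of_sum.

(** * The equation for one row, with explicit error *)

Section self_consistent_row.
Context (R : realType) d (T : measurableType d) (P : probability T R).
Variables (n : nat) (c : R).
Local Notation Re := complex.Re.
Local Notation Im := complex.Im.
Local Notation idx := ('I_n * 'I_n)%type.
Local Notation D := (fun p : idx => (p.1 <= p.2)%N).
Variable X : idx -> T -> R * R.
Hypothesis mX : forall p, D p -> measurable_fun setT (X p).
Hypothesis indX : mutually_independent P D X.
Local Notation M := (rmx c X).
Hypothesis sqr_integrable : forall i j,
  P.-integrable setT (EFin \o (fun w => cmod (M w i j) ^+ 2)).
Hypothesis centered : forall i j, cE P (fun w => M w i j) = 0.
Variable z : R[i].
Hypothesis z0 : 0 < Im z.
Local Notation y := (Im z).
Local Notation G := (fun w => resolvent z (M w)).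
Local Notation S i j := (rvar P c X i j).
Local Notation g i := (rdiag P c X z i).

Let hM w : herm (M w). Proof. exact: herm_matx. Qed.
Let y0 : 0 <= y. Proof. exact: ltW. Qed.
Let cG i j : cint P (fun w => G w i j). Proof. exact: cint_rmx_resolvent. Qed.
Let mG i j : cmeas (fun w => G w i j). Proof. exact: cmeas_rmx_resolvent. Qed.
Let bG w i j : cmod (G w i j) <= y^-1. Proof. exact: cmod_resolvent. Qed.

Let iMG i j : cint P (fun w => M w i j * G w j i).
Proof.
have mM : cmeas (fun w => M w i j) by exact: cmeas_rmx.
apply: (cint_dominated (cmeasM mM (mG j i)) (h := fun w => y^-1 * (1 + cmod (M w i j) ^+ 2))).
  by apply: EFin_integrableZ; apply: EFin_integrableD => //; exact: integrable_const.
move=> w; rewrite cmodM mulrC ler_pM ?cmod_ge0//.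
have := sqr_ge0 (cmod (M w i j) - 1); have := cmod_ge0 (M w i j); nra.
Qed.

(** The expected [(i, i)] entry of [(M - z) * G = 1]. *)
Lemma sum_cE_rmx_resolvent i :
  \sum_j cE P (fun w => M w i j * G w j i) = 1 + z * g i.
Proof.
rewrite -cE_sum//; transitivity (cE P (fun w => 1 + z * G w i i)).
  apply: eq_cE => w; have := mulresolventV (hM w) z0 => /matrixP /(_ i i).
  rewrite !mxE eqxx => e1.
  under eq_bigr => j _ do rewrite -[M w i j](subrK (z%:M i j)) mulrDl.
  rewrite big_split /= (_ : \sum_i0 _ = 1).
    congr (_ + _); rewrite (bigD1 i)//= big1 ?addr0 => [|j ji]; rewrite !mxE ?eqxx//.
    by rewrite eq_sym (negbTE ji) mul0r.
  by rewrite -[RHS]e1; apply: eq_bigr => j _; rewrite !mxE.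
have i1 : cint P (fun=> 1 : R[i]) by split; exact: integrable_const.
by rewrite cED ?cE_cst ?cEZ//; exact: cintZ.
Qed.

Variables (kap l : R).
Hypotheses (S_le : forall i j, S i j <= kap) (kap0 : 0 < kap).
Hypotheses (l0 : 0 < l) (lkap : l * (2 * kap / y) <= 2^-1).
Local Notation b := (expR (2 * n%:R * (l * (2 * kap / y)) ^+ 2)).

(** Here [f] stands for the real or the imaginary part, and the weights will be a row of [S]. There
    are [n] blocks, and each moves the sum by at most [2 * kap / y]. *)
Lemma weighted_trace_L1 (w : 'I_n -> R) (f : R[i] -> R) :
  (forall u v, f (u - v) = f u - f v) -> (forall u, `|f u| <= cmod u) ->
  (forall F, cmfunc D F -> mfunc D (fun x : idx -> R * R => f (F x))) ->
  (forall j, 0 <= w j <= kap) ->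
  \int[P]_t `|f (\sum_j (w j)%:C * G t j j) -
     \int[P]_t f (\sum_j (w j)%:C * G t j j)| <= 2 * b / l.
Proof.
move=> fB fb mf w_kap.
have w0 j : 0 <= w j by have /andP[] := w_kap j.
pose F (x : idx -> R * R) := f (\sum_j (w j)%:C * resolvent z (matx c x) j j).
apply: (@bounded_difference_L1 _ _ _ P _ _ _ D X mX indX (@row_block n) n F
  ((\sum_j w j) / y) (2 * kap / y)) => //.
- exact/mf/cmfunc_weighted_trace.
- by move=> x; rewrite (le_trans (fb _))//; exact: cmod_weighted_trace.
- by move=> x x' xx; rewrite /F (_ : matx c x = matx c x')//; apply/matrixP => i j;
    apply: matx_eq => p Dp _; apply: xx => //=; rewrite /row_block.
- move=> k x x' xx; rewrite /F -fB (le_trans (fb _))//.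
  apply: (weighted_trace_bounded_difference _ z0 _ (ltW kap0) xx) => j.
  by rewrite ger0_norm//; have /andP[] := w_kap j.
Qed.

(** With [U] the weighted trace for row [i] of [S], the difference is the expectation of
    [G i i * (U - E U)]. Since [G i i] is bounded, the mean deviation of [U] is enough. The constant
    8 is the 2 of [cE_bound] times [2 * b / l] for each of the two parts of [U]. *)
Lemma decoupled_diagonal i :
  cmod (\sum_j (S i j)%:C * cE P (fun w => G w i i * G w j j) -
        g i * \sum_j (S i j)%:C * g j) <= 8 * b / (l * y).
Proof.
pose U w := \sum_j (S i j)%:C * G w j j.
have mU : cmeas U.
  by apply: cmeas_sum => j; apply: cmeasM => //; exact: cmeas_cst.
have iU : cint P U by apply: cint_sum => j; exact: cintZ.
have S_itv j : 0 <= S i j <= kap by rewrite rvar_ge0 S_le.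
have iGG j : cint P (fun w => G w i i * G w j j).
  apply: (cint_bounded P (B := y^-1 * y^-1)); first exact: cmeasM.
  by move=> w; rewrite cmodM ler_pM ?cmod_ge0.
have EU : cE P U = \sum_j (S i j)%:C * g j.
  by rewrite cE_sum; [apply: eq_bigr => j _; rewrite cEZ|move=> j; exact: cintZ].
have -> : \sum_j (S i j)%:C * cE P (fun w => G w i i * G w j j) =
    cE P (fun w => G w i i * U w).
  transitivity (cE P (fun w => \sum_j (S i j)%:C * (G w i i * G w j j))).
    by rewrite cE_sum; [apply: eq_bigr => j _; rewrite cEZ|move=> j; exact: cintZ].
  by apply: eq_cE => w; rewrite mulr_sumr; apply: eq_bigr => j _; ring.
rewrite -EU mulrC -[g i]/(cE P (fun w => G w i i)) -cEZ//.
have iGU : cint P (fun w => G w i i * U w).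
  apply: (cint_bounded P (B := y^-1 * ((\sum_j S i j) / y))); first exact: cmeasM.
  move=> w; rewrite cmodM ler_pM ?cmod_ge0//.
  by apply: cmod_weighted_trace => // j; exact: rvar_ge0.
rewrite -cEB//; last exact: cintZ.
have iRe : P.-integrable setT (EFin \o (fun w => `|Re (U w) - \int[P]_w Re (U w)|)).
  apply: integrable_norm; apply: EFin_integrableB; [exact: iU.1|exact: integrable_const].
have iIm : P.-integrable setT (EFin \o (fun w => `|Im (U w) - \int[P]_w Im (U w)|)).
  apply: integrable_norm; apply: EFin_integrableB; [exact: iU.2|exact: integrable_const].
apply: (@le_trans _ _ (2 * \int[P]_w (y^-1 * (`|Re (U w) - \int[P]_w Re (U w)| +
    `|Im (U w) - \int[P]_w Im (U w)|)))).
  apply: cE_bound => [||w].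
  - by apply: cmeasB; apply: cmeasM => //; exact: cmeas_cst.
  - by apply: EFin_integrableZ; exact: EFin_integrableD.
  - rewrite [cE P U * _]mulrC -mulrBr cmodM ler_pM ?cmod_ge0//.
    by rewrite (le_trans (cmod_ReIm _))// Re_add Im_add Re_opp Im_opp.
rewrite RintegralZl//; last exact: EFin_integrableD.
rewrite RintegralD//.
have hRe := @weighted_trace_L1 (fun j => S i j) (@complex.Re R) _ _ _ S_itv.
have hIm := @weighted_trace_L1 (fun j => S i j) (@complex.Im R) _ _ _ S_itv.
have -> : 8 * b / (l * y) = 2 * (y^-1 * (2 * b / l + 2 * b / l)).
  by field; rewrite !gt_eqF.
rewrite ler_wpM2l// ler_wpM2l ?invr_ge0//; apply: lerD.
- apply: hRe; [by move=> u v; rewrite Re_add Re_opp|exact: Re_cmod|].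
  by move=> F mF; exact: cmfunc_Re.
- apply: hIm; [by move=> u v; rewrite Im_add Im_opp|exact: Im_cmod|].
  by move=> F mF; exact: cmfunc_Im.
Qed.

Variable tau : R.
Hypothesis tau0 : 0 < tau.
Hypothesis row_sum : forall i, \sum_j S i j <= 2.

Definition row_defect i : R[i] := 1 + z * g i + g i * \sum_j (S i j)%:C * g j.

Lemma row_defect_le i : cmod (row_defect i) <=
  2 * (4 * y ^- 2 + 4 * y ^- 3) * (\sum_j rtail P c X i j) +
  (8 * y ^- 3 * (tau + kap / tau) + 8 * y ^- 2 * kap + 64 * y ^- 4 * kap +
   8 * b / (l * y)).
Proof.
have -> : row_defect i =
    \sum_j (cE P (fun w => M w i j * G w j i) +
       (S i j)%:C * cE P (fun w => G w i i * G w j j)) -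
    (\sum_j (S i j)%:C * cE P (fun w => G w i i * G w j j) -
        g i * \sum_j (S i j)%:C * g j).
  by rewrite /row_defect -sum_cE_rmx_resolvent big_split/=; ring.
rewrite (le_trans (cmodB _ _))//.
rewrite [leRHS]addrA; apply: lerD; last exact: decoupled_diagonal.
rewrite (le_trans (cmod_sum _ _ _))//.
apply: (@le_trans _ _ (\sum_j entry_error P c X z i j tau)).
  by apply: ler_sum => j _; exact: entry_expectation.
rewrite /entry_error !big_split/= -mulr_sumr -addrA lerD2l -addrA.
have y2 : 0 <= y ^- 2 by rewrite invr_ge0 exprn_ge0.
have y3 : 0 <= y ^- 3 by rewrite invr_ge0 exprn_ge0.
have y4 : 0 <= y ^- 4 by rewrite invr_ge0 exprn_ge0.
have tk : 0 <= tau + kap / tau by rewrite addr_ge0 ?divr_ge0 ?(ltW tau0) ?(ltW kap0).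
apply: lerD.
  apply: (@le_trans _ _ (\sum_j S i j * (4 * y ^- 3 * (tau + kap / tau)))).
    apply: ler_sum => j _; rewrite -[leLHS]mulrA ler_wpM2l ?rvar_ge0// ler_wpM2l//.
      by rewrite mulr_ge0.
    by rewrite lerD2l ler_wpM2r// invr_ge0 ltW.
  rewrite -mulr_suml (_ : 8 * _ * _ = 2 * (4 * y ^- 3 * (tau + kap / tau))); last by ring.
  by rewrite ler_wpM2r// !mulr_ge0.
have iG2 j : P.-integrable setT (EFin \o (fun w => cmod (G w j i) ^+ 2)).
  apply: (@bounded_integrable _ _ _ _ _ (y^-1 ^+ 2)) => [|w].
    exact/measurable_sqr_cmod/mG.
  by rewrite ger0_norm ?sqr_ge0// lerXn2r ?nnegrE ?cmod_ge0 ?invr_ge0.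
(* Here the Ward identity saves a factor [n] over the entrywise bound. *)
have sumG : \sum_j \int[P]_w cmod (G w j i) ^+ 2 <= y ^- 2.
  rewrite -Rintegral_sum// -(Rintegral_const P (y ^- 2)); apply: Rintegral_le => //.
  - exact: EFin_integrable_sum.
  - exact: integrable_const.
  - by move=> w; exact: sum_sqr_resolvent_col.
apply: (@le_trans _ _ (\sum_j (8 * kap * \int[P]_w cmod (G w j i) ^+ 2 +
    32 * y ^- 4 * kap * S i j))).
  apply: ler_sum => j _; rewrite mulrDr; apply: lerD.
    rewrite (_ : 2 * _ * _ = 8 * S i j * \int[P]_w cmod (G w j i) ^+ 2); last by ring.
    rewrite ler_wpM2r ?ler_wpM2l//.
    by apply: Rintegral_ge0 => w _; exact: sqr_ge0.
  rewrite (_ : 2 * _ * _ = 32 * y ^- 4 * S i j * S i j); last by ring.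
  by rewrite ler_wpM2r ?rvar_ge0// ler_wpM2l// mulr_ge0.
rewrite big_split/= -!mulr_sumr; apply: lerD.
  by rewrite [8 * y ^- 2 * _]mulrAC ler_wpM2l// mulr_ge0// ltW.
rewrite (_ : 64 * _ * _ = 32 * y ^- 4 * kap * 2); last by ring.
by rewrite ler_wpM2l// !mulr_ge0// ltW.
Qed.

End self_consistent_row.

(** * Stability and the limit of the Stieltjes transform *)

Section stability.
Variables (R : realType) (n : nat) (S : 'I_n -> 'I_n -> R) (g : 'I_n -> R[i]).
Variables (z m : R[i]) (kap del B : R).
Local Notation Re := complex.Re.
Local Notation Im := complex.Im.
Local Notation y := (Im z).
Hypotheses (z0 : 0 < y) (S0 : forall i j, 0 <= S i j) (Ssym : forall i j, S i j = S j i).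
Hypotheses (S_le : forall i j, S i j <= kap).
Hypotheses (row_sum : forall i, `|\sum_j S i j - 1| <= del).
Hypotheses (gB : forall i, cmod (g i) <= B) (g_ge0 : forall i, 0 <= Im (g i)).
Hypotheses (mE : 1 + z * m + m ^+ 2 = 0) (m1 : cmod m < 1).
Hypothesis mdel : cmod m * (1 + del) <= (1 + cmod m) / 2.

Definition defect i : R[i] := 1 + z * g i + g i * \sum_j (S i j)%:C * g j.

Hypothesis small_defect : kap * \sum_j cmod (defect j) <= y ^+ 2.

Let b i := z + \sum_j (S i j)%:C * g j.
Let q i := Im (b i).
Let eps i := cmod (defect i).
Let d i := cmod (g i - m).
(** For an exact solution [p i ^+ 2 = Im (g i)]. Defined through [b i], the weight is positive even
    when the equation holds only approximately. *)
Let p i := Num.sqrt (q i) / cmod (b i).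

Let qE i : q i = y + \sum_j S i j * Im (g j).
Proof.
by rewrite /q /b Im_add Im_sum; congr (_ + _); apply: eq_bigr => j _; rewrite Im_scale.
Qed.

Let q_ge i : y <= q i.
Proof. by rewrite qE lerDl; apply: sumr_ge0 => j _; rewrite mulr_ge0. Qed.

Let q_gt0 i : 0 < q i. Proof. exact: lt_le_trans (q_ge i). Qed.

Let b_ge i : q i <= cmod (b i).
Proof. exact: le_trans (ler_norm _) (Im_cmod _). Qed.

Let b_gt0 i : 0 < cmod (b i). Proof. exact: lt_le_trans (b_ge i). Qed.

Let gbE i : g i * b i = defect i - 1.
Proof. by rewrite /defect /b; ring. Qed.

Let p_gt0 i : 0 < p i. Proof. by rewrite divr_gt0// sqrtr_gt0. Qed.

Let sqr_p i : p i ^+ 2 = q i / cmod (b i) ^+ 2.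
Proof. by rewrite exprMn sqr_sqrtr ?exprVn// ltW. Qed.

Let sqr_p_le i : p i ^+ 2 <= Im (g i) + eps i / y.
Proof.
have bi0 : b i != 0 by rewrite -cmod_gt0.
have -> : g i = defect i / b i - (b i)^-1.
  by apply: (mulIf bi0); rewrite gbE mulrBl mulVf// divfK.
rewrite Im_add Im_opp Im_inv -/(q i) mulNr opprK -sqr_p addrAC lerDr.
have : `|Im (defect i / b i)| <= eps i / y.
  rewrite (le_trans (Im_cmod _))// cmodM cmodV ler_wpM2l ?cmod_ge0//.
  by rewrite lef_pV2 ?posrE// (le_trans (q_ge i)).
by rewrite ler_norml => /andP[]; lra.
Qed.

(** The summand [y] of [q i] absorbs the defects; the threshold in [small_defect] is chosen for
    this. *)
Let sum_S_sqr_p i : \sum_j S i j * p j ^+ 2 <= q i.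
Proof.
apply: (@le_trans _ _ (\sum_j S i j * Im (g j) + \sum_j kap * eps j / y)).
  rewrite -big_split/=; apply: ler_sum => j _.
  rewrite (le_trans (ler_wpM2l (S0 i j) (sqr_p_le j)))// mulrDr lerD2l mulrA.
  by rewrite ler_wpM2r ?invr_ge0 ?(ltW z0)// ler_wpM2r// cmod_ge0.
by rewrite qE addrC lerD2r -mulr_suml -mulr_sumr ler_pdivrMr// -expr2.
Qed.

(* Schur test for the matrix [S] with the weights [p], which are nearly the
   square roots of the [Im (g i)]: its norm relative to the [b i] is at most
   [1 + del], without any lower bound on [Im z]. *)
Let schur_weight i : \sum_j S i j * (p j / p i) <= (1 + del) * cmod (b i).
Proof.
have del0 : 0 <= del by exact: le_trans (row_sum i).
apply: (@le_trans _ _ (\sum_j S i j * ((p j ^+ 2 * (cmod (b i) / q i) + cmod (b i)) / 2))).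
  apply: ler_sum => j _; rewrite ler_wpM2l//.
  have -> : p j ^+ 2 * (cmod (b i) / q i) = (p j / p i) ^+ 2 / cmod (b i).
    have -> : (p j / p i) ^+ 2 = p j ^+ 2 / p i ^+ 2 by exact: expr_div_n.
    rewrite (sqr_p i); move: (q i) (q_gt0 i) (cmod (b i)) (b_gt0 i) (p j) => Q Q0 C C0 p'.
    by field; rewrite !gt_eqF.
  rewrite ler_pdivlMr// -(ler_pM2r (b_gt0 i)) mulrDl divfK ?gt_eqF//.
  by have := sqr_ge0 (p j / p i - cmod (b i)); rewrite sqrrB; lra.
rewrite (eq_bigr (fun j => S i j * p j ^+ 2 * (cmod (b i) / q i / 2) +
    S i j * (cmod (b i) / 2))); last by move=> j _; ring.
rewrite big_split/= -!mulr_suml.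
have h1 : (\sum_j S i j * p j ^+ 2) * (cmod (b i) / q i / 2) <= cmod (b i) / 2.
  have bq0 : 0 <= cmod (b i) / q i / 2.
    by rewrite divr_ge0// divr_ge0 ?cmod_ge0// (ltW (q_gt0 i)).
  apply: (le_trans (ler_wpM2r bq0 (sum_S_sqr_p i))).
  rewrite le_eqVlt; apply/orP; left; apply/eqP.
  move: (q i) (q_gt0 i) (cmod (b i)) => Q Q0 C.
  by field; rewrite gt_eqF.
have h2 : \sum_j S i j <= 1 + del.
  by have := row_sum i; rewrite ler_norml => /andP[_]; rewrite lerBlDr addrC.
have h3 : (\sum_j S i j) * (cmod (b i) / 2) <= (1 + del) * (cmod (b i) / 2).
  by rewrite ler_wpM2r// divr_ge0// cmod_ge0.
rewrite (le_trans (lerD h1 h3))// -subr_ge0.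
rewrite (_ : _ - _ = del * cmod (b i) / 2); last by field.
by rewrite divr_ge0// mulr_ge0// cmod_ge0.
Qed.

(** Schur test: [2 * d i * d j <= (p j / p i) * d i ^+ 2 + (p i / p j) * d j ^+ 2], and the two
    resulting double sums agree by the symmetry of [S]. *)
Let quadratic_form_le :
  \sum_i \sum_j S i j * (d i * d j) <= (1 + del) * \sum_i cmod (b i) * d i ^+ 2.
Proof.
apply: (@le_trans _ _ (\sum_i \sum_j (S i j * (p j / p i)) * d i ^+ 2)); last first.
  rewrite mulr_sumr; apply: ler_sum => i _; rewrite -mulr_suml mulrA.
  by rewrite ler_wpM2r ?sqr_ge0 ?schur_weight.
have sym : \sum_i \sum_j (S i j * (p j / p i)) * d i ^+ 2 =
    \sum_i \sum_j (S i j * (p i / p j)) * d j ^+ 2.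
  by rewrite exchange_big/=; apply: eq_bigr => i _; apply: eq_bigr => j _; rewrite Ssym.
suff : 2 * \sum_i \sum_j S i j * (d i * d j) <=
    \sum_i \sum_j (S i j * (p j / p i)) * d i ^+ 2 +
    \sum_i \sum_j (S i j * (p i / p j)) * d j ^+ 2 by rewrite -sym; lra.
rewrite mulr_sumr -big_split; apply: ler_sum => i _.
rewrite mulr_sumr -big_split; apply: ler_sum => j _ /=.
move: (p i) (p_gt0 i) (p j) (p_gt0 j) => u u0 v v0.
have -> : S i j * (v / u) * d i ^+ 2 + S i j * (u / v) * d j ^+ 2 =
    S i j * (((v * d i) ^+ 2 + (u * d j) ^+ 2) / (u * v)) by field; rewrite !gt_eqF.
rewrite mulrCA ler_wpM2l// ler_pdivlMr ?mulr_gt0//.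
by have := sqr_ge0 (v * d i - u * d j); rewrite sqrrB; lra.
Qed.

(** The identity [e1], obtained by subtracting the equation of [m], is exact and not a
    linearization, so [g] is not assumed close to [m] beforehand. *)
Let entry_bound i : cmod (b i) * d i ^+ 2 <=
  (B + 1) * (eps i + del) + cmod m * \sum_j S i j * (d i * d j).
Proof.
have dB : d i <= B + 1 by rewrite (le_trans (cmodB _ _))// lerD// ltW.
have e1 : (g i - m) * b i = defect i - m * (\sum_j (S i j)%:C * (g j - m)) -
    (\sum_j S i j - 1)%:C * m ^+ 2.
  have -> : \sum_j (S i j)%:C * (g j - m) =
      \sum_j (S i j)%:C * g j - (\sum_j S i j)%:C * m.
    rewrite rmorph_sum mulr_suml -sumrB; apply: eq_bigr => j _; exact: mulrBr.
  have -> : (\sum_j S i j - 1)%:C = (\sum_j S i j)%:C - 1 :> R[i].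
    by rewrite rmorphB rmorph1.
  rewrite /b /defect; apply/eqP; rewrite -subr_eq0; apply/eqP.
  transitivity (- (1 + z * m + m ^+ 2)); first by ring.
  by rewrite mE oppr0.
have : cmod (b i) * d i <= eps i + del + cmod m * \sum_j S i j * d j.
  rewrite mulrC -cmodM e1 addrAC (le_trans (cmodB _ _))//; apply: lerD.
    rewrite (le_trans (cmodB _ _))// lerD2l cmodM cmod_real cmodX.
    rewrite (le_trans (ler_piMr _ _))// exprn_ile1 ?cmod_ge0// ltW//.
  rewrite cmodM ler_wpM2l ?cmod_ge0// (le_trans (cmod_sum _ _ _))//.
  by apply: ler_sum => j _; rewrite cmodM cmod_real ger0_norm.
have d0 : 0 <= d i by exact: cmod_ge0.
move=> /(ler_wpM2l d0).
have -> : \sum_j S i j * (d i * d j) = d i * \sum_j S i j * d j.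
  by rewrite mulr_sumr; apply: eq_bigr => j _; ring.
rewrite mulrCA -expr2 => /le_trans; apply; rewrite mulrDr; apply: lerD; last by rewrite mulrCA.
rewrite ler_wpM2r// addr_ge0 ?cmod_ge0//; exact: le_trans (row_sum i).
Qed.

(** The sum [Q] is bounded by the error plus at most [(1 + cmod m) / 2] times itself, so it can be
    absorbed; then [cmod (b i) >= y] turns [Q] into the unweighted sum of squares. *)
Lemma stability :
  (1 - cmod m) / 2 * y * \sum_i cmod (g i - m) ^+ 2 <=
  (B + 1) * \sum_i (cmod (defect i) + del).
Proof.
set Q := \sum_i cmod (b i) * d i ^+ 2.
have hQ : Q <= (B + 1) * \sum_i (eps i + del) + cmod m * ((1 + del) * Q).
  apply: (@le_trans _ _ (\sum_i ((B + 1) * (eps i + del) +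
      cmod m * \sum_j S i j * (d i * d j)))).
    by apply: ler_sum => i _; exact: entry_bound.
  by rewrite big_split/= -!mulr_sumr lerD2l ler_wpM2l ?cmod_ge0.
have Q0 : 0 <= Q.
  by apply: sumr_ge0 => i _; rewrite mulr_ge0 ?sqr_ge0 ?cmod_ge0.
have yQ : y * \sum_i d i ^+ 2 <= Q.
  rewrite mulr_sumr; apply: ler_sum => i _; rewrite ler_wpM2r ?sqr_ge0//.
  exact: le_trans (b_ge i).
have mQ : cmod m * ((1 + del) * Q) <= (1 + cmod m) / 2 * Q.
  by rewrite mulrA ler_wpM2r.
have m2 : 0 <= (1 - cmod m) / 2 by rewrite divr_ge0// subr_ge0 ltW.
rewrite -mulrA (le_trans (ler_wpM2l m2 yQ))//.
move: hQ mQ; set E := (B + 1) * _; set F := cmod m * _; lra.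
Qed.

End stability.

(** The two roots have product 1, so one lies inside the unit disc unless both lie on the circle. In
    that case [z = - (r1 + r1^-1)] would be real. *)
Lemma stieltjes_root (R : realType) (z : R[i]) : 0 < complex.Im z ->
  exists2 m : R[i], 1 + z * m + m ^+ 2 = 0 & cmod m < 1.
Proof.
move=> z0; pose s := sqrtc (z ^+ 2 - 4).
have sE : s ^+ 2 = z ^+ 2 - 4 by exact: sqr_sqrtc.
pose r1 := (- z + s) / 2; pose r2 := (- z - s) / 2.
have e1 : 1 + z * r1 + r1 ^+ 2 = 0.
  have -> : 1 + z * r1 + r1 ^+ 2 = (s ^+ 2 - (z ^+ 2 - 4)) / 4 by rewrite /r1; field.
  by rewrite sE subrr mul0r.
have e2 : 1 + z * r2 + r2 ^+ 2 = 0.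
  have -> : 1 + z * r2 + r2 ^+ 2 = (s ^+ 2 - (z ^+ 2 - 4)) / 4 by rewrite /r2; field.
  by rewrite sE subrr mul0r.
have r12 : r1 * r2 = 1.
  have -> : r1 * r2 = 1 - (s ^+ 2 - (z ^+ 2 - 4)) / 4 by rewrite /r1 /r2; field.
  by rewrite sE subrr mul0r subr0.
have r0 : r1 != 0 by apply/eqP => r10; move: r12; rewrite r10 mul0r => /eqP; rewrite eq_sym oner_eq0.
have c12 : cmod r1 * cmod r2 = 1 by rewrite -cmodM r12 /cmod; exact: ComplexField.Normc.normc1.
have [lt1|gt1|eq1] := ltgtP (cmod r1) 1.
- by exists r1.
- exists r2 => //; rewrite -(ltr_pM2l (lt_trans ltr01 gt1)) c12 mulr1//.
exfalso; have : complex.Im (z * 1) = 0; last by rewrite mulr1 => h; rewrite h ltxx in z0.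
have -> : z * 1 = - (r1 + r1^-1).
  apply: (mulIf r0); rewrite mulr1 mulNr mulrDl mulVf// -expr2.
  apply/eqP; rewrite -subr_eq0 opprK; apply/eqP.
  by rewrite -[RHS]e1; ring.
by rewrite Im_opp Im_add Im_inv eq1 expr1n divr1 subrr oppr0.
Qed.

(** * Convergence of the expected Stieltjes transform *)

Section expected_stieltjes_transform.
Context (R : realType) d (T : measurableType d) (P : probability T R).
Local Notation Re := complex.Re.
Local Notation Im := complex.Im.
Variables (c : nat -> R) (X : forall n, 'I_n * 'I_n -> T -> R * R).
Local Notation M n := (rmx (c n) (@X n)).
Hypothesis mX : forall n (p : 'I_n * 'I_n), (p.1 <= p.2)%N ->
  measurable_fun setT (X p).
Hypothesis indX : forall n,
  mutually_independent P (fun p : 'I_n * 'I_n => (p.1 <= p.2)%N) (@X n).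
Hypothesis sqr_integrable : forall n i j,
  P.-integrable setT (EFin \o (fun w => cmod (M n w i j) ^+ 2)).
Hypothesis centered : forall n i j, cE P (fun w => M n w i j) = 0.
Variable C : R.
Hypotheses (C0 : 0 < C)
  (rvar_le : forall n i j, (0 < n)%N -> rvar P (c n) (@X n) i j <= C / n%:R).
Hypothesis row_sum : forall del : R, 0 < del -> \forall n \near \oo,
  forall i, `|\sum_j rvar P (c n) (@X n) i j - 1| <= del.
Hypothesis tail : forall eps : R, 0 < eps -> \forall n \near \oo,
  n%:R^-1 * \sum_i \sum_j rtail P (c n) (@X n) i j <= eps.
Variables (z m : R[i]).
Hypotheses (z0 : 0 < Im z) (mE : 1 + z * m + m ^+ 2 = 0) (m1 : cmod m < 1).
Local Notation y := (Im z).
Local Notation g n := (rdiag P (c n) (@X n) z).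

Let y0 : 0 <= y. Proof. exact: ltW. Qed.

Lemma nat_large (a : R) : \forall n \near \oo, a <= n%:R /\ (0 < n)%N.
Proof.
near=> n; split; first by near: n; exact: nbhs_infty_ger.
by near: n; exact: nbhs_infty_gt.
Unshelve. all: end_near. Qed.

Lemma row_sum_le2 : \forall n \near \oo, forall i, \sum_j rvar P (c n) (@X n) i j <= 2.
Proof.
have := row_sum ltr01; apply: filterS => n h i.
by have := h i; rewrite ler_norml => /andP[_]; lra.
Qed.

Lemma average_row_defect (rho : R) : 0 < rho -> \forall n \near \oo,
  n%:R^-1 * \sum_i cmod (row_defect P (c n) (@X n) z i) <= rho.
Proof.
move=> rho0; pose K := 2 * (4 * y ^- 2 + 4 * y ^- 3).
have yX k : 0 < y ^- k by rewrite invr_gt0 exprn_gt0.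
have K0 : 0 < K by rewrite /K mulr_gt0// addr_gt0// mulr_gt0.
(* Six errors share [rho]: the tail term and the five summands of [E] below. *)
pose r := rho / 6; have r0 : 0 < r by rewrite divr_gt0.
pose tau := r / (8 * y ^- 3); have tau0 : 0 < tau by rewrite divr_gt0// mulr_gt0.
(* [l] does not grow with [n]. As [kap = C / n], the exponent in [b] is O(1/n), so [b <= expR 2]
   eventually, and this [l] makes [8 * b / (l * y) <= r]. *)
pose l := 8 * expR 2 / (r * y).
have l0 : 0 < l by rewrite divr_gt0 ?mulr_gt0 ?expR_gt0.
pose k1 := r / (8 * y ^- 3 / tau); pose k2 := r / (8 * y ^- 2).
pose k3 := r / (64 * y ^- 4); pose k4 := y / (4 * l).
have k10 : 0 < k1 by rewrite /k1 divr_gt0// divr_gt0// mulr_gt0.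
have k20 : 0 < k2 by rewrite /k2 divr_gt0// mulr_gt0.
have k30 : 0 < k3 by rewrite /k3 divr_gt0// mulr_gt0.
have k40 : 0 < k4 by rewrite /k4 divr_gt0// mulr_gt0.
near=> n.
have [n1 n0] : C / k1 <= n%:R /\ (0 < n)%N by near: n; exact: nat_large.
have [n2 _] : C / k2 <= n%:R /\ (0 < n)%N by near: n; exact: nat_large.
have [n3 _] : C / k3 <= n%:R /\ (0 < n)%N by near: n; exact: nat_large.
have [n4 _] : C / k4 <= n%:R /\ (0 < n)%N by near: n; exact: nat_large.
have [n5 _] : (l * (2 * C / y)) ^+ 2 <= n%:R /\ (0 < n)%N by near: n; exact: nat_large.
have nR : 0 < n%:R :> R by rewrite ltr0n.
pose kap := C / n%:R; have kap0 : 0 < kap by rewrite divr_gt0.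
have kap_le k : 0 < k -> C / k <= n%:R -> kap <= k.
  by move=> kp; rewrite ler_pdivrMr// => h; rewrite ler_pdivrMr// mulrC.
have kap1 := kap_le _ k10 n1; have kap2 := kap_le _ k20 n2.
have kap3 := kap_le _ k30 n3; have kap4 := kap_le _ k40 n4.
have lkap : l * (2 * kap / y) <= 2^-1.
  apply: (@le_trans _ _ (l * (2 * k4 / y))).
    by rewrite ler_pM2l// ler_pM2r ?invr_gt0// ler_pM2l.
  by rewrite /k4 le_eqVlt; apply/orP; left; apply/eqP; field; rewrite !gt_eqF.
have rs2 : forall i, \sum_j rvar P (c n) (@X n) i j <= 2 by near: n; exact: row_sum_le2.
have tl : n%:R^-1 * \sum_i \sum_j rtail P (c n) (@X n) i j <= r / K.
  by near: n; apply: tail; rewrite divr_gt0.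
pose b := expR (2 * n%:R * (l * (2 * kap / y)) ^+ 2).
have b2 : b <= expR 2.
  rewrite ler_expR -mulrA ler_piMr//.
  have -> : n%:R * (l * (2 * kap / y)) ^+ 2 = (l * (2 * C / y)) ^+ 2 / n%:R.
    by rewrite /kap; field; rewrite !gt_eqF.
  by rewrite ler_pdivrMr// mul1r.
pose E := 8 * y ^- 3 * (tau + kap / tau) + 8 * y ^- 2 * kap + 64 * y ^- 4 * kap +
   8 * b / (l * y).
have EE : E <= 5 * r.
  have t1 : 8 * y ^- 3 * tau = r by rewrite /tau mulrC divfK// gt_eqF// mulr_gt0.
  have t2 : 8 * y ^- 3 * (kap / tau) <= r.
    rewrite (_ : _ * (kap / tau) = kap * (8 * y ^- 3 / tau)); last by ring.
    by rewrite -ler_pdivlMr// divr_gt0// mulr_gt0.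
  have t3 : 8 * y ^- 2 * kap <= r by rewrite mulrC -ler_pdivlMr// mulr_gt0.
  have t4 : 64 * y ^- 4 * kap <= r by rewrite mulrC -ler_pdivlMr// mulr_gt0.
  have t5 : 8 * b / (l * y) <= r.
    have ly : 0 < l * y by rewrite mulr_gt0.
    have lyE : r * (l * y) = 8 * expR 2 by rewrite /l; field; rewrite !gt_eqF.
    by rewrite (ler_pdivrMr _ _ ly) lyE ler_pM2l.
  by rewrite /E mulrDr t1; lra.
apply: (@le_trans _ _ (n%:R^-1 * \sum_(i < n) (K * (\sum_j rtail P (c n) (@X n) i j) + 5 * r))).
  rewrite ler_pM2l ?invr_gt0//; apply: ler_sum => i _.
  apply: (@le_trans _ _ (K * (\sum_j rtail P (c n) (@X n) i j) + E)); last by rewrite lerD2l.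
  apply: row_defect_le => //.
  - exact: (@mX n).
  - by move=> i' j'; exact: rvar_le.
rewrite big_split/= sumr_const card_ord -mulr_sumr mulrDr mulrCA -[5 * r *+ n]mulr_natr.
have -> : n%:R^-1 * (5 * r * n%:R) = 5 * r by field; rewrite gt_eqF.
have -> : rho = K * (r / K) + 5 * r by rewrite /r; field; rewrite gt_eqF.
by rewrite lerD2r ler_pM2l.
Unshelve. all: end_near. Qed.

Lemma rvar_sym n i j : rvar P (c n) (@X n) i j = rvar P (c n) (@X n) j i.
Proof.
by apply: eq_Rintegral => w _; rewrite (herm_matx (c n) _ i j) cmod_conj.
Qed.

Lemma expected_stieltjes_cvg (eps : R) : 0 < eps -> \forall n \near \oo,
  cmod (n%:R^-1%:C * (\sum_i g n i) - m) <= eps.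
Proof.
move=> eps0; pose B := 2 * y^-1; pose e := eps / 2.
have e0 : 0 < e by rewrite divr_gt0.
have B0 : 0 < B by rewrite mulr_gt0// invr_gt0.
pose A := (1 - cmod m) / 2 * y.
have A0 : 0 < A by rewrite mulr_gt0// divr_gt0// subr_gt0.
pose rho := A * e ^+ 2 / (B + 1) / 2.
have rho0 : 0 < rho by rewrite /rho divr_gt0// divr_gt0 ?addr_gt0// mulr_gt0 ?exprn_gt0.
(* The second argument of each minimum secures a hypothesis of [stability]: here [mdel], and in
   [rho'] the bound [small_defect] with [kap = C / n]. *)
pose del := Num.min rho ((1 - cmod m) / 2).
have del0 : 0 < del by rewrite lt_min rho0 divr_gt0// subr_gt0.
pose rho' := Num.min rho (y ^+ 2 / C).
have rho'0 : 0 < rho' by rewrite lt_min rho0 divr_gt0// exprn_gt0.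
near=> n.
have [_ n0] : (0 : R) <= n%:R /\ (0 < n)%N by near: n; exact: nat_large.
have nR : 0 < n%:R :> R by rewrite ltr0n.
have rs : forall i, `|\sum_j rvar P (c n) (@X n) i j - 1| <= del.
  by near: n; exact: row_sum.
have rd : n%:R^-1 * \sum_i cmod (row_defect P (c n) (@X n) z i) <= rho'.
  by near: n; exact: average_row_defect.
have mG i : cmeas (fun w => resolvent z (M n w) i i).
  by apply: cmeas_rmx_resolvent => //; exact: (@mX n).
have st : A * \sum_i cmod (g n i - m) ^+ 2 <=
    (B + 1) * \sum_i (cmod (row_defect P (c n) (@X n) z i) + del).
  apply: (@stability _ _ (rvar P (c n) (@X n)) _ _ _ (C / n%:R)) => //.
  - by move=> i j; exact: rvar_ge0.
  - by move=> i j; exact: rvar_sym.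
  - by move=> i j; exact: rvar_le.
  - move=> i; apply: cE_boundc => [|w]; first exact: mG.
    by apply: cmod_resolvent => //; exact: herm_matx.
  - move=> i; apply: Rintegral_ge0 => w _; apply: Im_resolvent_ge0 => //.
    exact: herm_matx.
  - have : del <= (1 - cmod m) / 2 by rewrite ge_min lexx orbT.
    have := cmod_ge0 m; nra.
  - rewrite -mulrA mulrC -ler_pdivlMr//.
    by apply: (le_trans rd); rewrite ge_min lexx orbT.
have sq : n%:R^-1 * \sum_i cmod (g n i - m) ^+ 2 <= e ^+ 2.
  rewrite -(ler_pM2l A0) mulrCA (le_trans (ler_wpM2l _ st)) ?invr_ge0 ?(ltW nR)//.
  rewrite mulrCA big_split/= mulrDr sumr_const card_ord -[del *+ n]mulr_natr.
  have -> : n%:R^-1 * (del * n%:R) = del by field; rewrite gt_eqF.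
  have -> : A * e ^+ 2 = (B + 1) * (rho + rho) by rewrite /rho; field; rewrite gt_eqF// addr_gt0.
  rewrite ler_pM2l ?addr_gt0//; apply: lerD; last by rewrite ge_min lexx.
  by rewrite (le_trans rd)// ge_min lexx.
have -> : n%:R^-1%:C * (\sum_i g n i) - m = n%:R^-1%:C * \sum_i (g n i - m).
  rewrite sumrB sumr_const card_ord mulrBr -[m *+ n]mulr_natr; congr (_ - _).
  rewrite mulrCA (_ : _ * n%:R = 1) ?mulr1//.
  by rewrite -(rmorph_nat (real_complex R)) -rmorphM mulVf ?gt_eqF.
rewrite cmodM cmod_real ger0_norm ?invr_ge0 ?(ltW nR)//.
(* From mean square to mean, by [v <= e + v ^+ 2 / e]. *)
apply: (@le_trans _ _ (n%:R^-1 * \sum_(i < n) (e + e^-1 * cmod (g n i - m) ^+ 2))).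
  rewrite ler_pM2l ?invr_gt0// (le_trans (cmod_sum _ _ _))//.
  apply: ler_sum => i _; set v := cmod _.
  have -> : e + e^-1 * v ^+ 2 = (e ^+ 2 + v ^+ 2) / e by field; rewrite gt_eqF.
  rewrite ler_pdivlMr//; have v0 : 0 <= v by exact: cmod_ge0.
  by have := sqr_ge0 (e - v); nra.
rewrite big_split/= sumr_const card_ord -mulr_sumr mulrDr -[e *+ n]mulr_natr.
rewrite [X in _ + X]mulrCA.
have -> : n%:R^-1 * (e * n%:R) = e by field; rewrite gt_eqF.
have -> : eps = e + e^-1 * e ^+ 2 by rewrite /e; field; rewrite gt_eqF.
by rewrite lerD2l ler_pM2l// invr_gt0.
Unshelve. all: end_near. Qed.

End expected_stieltjes_transform.

Lemma sum_geometric_le (R : realType) (q : R) N : 0 <= q < 1 ->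
  \sum_(0 <= k < N) q ^+ k <= (1 - q)^-1.
Proof.
move=> /andP[q0 q1]; have q1' : 0 < 1 - q by rewrite subr_gt0.
suff -> : \sum_(0 <= k < N) q ^+ k = (1 - q ^+ N) / (1 - q).
  by rewrite ler_piMl ?invr_ge0 ?(ltW q1')// gerBl exprn_ge0.
elim: N => [|N IH]; first by rewrite big_nil expr0 subrr mul0r.
rewrite big_nat_recr//= IH exprS; field.
by rewrite gt_eqF.
Qed.

Section almost_surely.
Context (R : realType) d (T : measurableType d) (P : probability T R).

Lemma ae_eventually (A : nat -> set T) (q : R) :
  (forall n, measurable (A n)) -> 0 <= q < 1 ->
  (forall n, (P (A n) <= (2 * q ^+ n)%:E)%E) ->
  {ae P, forall w, \forall n \near \oo, ~ A n w}.
Proof.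
move=> mA q01 PA; have q0 : 0 <= q by case/andP: q01.
have sumA : (\sum_(n <oo) P (A n) < +oo)%E.
  apply: (@le_lt_trans _ _ (2 * (1 - q)^-1)%:E); last exact: ltry.
  apply: lime_le; first exact: is_cvg_nneseries.
  apply: nearW => N; apply: (@le_trans _ _ (\sum_(0 <= n < N) (2 * q ^+ n)%:E)%E).
    by apply: lee_sum => n _; exact: PA.
  by rewrite sumEFin lee_fin -mulr_sumr ler_wpM2l// sum_geometric_le.
have := lim_sup_set_cvg0 mA sumA => A0.
exists (lim_sup_set A); split => //.
  by apply: bigcap_measurable => // k _; apply: bigcup_measurable => j _.
move=> w /= nw N _; apply: contrapT => h; apply: nw.
by exists N => // n /= Nn An; apply: h; exists n.
Qed.

End almost_surely.

(** * Almost sure convergence at a fixed point of the upper half plane *)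

Section almost_sure_stieltjes_transform.
Context (R : realType) d (T : measurableType d) (P : probability T R).
Local Notation Re := complex.Re.
Local Notation Im := complex.Im.
Variables (c : nat -> R) (X : forall n, 'I_n * 'I_n -> T -> R * R).
Local Notation M n := (rmx (c n) (@X n)).
Local Notation D n := (fun p : 'I_n * 'I_n => (p.1 <= p.2)%N).
Hypothesis mX : forall n p, D n p -> measurable_fun setT (X p).
Hypothesis indX : forall n, mutually_independent P (D n) (@X n).
Variable z : R[i].
Hypothesis z0 : 0 < Im z.
Local Notation y := (Im z).

(** The normalized trace, written as a weighted trace with all weights [1 / n]. *)
Definition stieltjes n (A : 'M[R[i]]_n) : R[i] := \sum_i n%:R^-1%:C * resolvent z A i i.

Lemma ae_concentration (f : R[i] -> R) (eps : R) :
  (forall u v, f (u - v) = f u - f v) -> (forall u, `|f u| <= cmod u) ->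
  (forall n (F : ('I_n * 'I_n -> R * R) -> R[i]), cmfunc (D n) F ->
    mfunc (D n) (fun x => f (F x))) ->
  0 < eps ->
  {ae P, forall w, \forall n \near \oo,
    ~ (eps <= `|f (stieltjes (M n w)) - \int[P]_t f (stieltjes (M n t))|)}.
Proof.
move=> fB fb mf eps0.
(* With [l = th * n] and differences [c = 2 / (n * y)], the first bound gives [l * c <= 1 / 2]. The
   exponent of the tail is [n * (8 * th ^+ 2 / y ^+ 2 - th * eps)], and the second bound lets the
   quadratic term consume at most half of [th * eps]. *)
pose th := Num.min (y / 4) (eps * y ^+ 2 / 16).
have th0 : 0 < th by rewrite lt_min !divr_gt0// mulr_gt0// exprn_gt0.
have th1 : th <= y / 4 by rewrite ge_min lexx.
have th2 : th <= eps * y ^+ 2 / 16 by rewrite ge_min lexx orbT.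
pose q := expR (- (th * eps / 2)).
have q01 : 0 <= q < 1.
  by rewrite expR_ge0 expR_lt1 oppr_lt0 divr_gt0// mulr_gt0.
pose F n (x : 'I_n * 'I_n -> R * R) := f (stieltjes (matx (c n) x)).
have mF n : mfunc (D n) (@F n) by exact/mf/cmfunc_weighted_trace.
pose E n := [set w | eps <=
  `|f (stieltjes (M n w)) - \int[P]_t f (stieltjes (M n t))|].
have mE n : measurable (E n).
  rewrite -[X in measurable X]setTI.
  apply: (@measurable_fun_ler _ _ _ _ (fun=> eps)) => //.
  apply: measurableT_comp => //; apply: measurable_funB => //.
  exact: (mfuncX (@mX n) (@mF n)).
apply: (@ae_eventually _ _ _ P E q) => // n.
have [->|n0] := eqVneq n 0%N.
  rewrite expr0 mulr1; apply: (le_trans (probability_le1 P (mE 0%N))).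
  by rewrite lee_fin ler1n.
have nR : 0 < n%:R :> R by rewrite ltr0n lt0n.
have FB x : `|F n x| <= y^-1.
  rewrite (le_trans (fb _))// (le_trans (cmod_weighted_trace (c n) x z0 _))//.
  rewrite sumr_const card_ord -[X in X / _]mulr_natr mulVf ?gt_eqF// mul1r.
  exact: lexx.
have rF : reads (D n) [pred p | (row_block p < n)%N] (@F n).
  move=> x x' xx; rewrite /F (_ : matx (c n) x = matx (c n) x')//.
  apply/matrixP => i j; apply: matx_eq => p Dp _; apply: xx => //=.
  exact: ltn_ord.
have bF : bounded_difference (D n) (@row_block n) (2 * n%:R^-1 / y) (@F n).
  move=> k x x' xx; rewrite /F -fB (le_trans (fb _))//.
  apply: (weighted_trace_bounded_difference _ z0 _ _ xx) => [j|].
    by rewrite ger0_norm// invr_ge0 ltW.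
  by rewrite invr_ge0 ltW.
have l0 : 0 < th * n%:R by rewrite mulr_gt0.
have lcE : th * n%:R * (2 * n%:R^-1 / y) = 2 * th / y by field; rewrite !gt_eqF.
have lc : th * n%:R * (2 * n%:R^-1 / y) <= 2^-1.
  by rewrite lcE ler_pdivrMr//; lra.
apply: (le_trans (bounded_difference_tail (@mX n) (@indX n) (@mF n) FB rF bF l0 lc eps)).
rewrite lee_fin ler_wpM2l// lcE /q -expRM_natl ler_expR.
have -> : n%:R * - (th * eps / 2) = 2 * n%:R * (2 * th / y) ^+ 2 - th * n%:R * eps
   + n%:R * th * 8 / y ^+ 2 * (eps * y ^+ 2 / 16 - th).
  by field; rewrite gt_eqF.
rewrite lerDl mulr_ge0 ?subr_ge0//.
by rewrite !mulr_ge0 ?invr_ge0 ?sqr_ge0// ltW.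
Qed.

Hypothesis sqr_integrable : forall n i j,
  P.-integrable setT (EFin \o (fun w => cmod (M n w i j) ^+ 2)).
Hypothesis centered : forall n i j, cE P (fun w => M n w i j) = 0.
Variable C : R.
Hypotheses (C0 : 0 < C)
  (rvar_le : forall n i j, (0 < n)%N -> rvar P (c n) (@X n) i j <= C / n%:R).
Hypothesis row_sum : forall del : R, 0 < del -> \forall n \near \oo,
  forall i, `|\sum_j rvar P (c n) (@X n) i j - 1| <= del.
Hypothesis tail : forall eps : R, 0 < eps -> \forall n \near \oo,
  n%:R^-1 * \sum_i \sum_j rtail P (c n) (@X n) i j <= eps.
Variable m : R[i].
Hypotheses (mE : 1 + z * m + m ^+ 2 = 0) (m1 : cmod m < 1).

Lemma stieltjes_ae_cvg :
  {ae P, forall w, cmod (stieltjes (M n w) - m) @[n --> \oo] --> (0 : R)}.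
Proof.
have close (eps : R) : 0 < eps -> {ae P, forall w, \forall n \near \oo,
    cmod (stieltjes (M n w) - m) <= eps}.
  move=> eps0; have e3 : 0 < eps / 3 by rewrite divr_gt0.
  have hRe : {ae P, forall w, \forall n \near \oo, ~ (eps / 3 <=
      `|Re (stieltjes (M n w)) - \int[P]_t Re (stieltjes (M n t))|)}.
    apply: (ae_concentration (f := @complex.Re R)) => //.
    - by move=> u v; rewrite Re_add Re_opp.
    - exact: Re_cmod.
    - by move=> n F mF; exact: cmfunc_Re.
  have hIm : {ae P, forall w, \forall n \near \oo, ~ (eps / 3 <=
      `|Im (stieltjes (M n w)) - \int[P]_t Im (stieltjes (M n t))|)}.
    apply: (ae_concentration (f := @complex.Im R)) => //.
    - by move=> u v; rewrite Im_add Im_opp.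
    - exact: Im_cmod.
    - by move=> n F mF; exact: cmfunc_Im.
  have hE := expected_stieltjes_cvg mX indX sqr_integrable centered C0 rvar_le
    row_sum tail z0 mE m1 e3.
  apply: filterS2 hRe hIm => w h1 h2; apply: filterS3 h1 h2 hE => n.
  move=> /negP; rewrite -ltNge => h1 /negP; rewrite -ltNge => h2 h3.
  have EE : cE P (fun w => stieltjes (M n w)) = n%:R^-1%:C * \sum_i rdiag P (c n) (@X n) z i.
    have iG i : cint P (fun w => resolvent z (M n w) i i).
      by apply: cint_rmx_resolvent => //; exact: (@mX n).
    rewrite /stieltjes cE_sum; last by move=> i; exact: cintZ.
    by rewrite mulr_sumr; apply: eq_bigr => i _; rewrite cEZ.
  have -> : stieltjes (M n w) - m = (stieltjes (M n w) - cE P (fun w => stieltjes (M n w))) +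
      (n%:R^-1%:C * \sum_i rdiag P (c n) (@X n) z i - m) by rewrite EE; ring.
  rewrite (le_trans (cmodD _ _))//.
  have -> : eps = (eps / 3 + eps / 3) + eps / 3 by field.
  apply: lerD => //; rewrite (le_trans (cmod_ReIm _))// Re_add Im_add Re_opp Im_opp /=.
  by apply: lerD; exact: ltW.
have all_close : {ae P, forall w, forall k : nat, \forall n \near \oo,
    cmod (stieltjes (M n w) - m) <= k.+1%:R^-1}.
  by apply/ae_foralln => k; exact: close.
apply: filterS all_close => w hw; apply/cvgrPdist_le => eps eps0.
have [k keps] : exists k : nat, k.+1%:R^-1 <= eps.
  exists (Num.truncn eps^-1); rewrite invf_ple ?posrE//.
  by rewrite ltW// truncnS_gt.
apply: filterS (hw k) => n h; rewrite sub0r normrN ger0_norm ?cmod_ge0//.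
exact: le_trans keps.
Qed.

End almost_sure_stieltjes_transform.

(** * The Stieltjes transform of the semicircle law *)

Section calculus.
Variable R : realType.
Local Notation mu := (@lebesgue_measure R).
Implicit Types (f g F : R -> R).

Lemma is_derive_continuous F f : (forall x : R, is_derive x 1 F (f x)) -> continuous F.
Proof.
move=> dF x; apply: differentiable_continuous; apply/derivable1_diffP.
by have [] := dF x.
Qed.

Lemma derivable_LRcontinuous F f a b : (forall x : R, is_derive x 1 F (f x)) ->
  derivable_oo_LRcontinuous F a b.
Proof.
move=> dF; have cF := is_derive_continuous dF; split.
- by move=> x _; have [] := dF x.
- exact: cvg_at_right_filter (cF a).
- exact: cvg_at_left_filter (cF b).
Qed.

Lemma integral_is_derive F f a b : a < b -> (forall x : R, is_derive x 1 F (f x)) ->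
  continuous f -> \int[mu]_(x in `[a, b]) f x = F b - F a.
Proof.
move=> ab dF cf; rewrite /Rintegral.
rewrite (@continuous_FTC2 _ f F)//.
- exact: continuous_subspaceT.
- exact: (@derivable_LRcontinuous _ f).
- by move=> x _; rewrite derive1E; have [_ ->] := dF x.
Qed.

Lemma integrable_continuous f a b : continuous f ->
  mu.-integrable `[a, b] (EFin \o f).
Proof.
move=> cf; apply: continuous_compact_integrable; first exact: segment_compact.
exact: continuous_subspaceT.
Qed.

Lemma continuous_mul f g : continuous f -> continuous g ->
  continuous (fun t => f t * g t).
Proof. by move=> cf cg x; exact: continuousM (cf x) (cg x). Qed.

Lemma continuous_add f g : continuous f -> continuous g ->
  continuous (fun t => f t + g t).
Proof. by move=> cf cg x; exact: continuousD (cf x) (cg x). Qed.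

Lemma continuous_sub f g : continuous f -> continuous g ->
  continuous (fun t => f t - g t).
Proof. by move=> cf cg x; exact: continuousB (cf x) (cg x). Qed.

Lemma continuous_opp f : continuous f -> continuous (fun t => - f t).
Proof. by move=> cf x; exact: continuousN (cf x). Qed.

Lemma continuous_cst (k : R) : continuous (fun _ : R => k).
Proof. exact: cst_continuous. Qed.

Lemma continuous_inv f : continuous f -> (forall t, f t != 0) ->
  continuous (fun t => (f t)^-1).
Proof. by move=> cf f0 x; exact: continuousV (f0 x) (cf x). Qed.

Lemma continuous_compose f g : continuous f -> continuous g ->
  continuous (fun t => f (g t)).
Proof. by move=> cf cg x; exact: continuous_comp (cg x) (cf (g x)). Qed.

End calculus.

(** * Orthogonality of sines and the expansion of the Stieltjes kernel *)

Section sine_orthogonality.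
Variable R : realType.
Local Notation mu := (@lebesgue_measure R).

Lemma sin_nat_pi (n : nat) : sin (n%:R * pi : R) = 0.
Proof.
elim: n => [|n IH]; first by rewrite mul0r sin0.
by rewrite -natr1 mulrDl mul1r sinDpi IH oppr0.
Qed.

Lemma is_derive_sinM (k x : R) : is_derive x 1 (fun t => sin (k * t)) (k * cos (k * x)).
Proof.
have -> : (fun t : R => sin (k * t)) = sin \o (k \*: id) by [].
by apply: is_derive_eq; rewrite /GRing.scale/= mulr1 mulrC.
Qed.

Lemma continuous_sinM (k : R) : continuous (fun t => sin (k * t)).
Proof. exact: is_derive_continuous (is_derive_sinM k). Qed.

Lemma integral_sin_sin (k : nat) :
  \int[mu]_(t in `[0, pi]) (sin t * sin (k.+1%:R * t)) = if k == 0 then pi / 2 else 0.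
Proof.
have cf : continuous (fun t : R => sin t * sin (k.+1%:R * t)).
  by move=> x; apply: continuousM; [exact: continuous_sin|exact: continuous_sinM].
have k2 : k.+2%:R != 0 :> R by rewrite pnatr_eq0.
have prod (t : R) : sin t * sin (k.+1%:R * t) = (cos (k%:R * t) - cos (k.+2%:R * t)) / 2.
  have -> : k%:R * t = k.+1%:R * t - t by rewrite -natr1; ring.
  have -> : k.+2%:R * t = k.+1%:R * t + t by rewrite -natr1; ring.
  by rewrite cosB cosD; field.
case: k => [|k] in cf k2 prod *.
  have dF (x : R) : is_derive x 1 (fun t => (t - sin (2 * t) / 2) / 2)
      (sin x * sin (1%:R * x)).
    have h := is_derive_sinM 2 x.
    have -> : (fun t : R => (t - sin (2 * t) / 2) / 2) =
      (2^-1 \*: (id - (2^-1 \*: (fun t => sin (2 * t))))).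
      by apply/funext => t; transitivity (2^-1 * (t - 2^-1 * sin (2 * t))); [ring|].
    by apply: is_derive_eq; rewrite /GRing.scale/= prod mul0r cos0; field.
  rewrite (integral_is_derive (pi_gt0 R) dF cf).
  by rewrite !mulr0 sin0 (sin_nat_pi 2); field.
have dF (x : R) : is_derive x 1 (fun t => (sin (k.+1%:R * t) / k.+1%:R -
    sin (k.+3%:R * t) / k.+3%:R) / 2) (sin x * sin (k.+2%:R * x)).
  have h1 := is_derive_sinM k.+1%:R x; have h3 := is_derive_sinM k.+3%:R x.
  have -> : (fun t : R => (sin (k.+1%:R * t) / k.+1%:R - sin (k.+3%:R * t) / k.+3%:R) / 2) =
    (2^-1 \*: ((k.+1%:R^-1 \*: (fun t => sin (k.+1%:R * t))) -
      (k.+3%:R^-1 \*: (fun t => sin (k.+3%:R * t))))).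
    apply/funext => t; transitivity (2^-1 * (k.+1%:R^-1 * sin (k.+1%:R * t) -
      k.+3%:R^-1 * sin (k.+3%:R * t))); [ring|by []].
  apply: is_derive_eq; rewrite /GRing.scale/= prod.
  have u0 : k.+1%:R != 0 :> R by rewrite pnatr_eq0.
  have v0 : k.+3%:R != 0 :> R by rewrite pnatr_eq0.
  move: (k.+1%:R : R) (k.+3%:R : R) u0 v0 => u v u0 v0.
  by field; rewrite u0 v0.
rewrite (integral_is_derive (pi_gt0 R) dF cf).
by rewrite !mulr0 sin0 (sin_nat_pi k.+1) (sin_nat_pi k.+3); ring.
Qed.

End sine_orthogonality.

Section chebyshev_expansion.
Variables (R : realType) (z m : R[i]).
Local Notation Re := complex.Re.
Local Notation Im := complex.Im.
Local Notation mu := (@lebesgue_measure R).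
Hypotheses (z0 : 0 < Im z) (mE : 1 + z * m + m ^+ 2 = 0) (m1 : cmod m < 1).

Let a k : R[i] := (- 1) ^+ k * m ^+ k.+1.
Let s (k : nat) (t : R) : R := sin (k%:R * t).
Let r N t : R[i] := (- m) ^+ N * ((s N.+1 t)%:C + m * (s N t)%:C).

Let s_rec k t : s k.+2 t = 2 * cos t * s k.+1 t - s k t.
Proof.
rewrite /s; have -> : k.+2%:R * t = k.+1%:R * t + t by rewrite -natr1; ring.
have -> : k%:R * t = k.+1%:R * t - t by rewrite -natr1; ring.
by rewrite sinD sinB; ring.
Qed.

(** Partial sums of [sin t / (2 * cos t - z) = \sum_k (- 1) ^ k * m ^ (k + 1) * sin ((k + 1) * t)],
    the generating function of the Chebyshev polynomials of the second kind. After multiplication by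
    the denominator, the recurrence for the sines and the equation of [m] make the sum telescope to
    a remainder of size O(|m|^N). *)
Lemma sine_expansion N t :
  ((2 * cos t)%:C - z) * (\sum_(k < N) a k * (s k.+1 t)%:C) = (s 1 t)%:C - r N t.
Proof.
elim: N => [|N IH].
  by rewrite big_ord0 mulr0 /r expr0 mul1r /s mul0r sin0 mulr0 addr0 subrr.
rewrite big_ord_recr/= mulrDr IH.
apply/eqP; rewrite -subr_eq0; apply/eqP.
have -> : r N.+1 t = - m * (- m) ^+ N * ((2 * cos t)%:C * (s N.+1 t)%:C - (s N t)%:C + m * (s N.+1 t)%:C).
  by rewrite /r exprS s_rec rmorphB rmorphM.
have -> : a N = m * (- m) ^+ N by rewrite /a exprS mulrCA -exprMn mulN1r.
rewrite /r; transitivity (- ((1 + z * m + m ^+ 2) * ((- m) ^+ N * (s N.+1 t)%:C))).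
  by ring.
by rewrite mE mul0r oppr0.
Qed.

End chebyshev_expansion.

Section semicircle_integral.
Variable R : realType.
Local Notation Re := complex.Re.
Local Notation Im := complex.Im.
Local Notation mu := (@lebesgue_measure R).

Lemma is_derive_2cos (x : R) : is_derive x 1 (fun t => 2 * cos t) (- (2 * sin x)).
Proof.
have -> : (fun t : R => 2 * cos t) = 2 \*: (@cos R) by [].
by apply: is_derive_eq; rewrite /GRing.scale/= mulrN.
Qed.

Lemma semicircle_substitution (h : R -> R) : continuous h ->
  \int[mu]_(t in `[-2, 2]) (semicircle_pdf t * h t) =
  \int[mu]_(t in `[0, pi]) (2 / pi * (sin t * (sin t * h (2 * cos t)))).
Proof.
move=> ch; pose F (t : R) := 2 * cos t.
(* The density without its case distinction, hence visibly continuous: [Num.sqrt] is 0 at negative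
   arguments. *)
pose G (t : R) := (2 * pi)^-1 * Num.sqrt (4 - t ^+ 2) * h t.
have cG : continuous G.
  apply: continuous_mul => //; apply: continuous_mul; first exact: continuous_cst.
  apply: (continuous_compose (@sqrt_continuous R)).
  by apply: continuous_sub; [exact: continuous_cst|exact: exprn_continuous].
have F'E : (derive1 F) = fun t => - (2 * sin t).
  by apply/funext => t; rewrite derive1E; have [_ ->] := is_derive_2cos t.
have cF' : continuous (derive1 F).
  rewrite F'E; apply/continuous_opp/continuous_mul; first exact: continuous_cst.
  exact: continuous_sin.
have := @integration_by_substitution_decreasing R F G 0 pi (pi_ge0 R).
have -> : F pi = -2 by rewrite /F cospi mulrN1.
have -> : F 0 = 2 by rewrite /F cos0 mulr1.
have h1 : {in `[0, pi] &, {homo F : x y /~ x < y}}.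
  by move=> x y xi yi xy; rewrite /F ltr_pM2l// ltr_cos.
have h2 : {in `]0, pi[, continuous (derive1 F)} by move=> x _; exact: cF'.
have h3 : cvg ((derive1 F) x @[x --> 0^'+]).
  by apply/cvg_ex; exists ((derive1 F) 0); apply: cvg_at_right_filter; exact: cF'.
have h4 : cvg ((derive1 F) x @[x --> (pi : R)^'-]).
  by apply/cvg_ex; exists ((derive1 F) pi); apply: cvg_at_left_filter; exact: cF'.
have h5 : derivable_oo_LRcontinuous F 0 pi := derivable_LRcontinuous _ _ is_derive_2cos.
have h6 : {within `[-2, 2], continuous G} by exact: continuous_subspaceT.
move=> /(_ h1 h2 h3 h4 h5 h6) E.
transitivity (\int[mu]_(t in `[-2, 2]) G t).
  apply: eq_Rintegral => t; rewrite inE /= in_itv /= => t2.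
  by rewrite /semicircle_pdf t2.
rewrite /Rintegral E; congr fine; apply: eq_integral => t; rewrite inE /= in_itv /= => t0.
rewrite !fctE F'E /G /F opprK.
have -> : 4 - (2 * cos t) ^+ 2 = (2 * sin t) ^+ 2.
  by rewrite !exprMn sin2cos2; ring.
rewrite sqrtr_sqr ger0_norm ?mulr_ge0 ?sin_ge0_pi//.
congr EFin; move: (@pi R) (pi_gt0 R) => p p0.
by field; rewrite gt_eqF.
Qed.

Lemma semicircle_mass : \int[mu]_(t in `[-2, 2]) semicircle_pdf t = 1.
Proof.
have := @semicircle_substitution (fun=> 1) (@continuous_cst R 1).
under eq_Rintegral do rewrite mulr1.
move=> ->; have := integral_sin_sin R 0; rewrite eqxx => E.
rewrite RintegralZl//; last first.
  apply/integrable_continuous/continuous_mul; first exact: continuous_sin.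
  by apply: continuous_mul; [exact: continuous_sin|exact: continuous_cst].
rewrite (_ : \int[mu]_(x in _) _ = pi / 2).
  by move: (@pi R) (pi_gt0 R) => p p0; field; rewrite gt_eqF.
by rewrite -E; apply: eq_Rintegral => t _; rewrite mulr1 mul1r.
Qed.

Lemma Im_subV (z : R[i]) t :
  Im (t%:C - z)^-1 = Im z / ((t - Re z) ^+ 2 + Im z ^+ 2).
Proof.
rewrite Im_inv sqr_cmod Re_add Re_opp Im_add Im_opp /= sub0r opprK.
by rewrite sqrrN.
Qed.

Lemma continuous_cauchy_kernel (x y : R) : 0 < y ->
  continuous (fun t : R => y / ((t - x) ^+ 2 + y ^+ 2)).
Proof.
move=> y0; apply: continuous_mul; first exact: continuous_cst.
have cd : continuous (fun t : R => (t - x) ^+ 2 + y ^+ 2).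
  apply: continuous_add; last exact: continuous_cst.
  apply: (continuous_compose (@exprn_continuous R 2)).
  by apply: continuous_sub; [move=> ?; exact: cvg_id|exact: continuous_cst].
apply: continuous_inv cd _ => t.
by rewrite gt_eqF// ltr_wpDl ?sqr_ge0// exprn_gt0.
Qed.

Variables (z m : R[i]).
Hypotheses (z0 : 0 < Im z) (mE : 1 + z * m + m ^+ 2 = 0) (m1 : cmod m < 1).

Let a k : R[i] := (- 1) ^+ k * m ^+ k.+1.
Let h t := Im (t%:C - z)^-1.

Let ch : continuous h.
Proof.
have -> : h = fun t => Im z / ((t - Re z) ^+ 2 + Im z ^+ 2).
  by apply/funext => t; exact: Im_subV.
exact: continuous_cauchy_kernel.
Qed.

Let psum N t : R := \sum_(k < N) Im (a k) * sin (k.+1%:R * t).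

Let remainder N t : `|sin t * h (2 * cos t) - psum N t| <= 2 * cmod m ^+ N / Im z.
Proof.
set w := (2 * cos t)%:C - z.
have w0 : Im z <= cmod w.
  rewrite (le_trans _ (Im_cmod _))// /w Im_add Im_opp /= sub0r normrN.
  exact: ler_norm.
have wn0 : w != 0 by rewrite -cmod_gt0 (lt_le_trans z0).
pose r := (- m) ^+ N * ((sin (N.+1%:R * t))%:C + m * (sin (N%:R * t))%:C).
have := sine_expansion mE N t; rewrite -/w -/r => E.
have -> : sin t * h (2 * cos t) - psum N t = Im (r / w).
  have -> : r / w = (sin t)%:C * w^-1 - \sum_(k < N) a k * (sin (k.+1%:R * t))%:C.
    apply: (mulIf wn0); rewrite mulrBl !divfK//.
    by rewrite [X in _ - X]mulrC E mul1r opprB addrCA subrr addr0.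
  rewrite Im_add Im_opp Im_scale Im_sum; congr (_ - _).
  by apply: eq_bigr => k _; rewrite [a k * _]mulrC Im_scale mulrC.
rewrite (le_trans (Im_cmod _))// cmodM cmodV; apply: ler_pM.
- exact: cmod_ge0.
- by rewrite invr_ge0 cmod_ge0.
- rewrite /r cmodM cmodX cmodN mulrC ler_wpM2r ?exprn_ge0 ?cmod_ge0//.
  rewrite (le_trans (cmodD _ _))// cmodM !cmod_real.
  have := sin_max (N.+1%:R * t); have := sin_max (N%:R * t).
  by have := cmod_ge0 m; move: m1; move: `|sin (N%:R * t)| => u; nra.
- by rewrite lef_pV2 ?posrE// (lt_le_trans z0).
Qed.

Let continuous_psum N : continuous (psum N).
Proof.
elim: N => [|N IH].
  have -> : psum 0 = fun=> 0 by apply/funext => t; rewrite /psum big_ord0.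
  exact: cst_continuous.
have -> : psum N.+1 = psum N \+ (fun t => Im (a N) * sin (N.+1%:R * t)).
  by apply/funext => t; rewrite /psum big_ord_recr.
apply: continuous_add => //.
by apply: continuous_mul; [exact: continuous_cst|exact: continuous_sinM].
Qed.

Let continuous_sin_mul (f : R -> R) : continuous f -> continuous (fun t => sin t * f t).
Proof. by move=> cf; apply: continuous_mul => //; exact: continuous_sin. Qed.

(** Orthogonality to [sin t] keeps only the term with [a 0 = m], whatever the length of the sum. *)
Let integral_psum N :
  \int[mu]_(t in `[0, pi]) (sin t * psum N.+1 t) = Im m * (pi / 2).
Proof.
have intS k : mu.-integrable `[0, pi] (EFin \o (fun t => sin t * sin (k.+1%:R * t))).
  by apply/integrable_continuous/continuous_sin_mul; exact: continuous_sinM.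
elim: N => [|N IH].
  under eq_Rintegral => t _ do rewrite /psum big_ord1 mulrCA.
  by rewrite RintegralZl// integral_sin_sin eqxx /a expr0 mul1r expr1.
under eq_Rintegral => t _ do rewrite /psum big_ord_recr mulrDr mulrCA -/(psum N.+1 t).
rewrite RintegralD//; last 2 first.
- by apply/integrable_continuous/continuous_sin_mul; exact: continuous_psum.
- apply/integrable_continuous/continuous_mul; first exact: continuous_cst.
  by apply: continuous_sin_mul; exact: continuous_sinM.
by rewrite IH RintegralZl// integral_sin_sin mulr0 addr0.
Qed.

Lemma semicircle_stieltjes :
  \int[mu]_(t in `[-2, 2]) (semicircle_pdf t * Im (t%:C - z)^-1) = Im m.
Proof.
rewrite (semicircle_substitution ch).
have chc : continuous (fun t : R => sin t * h (2 * cos t)).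
  apply/continuous_sin_mul/(continuous_compose ch).
  by apply: continuous_mul; [exact: continuous_cst|exact: continuous_cos].
have pi0 : 0 < pi :> R := pi_gt0 R.
rewrite RintegralZl//; last exact/integrable_continuous/continuous_sin_mul.
set I := \int[mu]_(t in _) _.
have bound N : `|2 / pi * I - Im m| <= 4 * cmod m ^+ N.+1 / Im z.
  have -> : 2 / pi * I - Im m = 2 / pi * (I - Im m * (pi / 2)).
    by move: I (@pi R) pi0 => I' p p0; field; rewrite gt_eqF.
  rewrite -(integral_psum N) /I -RintegralB//; last 2 first.
  - exact/integrable_continuous/continuous_sin_mul.
  - by apply/integrable_continuous/continuous_sin_mul; exact: continuous_psum.
  have cD : continuous (fun t : R => sin t * (sin t * h (2 * cos t)) - sin t * psum N.+1 t).
    apply: continuous_sub; first exact: continuous_sin_mul.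
    by apply: continuous_sin_mul; exact: continuous_psum.
  rewrite normrM ger0_norm ?divr_ge0 ?(ltW pi0)//.
  have -> : 4 * cmod m ^+ N.+1 / Im z = 2 / pi * (2 * cmod m ^+ N.+1 / Im z * pi).
    by move: (@pi R) pi0 => p p0; field; rewrite !gt_eqF.
  rewrite ler_wpM2l ?divr_ge0 ?(ltW pi0)//.
  apply: (le_trans (le_normr_Rintegral _ (integrable_continuous 0 pi cD))) => //.
  have -> : 2 * cmod m ^+ N.+1 / Im z * pi =
      \int[mu]_(t in `[0, pi]) (2 * cmod m ^+ N.+1 / Im z).
    by rewrite Rintegral_cst//= lebesgue_measure_itv/= lte_fin pi0 -EFinD/= subr0.
  apply: le_Rintegral => //.
  - apply: integrable_norm; exact: integrable_continuous.
  - by apply: integrable_continuous; exact: continuous_cst.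
  - move=> t _; rewrite -mulrBr normrM (le_trans _ (remainder N.+1 t))//.
    by rewrite ler_piMl// sin_max.
apply/eqP; rewrite -subr_eq0 -normr_le0; apply/ler_addgt0Pr => e e0; rewrite add0r.
have : (fun N => 4 / Im z * cmod m ^+ N.+1) @ \oo --> (4 / Im z * 0 : R).
  apply: cvgMr; rewrite (cvg_shiftS (fun N => cmod m ^+ N)).
  by apply: cvg_expr; rewrite ger0_norm ?cmod_ge0.
rewrite mulr0 => /cvgrPdist_le /(_ e e0) [N _ /(_ N (leqnn N))].
rewrite sub0r normrN => hN; rewrite (le_trans (bound N))//.
by rewrite mulrAC (le_trans (ler_norm _)).
Qed.

End semicircle_integral.

(** * From Cauchy kernels to distribution functions *)

Section semicircle_functional.
Variable R : realType.
Local Notation mu := (@lebesgue_measure R).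
Implicit Types f g : R -> R.

Definition bounded_measurable f := measurable_fun setT f /\ exists B, forall t, `|f t| <= B.

Definition semicircle_mean f : R := \int[mu]_(t in `[-2, 2]) (semicircle_pdf t * f t).
Local Notation L := semicircle_mean.

Let dens (t : R) : R := (2 * pi)^-1 * Num.sqrt (4 - t ^+ 2).

Let densE t : t \in `[-2, 2]%classic -> semicircle_pdf t = dens t.
Proof. by rewrite inE /= in_itv /= /semicircle_pdf => ->. Qed.

Let dens_ge0 t : 0 <= dens t.
Proof. by rewrite mulr_ge0 ?sqrtr_ge0// invr_ge0 mulr_ge0// pi_ge0. Qed.

Let cdens : continuous dens.
Proof.
apply: continuous_mul; first exact: continuous_cst.
apply: (continuous_compose (@sqrt_continuous R)).
by apply: continuous_sub; [exact: continuous_cst|exact: exprn_continuous].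
Qed.

Let semicircle_meanE f : L f = \int[mu]_(t in `[-2, 2]) (dens t * f t).
Proof. by apply: eq_Rintegral => t /densE ->. Qed.

Let integrable_dens f : bounded_measurable f ->
  mu.-integrable `[-2, 2] (EFin \o (fun t => dens t * f t)).
Proof.
move=> [mf [B fB]].
rewrite (_ : EFin \o _ = (EFin \o dens) \* (EFin \o f))%E//.
apply: integrableMl => //.
- exact: integrable_continuous.
- exact: measurable_funTS.
- exists B; split; first exact: num_real.
  by move=> M BM w _ /=; rewrite (le_trans (fB w))// ltW.
Qed.

Lemma semicircle_meanD f g : bounded_measurable f -> bounded_measurable g ->
  L (fun t => f t + g t) = L f + L g.
Proof.
move=> bf bg; rewrite !semicircle_meanE -RintegralD//; [|exact: integrable_dens..].
by apply: eq_Rintegral => t _; rewrite mulrDr.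
Qed.

Lemma semicircle_meanZ (k : R) f : bounded_measurable f ->
  L (fun t => k * f t) = k * L f.
Proof.
move=> bf; rewrite !semicircle_meanE -RintegralZl//; last exact: integrable_dens.
by apply: eq_Rintegral => t _; rewrite mulrCA.
Qed.

Lemma semicircle_mean_cst (k : R) : L (fun=> k) = k.
Proof.
have := @semicircle_mass R => E.
have bk : bounded_measurable (fun _ : R => 1 : R).
  by split; [exact: measurable_cst|exists 1 => t; rewrite normr1].
transitivity (L (fun t => k * (fun=> 1) t)); first by apply: eq_Rintegral => t _; rewrite /= mulr1.
rewrite semicircle_meanZ// (_ : L _ = 1) ?mulr1// -[RHS]E.
by apply: eq_Rintegral => t _; rewrite /= mulr1.
Qed.

Lemma semicircle_mean_le f g : bounded_measurable f -> bounded_measurable g ->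
  (forall t, -2 <= t <= 2 -> f t <= g t) -> L f <= L g.
Proof.
move=> bf bg fg; rewrite !semicircle_meanE; apply: le_Rintegral => //.
- exact: integrable_dens.
- exact: integrable_dens.
- by move=> t /=; rewrite in_itv /= => t2; rewrite ler_wpM2l// fg.
Qed.

Definition le_ind (x t : R) : R := (t <= x)%R%:R.

Lemma bounded_measurable_le_ind x : bounded_measurable (le_ind x).
Proof.
split; last by exists 1 => t; rewrite /le_ind normr_nat -[leRHS]/(1%:R) ler_nat leq_b1.
rewrite (_ : le_ind x = \1_(`]-oo, x]%classic : set R)); first exact: measurable_indic.
apply/funext => t; rewrite /le_ind indicE; congr ((nat_of_bool _)%:R).
by apply/idP/idP; rewrite inE /= in_itv.
Qed.

Lemma semicircle_cdfE x : semicircle_cdf x = L (le_ind x).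
Proof.
rewrite /semicircle_cdf /semicircle_law /semicircle_mean /Rintegral.
rewrite [in LHS]integral_mkcond [in RHS]integral_mkcond; congr fine.
apply: eq_integral => t _; rewrite !patchE /le_ind /semicircle_pdf.
have -> : (t \in `]-oo, x]%classic) = (t <= x) by apply/idP/idP; rewrite inE /= in_itv.
have -> : (t \in `[-2, 2]%classic) = (-2 <= t <= 2) by apply/idP/idP; rewrite inE /= in_itv.
by case: (t <= x); case: (-2 <= t <= 2); rewrite ?mulr1 ?mulr0 ?mul0r.
Qed.

End semicircle_functional.

(** * Test functions whose empirical means converge *)

Section weak_convergence.
Variable R : realType.
Implicit Types f g : R -> R.
Variables (lam : forall n, 'I_n -> R).
Local Notation L := (@semicircle_mean R).

Definition emp_mean n f : R := n%:R^-1 * \sum_(i < n) f (lam i).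

(** Closed under linear combinations and uniform limits, which is what carries convergence from
    Cauchy kernels to arctangents. *)
Definition good f := bounded_measurable f /\ emp_mean n f @[n --> \oo] --> L f.

Lemma emp_meanD n f g : emp_mean n (fun t => f t + g t) = emp_mean n f + emp_mean n g.
Proof. by rewrite /emp_mean big_split/= mulrDr. Qed.

Lemma emp_meanZ n k f : emp_mean n (fun t => k * f t) = k * emp_mean n f.
Proof. by rewrite /emp_mean /= -mulr_sumr mulrCA. Qed.

Lemma emp_mean_le n f g : (forall t, f t <= g t) -> emp_mean n f <= emp_mean n g.
Proof. by move=> fg; rewrite ler_wpM2l ?invr_ge0//; apply: ler_sum. Qed.

Lemma emp_mean_cst n k : (0 < n)%N -> emp_mean n (fun=> k) = k.
Proof.
move=> n0; rewrite /emp_mean sumr_const card_ord -[k *+ n]mulr_natr mulrCA mulVf ?mulr1//.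
by rewrite pnatr_eq0 -lt0n.
Qed.

Lemma bounded_measurableD f g : bounded_measurable f -> bounded_measurable g ->
  bounded_measurable (fun t => f t + g t).
Proof.
move=> [mf [B fB]] [mg [C gC]]; split; first exact: measurable_funD.
by exists (B + C) => t; rewrite (le_trans (ler_normD _ _))// lerD.
Qed.

Lemma bounded_measurableZ k f : bounded_measurable f ->
  bounded_measurable (fun t => k * f t).
Proof.
move=> [mf [B fB]]; split; first exact: measurable_funM.
by exists (`|k| * B) => t; rewrite normrM ler_wpM2l.
Qed.

Lemma bounded_measurable_cst (k : R) : bounded_measurable (fun=> k).
Proof. by split; [exact: measurable_cst|exists `|k|]. Qed.

Lemma goodD f g : good f -> good g -> good (fun t => f t + g t).
Proof.
move=> [bf cf] [bg cg]; split; first exact: bounded_measurableD.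
rewrite semicircle_meanD//; under eq_fun do rewrite emp_meanD.
exact: cvgD.
Qed.

Lemma goodZ k f : good f -> good (fun t => k * f t).
Proof.
move=> [bf cf]; split; first exact: bounded_measurableZ.
rewrite semicircle_meanZ//; under eq_fun do rewrite emp_meanZ.
by apply: cvgMr.
Qed.

Lemma good0 : good (fun=> 0).
Proof.
split; first exact: bounded_measurable_cst.
rewrite semicircle_mean_cst; apply: cvg_near_cst; near=> n.
by rewrite emp_mean_cst//; near: n; exact: nbhs_infty_gt.
Unshelve. all: end_near. Qed.

(** Both means are monotone and preserve constants (for [n > 0]), so a uniform error passes through
    them unchanged. *)
Lemma good_uniform f : bounded_measurable f ->
  (forall e, 0 < e -> exists2 g, good g & forall t, `|f t - g t| <= e) -> good f.
Proof.
move=> bf happrox; split => //; apply/cvgrPdist_le => e e0.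
have e3 : 0 < e / 3 by rewrite divr_gt0.
have [g [bg cg] fg] := happrox _ e3.
have fg1 t : f t <= g t + e / 3 by have := fg t; rewrite ler_norml => /andP[]; lra.
have fg2 t : g t + - (e / 3) <= f t by have := fg t; rewrite ler_norml => /andP[]; lra.
have bge k : bounded_measurable (fun t => g t + k).
  by apply: bounded_measurableD => //; exact: bounded_measurable_cst.
have L1 : L f <= L g + e / 3.
  rewrite -[X in _ <= _ + X]semicircle_mean_cst -semicircle_meanD//; last first.
    exact: bounded_measurable_cst.
  by apply: semicircle_mean_le.
have L2 : L g - e / 3 <= L f.
  rewrite -[- (e / 3)]semicircle_mean_cst -semicircle_meanD//; last first.
    exact: bounded_measurable_cst.
  by apply: semicircle_mean_le.
near=> n.
have n0 : (0 < n)%N by near: n; exact: nbhs_infty_gt.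
have hn : `|L g - emp_mean n g| <= e / 3.
  by near: n; move/cvgrPdist_le: cg; apply.
have E1 : emp_mean n f <= emp_mean n g + e / 3.
  by rewrite -[X in _ <= _ + X](@emp_mean_cst n)// -emp_meanD; exact: emp_mean_le.
have E2 : emp_mean n g - e / 3 <= emp_mean n f.
  by rewrite -[- (e / 3)](@emp_mean_cst n)// -emp_meanD; exact: emp_mean_le.
by move: hn; rewrite !ler_norml => /andP[h1 h2]; apply/andP; split; lra.
Unshelve. all: end_near. Qed.

Definition cauchy_kernel (x y t : R) : R := y / ((t - x) ^+ 2 + y ^+ 2).

Section fixed_height.
Variable y : R.
Hypothesis y0 : 0 < y.
Hypothesis good_rat : forall q : rat, good (cauchy_kernel (ratr q) y).

Let den_gt0 (v : R) : 0 < v ^+ 2 + y ^+ 2.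
Proof. by rewrite ltr_wpDl ?sqr_ge0// exprn_gt0. Qed.

Lemma cauchy_kernel_ge0 x t : 0 <= cauchy_kernel x y t.
Proof. by rewrite divr_ge0// ltW. Qed.

Lemma cauchy_kernel_le x t : cauchy_kernel x y t <= y^-1.
Proof.
rewrite /cauchy_kernel ler_pdivrMr// mulrDr.
have -> : y^-1 * y ^+ 2 = y by rewrite expr2 mulKf// gt_eqF.
by rewrite lerDr mulr_ge0 ?sqr_ge0// invr_ge0 ltW.
Qed.

(** Once [x - x'] is factored out, the claim is [y * (|u| + |v|) * y ^+ 2 <= (u ^+ 2 + y ^+ 2) * (v
    ^+ 2 + y ^+ 2)], which follows from [2 * y * |u| <= u ^+ 2 + y ^+ 2]. *)
Lemma cauchy_kernel_lipschitz x x' t :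
  `|cauchy_kernel x y t - cauchy_kernel x' y t| <= `|x - x'| / y ^+ 2.
Proof.
set u := t - x; set v := t - x'.
have du := den_gt0 u; have dv := den_gt0 v.
have -> : cauchy_kernel x y t - cauchy_kernel x' y t =
    y * (v - u) * (v + u) / ((u ^+ 2 + y ^+ 2) * (v ^+ 2 + y ^+ 2)).
  by rewrite /cauchy_kernel -/u -/v; field; rewrite !gt_eqF.
have -> : x - x' = v - u by rewrite /u /v; ring.
rewrite normrM [X in _ * X <= _]ger0_norm; last by rewrite invr_ge0 mulr_ge0// ltW.
rewrite ler_pdivrMr ?mulr_gt0// !normrM (gtr0_norm y0).
have -> : y * `|v - u| * `|v + u| = `|v - u| * (y * `|v + u|) by ring.
have -> : `|v - u| / y ^+ 2 * ((u ^+ 2 + y ^+ 2) * (v ^+ 2 + y ^+ 2)) =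
    `|v - u| * ((u ^+ 2 + y ^+ 2) * (v ^+ 2 + y ^+ 2) / y ^+ 2) by ring.
rewrite ler_wpM2l// ler_pdivlMr ?exprn_gt0//.
have h1 : `|v + u| <= `|v| + `|u| by exact: ler_normD.
have hu : `|u| ^+ 2 = u ^+ 2 by rewrite real_normK ?num_real.
have hv : `|v| ^+ 2 = v ^+ 2 by rewrite real_normK ?num_real.
rewrite -hu -hv; move: (normr_ge0 u) (normr_ge0 v) h1.
move: `|u| `|v| `|v + u| => a b c a0 b0 cab.
apply: (@le_trans _ _ (y * (b + a) * y ^+ 2)).
  by rewrite ler_wpM2r ?sqr_ge0// ler_wpM2l// ltW.
have p1 : 0 <= (a - y) ^+ 2 by exact: sqr_ge0.
have p2 : 0 <= (b - y) ^+ 2 by exact: sqr_ge0.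
have ya : y * a <= (a ^+ 2 + y ^+ 2) / 2 by nra.
have yb : y * b <= (b ^+ 2 + y ^+ 2) / 2 by nra.
have y2 : 0 < y ^+ 2 by rewrite exprn_gt0.
have a2 : 0 <= a ^+ 2 by exact: sqr_ge0.
have b2 : 0 <= b ^+ 2 by exact: sqr_ge0.
rewrite mulrDr; move: (a ^+ 2) (b ^+ 2) (y ^+ 2) (y * a) (y * b) ya yb y2 a2 b2.
move=> A B Y p q pA qB Y0 A0 B0.
apply: (@le_trans _ _ (((A + Y) / 2 + (B + Y) / 2) * Y)).
  by rewrite ler_wpM2r ?(ltW Y0)//; lra.
have AB := mulr_ge0 A0 B0; have AY := mulr_ge0 A0 (ltW Y0); have BY := mulr_ge0 B0 (ltW Y0).
by lra.
Qed.

Lemma bounded_measurable_continuous f B : continuous f -> (forall t, `|f t| <= B) ->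
  bounded_measurable f.
Proof. by move=> cf fB; split; [exact: continuous_measurable_fun|exists B]. Qed.

(** The almost sure statement covers countably many centres only; the Lipschitz bound in the centre
    supplies the others. *)
Lemma good_cauchy_kernel x : good (cauchy_kernel x y).
Proof.
apply: good_uniform.
  apply: (@bounded_measurable_continuous _ y^-1).
    exact: (continuous_cauchy_kernel y0).
  by move=> t; rewrite ger0_norm ?cauchy_kernel_ge0// cauchy_kernel_le.
move=> e e0; pose r := e * y ^+ 2.
have r0 : 0 < r by rewrite mulr_gt0// exprn_gt0.
have [q] : exists q : rat, ratr q \in `]x - r, x + r[.
  by apply: rat_in_itvoo; rewrite ltrBlDr -addrA ltrDl addr_gt0.
rewrite in_itv /= => /andP[q1 q2]; exists (cauchy_kernel (ratr q) y) => // t.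
rewrite (le_trans (cauchy_kernel_lipschitz _ _ _))// ler_pdivrMr ?exprn_gt0// -/r.
by rewrite ler_norml; apply/andP; split; lra.
Qed.

(** In [x] this is an antiderivative of the Cauchy kernel; in [t] it is, for small [y], nearly a
    downward step of height [pi] at [x]. *)
Definition atan_step (x t : R) : R := atan ((x - t) / y).

(** By the mean value theorem the increment is [h] times the kernel at an intermediate centre, which
    the Lipschitz bound compares with the kernel at [x]. *)
Lemma atan_step_increment x t h : 0 < h ->
  `|atan_step (x + h) t - atan_step x t - h * cauchy_kernel x y t| <= h ^+ 2 / y ^+ 2.
Proof.
move=> h0.
have dA (u : R) : is_derive u 1 (fun u => atan_step u t) (cauchy_kernel u y t).
  have -> : (fun u => atan_step u t) = atan \o (y^-1 \*: (id - cst t)).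
    by apply/funext => v; rewrite /atan_step mulrC.
  apply: is_derive_eq; rewrite /GRing.scale/= subr0 mulr1 /cauchy_kernel.
  have := den_gt0 (t - u) => dtu.
  have -> : (id - cst t) u = u - t by [].
  have e1 : 1 + (y^-1 * (u - t)) ^+ 2 = ((t - u) ^+ 2 + y ^+ 2) / y ^+ 2.
    by field; rewrite gt_eqF.
  rewrite -[_ *: _]/(y^-1 * (u - t)) e1.
  by field; rewrite !gt_eqF.
have cA : continuous (fun u => atan_step u t) := is_derive_continuous dA.
have xh : x < x + h by rewrite ltrDl.
have [c cx] := MVT xh (fun u _ => dA u) (continuous_subspaceT cA).
rewrite /= => ->; rewrite addrAC subrr add0r mulrC -mulrBr normrM gtr0_norm//.
rewrite expr2 -[leRHS]mulrA ler_pM2l// (le_trans (cauchy_kernel_lipschitz _ _ _))//.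
rewrite ler_pM2r ?invr_gt0 ?exprn_gt0//.
by move: cx; rewrite in_itv /= => /andP[c1 c2]; rewrite ler_norml; apply/andP; split; lra.
Qed.

Let riemann x h N t : R := \sum_(k < N) h * cauchy_kernel (x + h * k%:R) y t.

Let riemann_error x h N t : 0 < h ->
  `|atan_step (x + h * N%:R) t - atan_step x t - riemann x h N t| <= N%:R * (h ^+ 2 / y ^+ 2).
Proof.
move=> h0; elim: N => [|N IH].
  by rewrite /riemann big_ord0 mulr0 addr0 subrr subrr normr0 mul0r.
rewrite /riemann big_ord_recr/= -/(riemann x h N t).
have := atan_step_increment (x + h * N%:R) t h0.
have -> : x + h * N.+1%:R = x + h * N%:R + h by rewrite -natr1; ring.
move=> inc; rewrite -natr1 mulrDl mul1r.
apply: (le_trans _ (lerD IH inc)); apply: (le_trans _ (ler_normD _ _)).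
by rewrite le_eqVlt; apply/orP; left; apply/eqP; congr (`|_|); ring.
Qed.

Let good_riemann x h N : good (riemann x h N).
Proof.
elim: N => [|N IH].
  have -> : riemann x h 0 = (fun=> 0) by apply/funext => t; rewrite /riemann big_ord0.
  exact: good0.
have -> : riemann x h N.+1 = (fun t => riemann x h N t + h * cauchy_kernel (x + h * N%:R) y t).
  by apply/funext => t; rewrite /riemann big_ord_recr.
by apply: goodD => //; apply: goodZ; exact: good_cauchy_kernel.
Qed.

Lemma atan_bound (u : R) : `|atan u| <= pi / 2.
Proof.
by rewrite ler_norml ltW ?atan_gtNpi2// ltW// atan_ltpi2.
Qed.

Lemma bounded_measurable_atan_step x : bounded_measurable (atan_step x).
Proof.
apply: (@bounded_measurable_continuous _ (pi / 2)); last by move=> t; exact: atan_bound.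
apply: (continuous_compose (@continuous_atan R)).
apply: continuous_mul; last exact: continuous_cst.
by apply: continuous_sub; [exact: continuous_cst|move=> ?; exact: cvg_id].
Qed.

(** The base point [c] keeps the range of centres bounded, so finite Riemann sums of kernels
    approximate uniformly in [t]. *)
Lemma good_atan_step c x : c <= x -> good (fun t => atan_step x t - atan_step c t).
Proof.
rewrite le_eqVlt => /predU1P[->|cx].
  have -> : (fun t => atan_step x t - atan_step x t) = (fun=> 0).
    by apply/funext => t; rewrite subrr.
  exact: good0.
apply: good_uniform.
  have -> : (fun t => atan_step x t - atan_step c t) =
      (fun t => atan_step x t + (-1) * atan_step c t).
    by apply/funext => t; rewrite mulN1r.
  apply: bounded_measurableD; first exact: bounded_measurable_atan_step.
  by apply: bounded_measurableZ; exact: bounded_measurable_atan_step.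
move=> e e0; pose l := x - c; have l0 : 0 < l by rewrite subr_gt0.
(* The total Riemann error is [N * h ^+ 2 / y ^+ 2 = l ^+ 2 / (N * y ^+ 2)]. *)
pose N := (Num.truncn (l ^+ 2 / (e * y ^+ 2))).+1.
have N0 : 0 < N%:R :> R by rewrite ltr0n.
have hN : l ^+ 2 / (e * y ^+ 2) <= N%:R by rewrite ltW// truncnS_gt.
pose h := l / N%:R; have h0 : 0 < h by rewrite divr_gt0.
exists (riemann c h N) => [|t]; first exact: good_riemann.
have := @riemann_error c h N t h0.
have -> : c + h * N%:R = x by rewrite /h divfK ?gt_eqF// /l addrC subrK.
move=> /le_trans; apply.
have -> : N%:R * (h ^+ 2 / y ^+ 2) = l ^+ 2 / y ^+ 2 / N%:R.
  by rewrite /h; field; rewrite !gt_eqF.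
rewrite ler_pdivrMr//; move: hN; rewrite ler_pdivrMr ?mulr_gt0 ?exprn_gt0// => hN.
by rewrite ler_pdivrMr ?exprn_gt0//; apply: (le_trans hN); rewrite mulrA [N%:R * e]mulrC.
Qed.

End fixed_height.
End weak_convergence.

(** * Squeezing the distribution functions *)

Section distribution_functions.
Variable R : realType.
Variables (lam : forall n, 'I_n -> R).
Local Notation L := (@semicircle_mean R).
Local Notation F := (@semicircle_cdf R).
Local Notation Fn n x := (emp_mean lam n (le_ind x)).
Hypothesis good_kernels : forall (k : nat) (q : rat),
  good lam (cauchy_kernel (ratr q) k.+1%:R^-1).

Let pi0 : 0 < pi :> R := pi_gt0 R.

Let height (del e : R) : 0 < del -> 0 < e ->
  exists k, `|pi / 2 - atan (del / k.+1%:R^-1)| <= pi * e.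
Proof.
move=> d0 e0; have := @cvgy_atan R => /cvgrPdist_le /(_ (pi * e)).
have pe0 : 0 < pi * e by rewrite mulr_gt0.
move=> /(_ pe0) [M [_ hM]].
exists (Num.truncn (`|M| / del)).
apply: hM; rewrite invrK (le_lt_trans (ler_norm M))// mulrC -ltr_pdivrMr//.
exact: truncnS_gt.
Qed.

Let semicircle_cdf_itv x : 0 <= F x <= 1.
Proof.
rewrite semicircle_cdfE -{1}(semicircle_mean_cst 0) -(semicircle_mean_cst 1).
have bk k : bounded_measurable (fun _ : R => k : R) by exact: bounded_measurable_cst.
have bi := bounded_measurable_le_ind x.
by apply/andP; split; apply: semicircle_mean_le => // t _;
  rewrite /le_ind ?ler0n// -[leRHS]/(1%:R) ler_nat leq_b1.
Qed.

Let leE (u t : R) : le_ind u t = if t <= u then 1 else 0.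
Proof. by rewrite /le_ind; case: ifP. Qed.

Section step.
Variables (x del e y : R).
Hypotheses (d0 : 0 < del) (e0 : 0 < e) (y0 : 0 < y).
Hypothesis good_y : forall q : rat, good lam (cauchy_kernel (ratr q) y).
Local Notation a := (atan (del / y)).
Local Notation S := (atan_step y).
Hypothesis a_near : `|pi / 2 - a| <= pi * (e / 4).

Let a_le : a <= pi / 2. Proof. by rewrite ltW// atan_ltpi2. Qed.

Let a_ge : pi / 2 - a <= pi * (e / 4).
Proof. exact: le_trans (ler_norm _) a_near. Qed.

Let S_le u t : S u t <= pi / 2. Proof. by rewrite ltW// atan_ltpi2. Qed.
Let S_ge u t : - (pi / 2) <= S u t. Proof. by rewrite ltW// atan_gtNpi2. Qed.

Let S_mono u v t : u <= v -> S u t <= S v t.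
Proof. by move=> uv; apply: le_atan; rewrite ler_pM2r ?invr_gt0// lerD2r. Qed.

Let S_far u t : del <= u - t -> a <= S u t.
Proof. by move=> h; apply: le_atan; rewrite ler_pM2r ?invr_gt0. Qed.

Let S_neg u t : u - t <= - del -> S u t <= - a.
Proof.
by move=> h; rewrite -atanN; apply: le_atan; rewrite -mulNr ler_pM2r ?invr_gt0.
Qed.

Let good_difference u v : u <= v -> good lam (fun t => pi^-1 * (S v t - S u t)).
Proof. by move=> uv; apply: goodZ; exact: good_atan_step. Qed.

(** How far a normalized arctangent, at distance at least [del] from its step, can be from its
    limiting value. A difference of two of them is at least [1 - 2 * th] at depth [del] inside the
    interval between their steps. *)
Let th := pi^-1 * (pi / 2 - a).

Let th_ge0 : 0 <= th. Proof. by rewrite mulr_ge0 ?invr_ge0 ?subr_ge0// ltW. Qed.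

Let th_le : th <= e / 4. Proof. by rewrite /th mulrC ler_pdivrMr// [e / 4 * _]mulrC. Qed.

Let thE : 1 - 2 * th = pi^-1 * (a + a).
Proof. by rewrite /th; move: a (@pi R) pi0 => b p p0; field; rewrite gt_eqF. Qed.

Let pi1 : pi^-1 * pi = 1 :> R. Proof. by rewrite mulVf// gt_eqF. Qed.

Let ler_piV (u v : R) : u <= v -> pi^-1 * u <= pi^-1 * v.
Proof. by move=> uv; rewrite ler_wpM2l ?invr_ge0 ?(ltW pi0). Qed.

Let difference_le u v t : pi^-1 * (S v t - S u t) <= 1.
Proof.
by rewrite -pi1; apply: ler_piV; have := S_le v t; have := S_ge u t; lra.
Qed.

Let difference_ge0 u v t : u <= v -> 0 <= pi^-1 * (S v t - S u t).
Proof. by move=> uv; rewrite mulr_ge0 ?invr_ge0 ?(ltW pi0)// subr_ge0 S_mono. Qed.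

Let bound_of_good (g : R -> R) (l : R) : good lam g -> l <= L g ->
  \forall n \near \oo, (0 < n)%N /\ l - e / 4 <= emp_mean lam n g.
Proof.
move=> [_ /cvgrPdist_le /(_ (e / 4))] cg lg.
have e4 : 0 < e / 4 by rewrite divr_gt0.
near=> n; split; first by near: n; exact: nbhs_infty_gt.
have : `|L g - emp_mean lam n g| <= e / 4 by near: n; exact: cg.
by rewrite ler_norml => /andP[]; lra.
Unshelve. all: end_near. Qed.

Let x_ge : - `|x| <= x. Proof. by rewrite lerNl ler_normr lexx orbT. Qed.
Let x_le : x <= `|x|. Proof. exact: ler_norm. Qed.

(** The function [g] smooths the indicator of []x + del, c]]. Up to [th] it lies below the indicator
    of []x, +oo[] at every [t], since the eigenvalues are not confined. It dominates [1 - 2 * th]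
    times the indicator of []x + 2 * del, +oo[] only on [[-2, 2]], which suffices for the semicircle
    mean; the choice of [c] puts this interval at distance at least [del] to its left. *)
Lemma emp_cdf_upper : \forall n \near \oo, Fn n x <= F (x + 2 * del) + e.
Proof.
pose c := `|x| + 2 + del; pose x' := x + del.
have xc : x' <= c by rewrite /x' /c; have := x_le; lra.
have gg := good_difference xc.
set g := fun t => _ in gg.
pose F2 := F (x + 2 * del).
have h1 t : g t <= (1 + - 1 * le_ind x t) + th.
  rewrite leE; case: (leP t x) => tx.
    rewrite mulN1r subrr add0r; apply: ler_piV; apply: lerB => //; apply: S_far.
    by rewrite /x'; lra.
  by rewrite mulr0 addr0 (le_trans (difference_le _ _ _))// lerDl.
have h2 t : -2 <= t <= 2 -> (1 - 2 * th) * (1 + - 1 * le_ind (x + 2 * del) t) <= g t.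
  move=> /andP[t1 t2]; rewrite leE; case: (leP t (x + 2 * del)) => tx.
    by rewrite mulN1r subrr mulr0; exact: difference_ge0.
  rewrite mulr0 addr0 mulr1 thE; apply: ler_piV; rewrite lerD//; last first.
    by rewrite lerNr; apply: S_neg; rewrite /x'; lra.
  by apply: S_far; rewrite /c; have := normr_ge0 x; lra.
have bi u : bounded_measurable (le_ind u) := bounded_measurable_le_ind u.
have bc (u v : R) : bounded_measurable (fun t => u + - 1 * le_ind v t).
  by apply: bounded_measurableD; [exact: bounded_measurable_cst|exact: bounded_measurableZ].
have Lg : (1 - 2 * th) * (1 - F2) <= L g.
  have -> : (1 - 2 * th) * (1 - F2) =
      L (fun t => (1 - 2 * th) * (1 + - 1 * le_ind (x + 2 * del) t)).
    rewrite semicircle_meanZ// semicircle_meanD ?semicircle_meanZ//.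
    - by rewrite semicircle_mean_cst -semicircle_cdfE mulN1r.
    - exact: bounded_measurable_cst.
    - exact: bounded_measurableZ.
  apply: semicircle_mean_le => //; first exact: bounded_measurableZ.
  by case: gg.
apply: filterS (bound_of_good gg Lg) => n [n0 hn].
have : emp_mean lam n g <= (1 - Fn n x) + th.
  rewrite (le_trans (emp_mean_le _ _ h1))// !emp_meanD !emp_mean_cst// emp_meanZ mulN1r.
  exact: lexx.
have /andP[F20 F21] := semicircle_cdf_itv (x + 2 * del).
(* The losses add up to at most [3 * th + e / 4 <= e]. *)
move: hn; rewrite -/F2 in F20 F21 *; move: th_le th_ge0; nra.
Qed.

(** The mirror image, with a smoothed indicator of []c, x - del]] and [c] to the left of the
    support. *)
Lemma emp_cdf_lower : \forall n \near \oo, F (x - 2 * del) - e <= Fn n x.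
Proof.
pose c := - (`|x| + 2 + del); pose x' := x - del.
have xc : c <= x' by rewrite /x' /c; have := x_ge; lra.
have gg := good_difference xc.
set g := fun t => _ in gg.
pose F1 := F (x - 2 * del).
have h1 t : g t <= le_ind x t + th.
  rewrite leE; case: (leP t x) => tx.
    by rewrite (le_trans (difference_le _ _ _))// lerDl.
  rewrite add0r; apply: ler_piV.
  have := S_ge c t; have : S x' t <= - a by apply: S_neg; rewrite /x'; lra.
  lra.
have h2 t : -2 <= t <= 2 -> (1 - 2 * th) * le_ind (x - 2 * del) t <= g t.
  move=> /andP[t1 t2]; rewrite leE; case: (leP t (x - 2 * del)) => tx; last first.
    by rewrite mulr0; exact: difference_ge0.
  rewrite mulr1 thE; apply: ler_piV; rewrite lerD//.
    by apply: S_far; rewrite /x'; lra.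
  by rewrite lerNr; apply: S_neg; rewrite /c; have := normr_ge0 x; lra.
have bi u : bounded_measurable (le_ind u) := bounded_measurable_le_ind u.
have Lg : (1 - 2 * th) * F1 <= L g.
  rewrite /F1 semicircle_cdfE -semicircle_meanZ//.
  apply: semicircle_mean_le => //; first exact: bounded_measurableZ.
  by case: gg.
apply: filterS (bound_of_good gg Lg) => n [n0 hn].
have : emp_mean lam n g <= Fn n x + th.
  by rewrite (le_trans (emp_mean_le _ _ h1))// emp_meanD emp_mean_cst.
have /andP[F10 F11] := semicircle_cdf_itv (x - 2 * del).
move: hn; rewrite -/F1 in F10 F11 *; move: th_le th_ge0; nra.
Qed.

End step.

Lemma weak_cvg_semicircle : weak_cvg (fun n x => Fn n x) F.
Proof.
move=> x cF; apply/cvgrPdist_le => e e0.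
have e2 : 0 < e / 2 by rewrite divr_gt0.
have := cF => /cvgrPdist_le /(_ _ e2) [r /= r0 hr].
pose del := r / 4; have d0 : 0 < del by rewrite divr_gt0.
have e8 : 0 < e / 2 / 4 by rewrite divr_gt0.
have [k hk] := height d0 e8.
have k0 : 0 < k.+1%:R^-1 :> R by rewrite invr_gt0 ltr0n.
have up : \forall n \near \oo, Fn n x <= F (x + 2 * del) + e / 2.
  by apply: emp_cdf_upper hk => //; exact: good_kernels.
have lo : \forall n \near \oo, F (x - 2 * del) - e / 2 <= Fn n x.
  by apply: emp_cdf_lower hk => //; exact: good_kernels.
have dr : 2 * del < r by rewrite /del; lra.
have d2 : 0 <= 2 * del by rewrite mulr_ge0// ltW.
have c1 : `|F x - F (x + 2 * del)| <= e / 2.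
  by apply: (hr (x + 2 * del)); rewrite /= opprD addNKr normrN ger0_norm.
have c2 : `|F x - F (x - 2 * del)| <= e / 2.
  by apply: (hr (x - 2 * del)); rewrite /= opprB addrC subrK ger0_norm.
apply: filterS2 up lo => n up lo.
by move: c1 c2; rewrite !ler_norml => /andP[? ?] /andP[? ?]; apply/andP; split; lra.
Qed.

End distribution_functions.

(** * Normalized random matrices *)

Section normalized_array.
Context (R : realType) (d : measure_display) (T : measurableType d) (P : probability T R).
Local Notation Re := complex.Re.
Local Notation Im := complex.Im.
Variables (A : forall n : nat, T -> 'M[R[i]]_n) (s : forall n : nat, 'I_n -> 'I_n -> R).
Hypothesis A_measurable : forall (n : nat) (i j : 'I_n),
    measurable_fun [set: T] (fun w => to_plane (A n w i j)).
Hypothesis A_hermitian : forall (n : nat) (w : T), A n w \is hermsymmx.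
Hypothesis A_mean : forall (n : nat) (i j : 'I_n),
    ('E_P[fun w => complex.Re (A n w i j)] = 0 /\
     'E_P[fun w => complex.Im (A n w i j)] = 0)%E.
Hypothesis A_variance : forall (n : nat) (i j : 'I_n),
    ('E_P[fun w => (cmod (A n w i j) ^+ 2)%R] = (s i j)%:E)%E.

Definition inv_sqrt n : R := (Num.sqrt n%:R)^-1.
Definition plane_array n (p : 'I_n * 'I_n) (w : T) : R * R := to_plane (A n w p.1 p.2).
Local Notation M n := (rmx (inv_sqrt n) (@plane_array n)).

Lemma rmx_inv_sqrt n w : M n w = (inv_sqrt n)%:C *: A n w.
Proof.
have hA := hermsymmx_herm (A_hermitian n w).
apply/matrixP => i j; rewrite !mxE; congr (_ * _).
rewrite /plane_array /of_plane /to_plane /=; case: ltngtP => [_|_|/val_inj <-].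
- by case: (A n w i j).
- by rewrite [RHS]hA; case: (A n w j i).
- by have := hA i i; case: (A n w i i) => u v [] /eqP; rewrite -subr_eq0 opprK -mulr2n mulrn_eq0 /= => /eqP ->.
Qed.

Let cmeasA n i j : cmeas (fun w => A n w i j).
Proof.
split; first exact: (measurableT_comp measurable_fst (A_measurable i j)).
exact: (measurableT_comp measurable_snd (A_measurable i j)).
Qed.

(** Finiteness of [s i j] is what yields integrability, because the integrand is nonnegative. First
    moments are later dominated by [1 + cmod (A n w i j) ^+ 2]. *)
Lemma integrable_sqr_cmod n i j :
  P.-integrable setT (EFin \o (fun w => cmod (A n w i j) ^+ 2)).
Proof.
apply/integrableP; split.
  by apply/measurable_EFinP; exact: measurable_sqr_cmod.
rewrite (_ : (\int[P]_x _)%E = (s i j)%:E) ?ltry//.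
rewrite -A_variance unlock; apply: eq_integral => w _ /=.
by rewrite ger0_norm ?sqr_ge0.
Qed.

Lemma Rintegral_sqr_cmod n i j : \int[P]_w cmod (A n w i j) ^+ 2 = s i j.
Proof. by have := A_variance i j; rewrite unlock /Rintegral => ->. Qed.

Let sqr_inv_sqrt n : inv_sqrt n ^+ 2 = n%:R^-1.
Proof. by rewrite /inv_sqrt exprVn sqr_sqrtr. Qed.

Let inv_sqrt_ge0 n : 0 <= inv_sqrt n. Proof. by rewrite invr_ge0 sqrtr_ge0. Qed.

Lemma cmod_rmx_inv_sqrt n w i j : cmod (M n w i j) = inv_sqrt n * cmod (A n w i j).
Proof. by rewrite rmx_inv_sqrt mxE cmodM cmod_real ger0_norm. Qed.

Lemma integrable_sqr_rmx n i j :
  P.-integrable setT (EFin \o (fun w => cmod (M n w i j) ^+ 2)).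
Proof.
under eq_fun do rewrite cmod_rmx_inv_sqrt exprMn.
by apply: EFin_integrableZ; exact: integrable_sqr_cmod.
Qed.

Lemma centered_rmx n i j : cE P (fun w => M n w i j) = 0.
Proof.
have iA : cint P (fun w => A n w i j).
  apply: (cint_dominated (cmeasA i j) (h := fun w => 1 + cmod (A n w i j) ^+ 2)).
    apply: EFin_integrableD; first exact: integrable_const.
    exact: integrable_sqr_cmod.
  move=> w; have := sqr_ge0 (cmod (A n w i j) - 1); have := cmod_ge0 (A n w i j); nra.
transitivity (cE P (fun w => (inv_sqrt n)%:C * A n w i j)).
  by apply: eq_cE => w; rewrite rmx_inv_sqrt mxE.
rewrite cEZ// (_ : cE P _ = 0) ?mulr0//.
have [h1 h2] := A_mean i j; rewrite unlock in h1 h2.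
by rewrite /cE /Rintegral h1 h2.
Qed.

Lemma rvar_rmx n i j : rvar P (inv_sqrt n) (@plane_array n) i j = n%:R^-1 * s i j.
Proof.
rewrite /rvar; under eq_Rintegral do rewrite cmod_rmx_inv_sqrt exprMn sqr_inv_sqrt.
by rewrite RintegralZl// ?Rintegral_sqr_cmod//; exact: integrable_sqr_cmod.
Qed.

Section lindeberg_condition.
Hypothesis s_row_avg : forall eps : R, 0 < eps ->
    \forall n \near \oo, forall i : 'I_n,
      `|n%:R^-1 * (\sum_(j < n) s i j) - 1| < eps.
Hypothesis lindeberg : forall eta : R, 0 < eta ->
    ((n%:R ^- 2)%:E *
       \sum_(i < n) \sum_(j < n)
         'E_P[fun w => (cmod (A n w i j) ^+ 2 *
                \1_[set w' | eta * Num.sqrt n%:R <= cmod (A n w' i j)] w)%R])%E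
      @[n --> \oo] --> 0%E.

Lemma row_sum_rmx (del : R) : 0 < del -> \forall n \near \oo,
  forall i, `|\sum_j rvar P (inv_sqrt n) (@plane_array n) i j - 1| <= del.
Proof.
move=> d0; apply: filterS (s_row_avg d0) => n h i.
under eq_bigr do rewrite rvar_rmx.
by rewrite -mulr_sumr ltW.
Qed.

Let large eta n i j : set T := [set w | eta * Num.sqrt n%:R <= cmod (A n w i j)].

Let measurable_large eta n i j : measurable (@large eta n i j).
Proof.
rewrite -[X in measurable X]setTI.
apply: (@measurable_fun_ler _ _ _ _ (fun=> eta * Num.sqrt n%:R)) => //.
exact: measurable_cmod.
Qed.

Let integrable_large eta n i j : P.-integrable setT (EFin \o
  (fun w => cmod (A n w i j) ^+ 2 * \1_(@large eta n i j) w)).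
Proof.
apply: (integrable_dominated (k := fun w => cmod (A n w i j) ^+ 2)).
- by apply: measurable_funM; [exact: measurable_sqr_cmod|exact: measurable_indic].
- exact: integrable_sqr_cmod.
- move=> w; rewrite indicE normrM ger0_norm ?sqr_ge0// ler_piMr ?sqr_ge0//.
  by rewrite normr_nat -[leRHS]/(1%:R) ler_nat leq_b1.
Qed.

(** Since [cmod (A n w i j) >= eta * sqrt n] means [cmod (M n w i j) >= eta], the factor
    [min 1 |M i j|] is at most [eta] off this event and at most 1 on it. *)
Let rtail_le eta n i j : 0 < eta -> (0 < n)%N ->
  rtail P (inv_sqrt n) (@plane_array n) i j <=
  eta * rvar P (inv_sqrt n) (@plane_array n) i j +
  n%:R^-1 * \int[P]_w (cmod (A n w i j) ^+ 2 * \1_(@large eta n i j) w).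
Proof.
move=> eta0 n0; have sn : 0 < Num.sqrt n%:R :> R by rewrite sqrtr_gt0 ltr0n.
have iM := @integrable_sqr_rmx n i j.
rewrite /rvar -!RintegralZl// -RintegralD//; [|exact: EFin_integrableZ..].
have mM : cmeas (fun w => M n w i j).
  by apply: cmeas_rmx => p _; exact: A_measurable.
apply: Rintegral_le.
- apply: (integrable_dominated (k := fun w => cmod (M n w i j) ^+ 2)) => //.
    apply: measurable_funM; first exact: measurable_sqr_cmod.
    by apply: measurable_minr => //; exact: measurable_cmod.
  move=> w; rewrite normrM ger0_norm ?sqr_ge0// ler_piMr ?sqr_ge0//.
  rewrite ger0_norm; first by rewrite ge_min lexx.
  by rewrite le_min ler01 cmod_ge0.
- by apply: EFin_integrableD; exact: EFin_integrableZ.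
- move=> w; have a0 := cmod_ge0 (M n w i j).
  rewrite indicE mulrA -sqr_inv_sqrt -exprMn -cmod_rmx_inv_sqrt.
  have [wl|wl] := boolP (w \in _).
    rewrite mulr1 (le_trans (ler_wpM2l (sqr_ge0 _) (_ : _ <= 1))) ?ge_min ?lexx//.
    by rewrite mulr1 lerDr mulr_ge0 ?sqr_ge0// ltW.
  rewrite mulr0 addr0 mulrC ler_wpM2r ?sqr_ge0// ge_min; apply/orP; right.
  rewrite cmod_rmx_inv_sqrt /inv_sqrt mulrC ler_pdivrMr// ltW// ltNge.
  by apply: contra wl => h; rewrite inE.
Qed.

Lemma tail_rmx (eps : R) : 0 < eps -> \forall n \near \oo,
  n%:R^-1 * \sum_i \sum_j rtail P (inv_sqrt n) (@plane_array n) i j <= eps.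
Proof.
(* The average row sum of the variances is eventually at most 2, so the part multiplied by [eta]
   costs at most [eps / 2]. *)
move=> eps0; pose eta := eps / 4; have eta0 : 0 < eta by rewrite divr_gt0.
have e2 : 0 < eps / 2 by rewrite divr_gt0.
pose u n := n%:R ^- 2 * \sum_(i < n) \sum_(j < n)
  \int[P]_w (cmod (A n w i j) ^+ 2 * \1_(@large eta n i j) w).
have cu : u n @[n --> \oo] --> (0 : R).
  suff /fine_cvg : (EFin \o u) n @[n --> \oo] --> 0%:E by [].
  apply: cvg_trans (lindeberg eta0); apply: near_eq_cvg.
  apply: nearW => n; rewrite /u /= EFinM -sumEFin; congr (_ * _)%E.
  apply: eq_bigr => i _; rewrite -sumEFin; apply: eq_bigr => j _.
  by rewrite unlock -Rintegral_fineK.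
near=> n.
have n0 : (0 < n)%N by near: n; exact: nbhs_infty_gt.
have nR : 0 < n%:R :> R by rewrite ltr0n.
have rs : forall i, `|\sum_j rvar P (inv_sqrt n) (@plane_array n) i j - 1| <= 1.
  by near: n; exact: row_sum_rmx.
have un : `|0 - u n| <= eps / 2 by near: n; move/cvgrPdist_le: cu; apply.
apply: (@le_trans _ _ (n%:R^-1 * \sum_(i < n) \sum_(j < n)
   (eta * rvar P (inv_sqrt n) (@plane_array n) i j +
  n%:R^-1 * \int[P]_w (cmod (A n w i j) ^+ 2 * \1_(@large eta n i j) w)))).
  rewrite ler_wpM2l ?invr_ge0//; apply: ler_sum => i _; apply: ler_sum => j _.
  exact: rtail_le.
have -> : n%:R^-1 * \sum_(i < n) \sum_(j < n)
   (eta * rvar P (inv_sqrt n) (@plane_array n) i j +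
  n%:R^-1 * \int[P]_w (cmod (A n w i j) ^+ 2 * \1_(@large eta n i j) w)) =
  eta * (n%:R^-1 * \sum_(i < n) \sum_(j < n) rvar P (inv_sqrt n) (@plane_array n) i j) + u n.
  under eq_bigr do rewrite big_split/= -!mulr_sumr.
  by rewrite big_split/= -!mulr_sumr mulrDr mulrCA; congr (_ + _); rewrite /u -exprVn expr2 mulrA.
have h1 : n%:R^-1 * \sum_(i < n) \sum_(j < n) rvar P (inv_sqrt n) (@plane_array n) i j <= 2.
  rewrite mulrC ler_pdivrMr// (_ : 2 * n%:R = \sum_(i < n) 2); last first.
    by rewrite sumr_const card_ord mulr_natr.
  by apply: ler_sum => i _; have := rs i; rewrite ler_norml => /andP[_]; lra.
have h2 : eta * (n%:R^-1 * \sum_(i < n) \sum_(j < n) rvar P (inv_sqrt n) (@plane_array n) i j)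
    <= eps / 2.
  by rewrite (le_trans (ler_wpM2l (ltW eta0) h1))// /eta; lra.
move: un; rewrite sub0r normrN => /(le_trans (ler_norm _)) un.
by have := lerD h2 un; lra.
Unshelve. all: end_near. Qed.

End lindeberg_condition.
End normalized_array.

(** * Eigenvalue means and the conclusion *)

Section spectral_means.
Context (R : realType).

Definition real_spectrum n (M : 'M[R[i]]_n) (i : 'I_n) : R :=
  complex.Re (spectral_diag M 0 i).

Let spectral_diagE n (M : 'M[R[i]]_n) i : herm M ->
  spectral_diag M 0 i = (real_spectrum M i)%:C.
Proof.
move=> hM; have := spectral_diag_real hM i; rewrite /real_spectrum.
by case: (spectral_diag M 0 i) => a b /= ->.
Qed.

Lemma esd_emp_mean (M : forall n, 'M[R[i]]_n) n x : herm (M n) ->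
  esd (M n) x = emp_mean (fun n => real_spectrum (M n)) n (le_ind x).
Proof.
move=> hM; rewrite /esd /emp_mean; congr (_ * _); apply: eq_bigr => i _.
by rewrite spectral_diagE// lecR.
Qed.

Lemma Im_stieltjes (M : forall n, 'M[R[i]]_n) n z : 0 < complex.Im z -> herm (M n) ->
  complex.Im (stieltjes z (M n)) =
  emp_mean (fun n => real_spectrum (M n)) n (cauchy_kernel (complex.Re z) (complex.Im z)).
Proof.
move=> z0 hM; rewrite /stieltjes -mulr_sumr -/(mxtrace _) mxtrace_resolvent//.
rewrite mulr_sumr Im_sum /emp_mean mulr_sumr; apply: eq_bigr => i _.
by rewrite spectral_diagE// Im_mul /= mul0r addr0 Im_subV.
Qed.

Lemma good_cauchy_kernel_of_stieltjes (M : forall n, 'M[R[i]]_n) (x y : R) (m : R[i]) :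
  0 < y -> (forall n, herm (M n)) ->
  1 + (x +i* y) * m + m ^+ 2 = 0 -> cmod m < 1 ->
  cmod (stieltjes (x +i* y) (M n) - m) @[n --> \oo] --> (0 : R) ->
  good (fun n => real_spectrum (M n)) (cauchy_kernel x y).
Proof.
move=> y0 hM mE m1 cM; split.
  apply: (@bounded_measurable_continuous _ _ y^-1); first exact: continuous_cauchy_kernel.
  by move=> t; rewrite ger0_norm ?cauchy_kernel_ge0// cauchy_kernel_le.
have -> : semicircle_mean (cauchy_kernel x y) = complex.Im m.
  rewrite -(@semicircle_stieltjes _ (x +i* y) m)//.
  by apply: eq_Rintegral => t _; rewrite Im_subV.
apply/cvgrPdist_le => e e0; have /cvgrPdist_le /(_ _ e0) := cM.
apply: filterS => n; rewrite sub0r normrN ger0_norm ?cmod_ge0// => h.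
rewrite -(@Im_stieltjes _ _ (x +i* y))// distrC -Im_opp -Im_add.
exact: le_trans (Im_cmod _) h.
Qed.

End spectral_means.

Unset Implicit Arguments.
Set Strict Implicit.
Set Printing Implicit Defensive.

Theorem theorem4p2 (R : realType) (d : measure_display) (T : measurableType d)
  (P : probability T R)
  (A : forall n : nat, T -> 'M[R[i]]_n)
  (s : forall n : nat, 'I_n -> 'I_n -> R)
  (A_measurable : forall (n : nat) (i j : 'I_n),
    measurable_fun [set: T] (fun w => to_plane (A n w i j)))
  (A_hermitian : forall (n : nat) (w : T), A n w \is hermsymmx)
  (A_independent : forall n : nat,
    mutually_independent P
      (fun p : 'I_n * 'I_n => (p.1 <= p.2)%N)
      (fun p w => to_plane (A n w p.1 p.2)))
  (A_mean : forall (n : nat) (i j : 'I_n),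
    ('E_P[fun w => complex.Re (A n w i j)] = 0 /\
     'E_P[fun w => complex.Im (A n w i j)] = 0)%E)
  (A_variance : forall (n : nat) (i j : 'I_n),
    ('E_P[fun w => (cmod (A n w i j) ^+ 2)%R] = (s n i j)%:E)%E)
  (s_row_avg : forall eps : R, 0 < eps ->
    \forall n \near \oo, forall i : 'I_n,
      `|n%:R^-1 * (\sum_(j < n) s n i j) - 1| < eps)
  (lindeberg : forall eta : R, 0 < eta ->
    ((n%:R ^- 2)%:E *
       \sum_(i < n) \sum_(j < n)
         'E_P[fun w => (cmod (A n w i j) ^+ 2 *
                \1_[set w' | eta * Num.sqrt n%:R <= cmod (A n w' i j)] w)%R])%E
      @[n --> \oo] --> 0%E)
  (s_bounded : exists2 C : R, 0 < C &
    forall (n : nat) (i j : 'I_n), s n i j <= C) :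
  {ae P, forall w : T,
    weak_cvg (fun n => esd ((Num.sqrt n%:R)^-1%:C *: A n w))
             (@semicircle_cdf R)}.
Proof.
have [C C0 sC] := s_bounded.
pose M n w : 'M[R[i]]_n := rmx (inv_sqrt R n) (@plane_array _ _ _ A n) w.
have ME n w : M n w = (Num.sqrt n%:R)^-1%:C *: A n w by exact: rmx_inv_sqrt.
have hM n w : herm (M n w) by exact: herm_matx.
(* Countably many points [z], with rational centre and height [1 / (k + 1)], so that a single null
   set serves them all. *)
suff : {ae P, forall w, forall (k : nat) (q : rat),
    good (fun n => real_spectrum (M n w)) (cauchy_kernel (ratr q) k.+1%:R^-1)}.
  apply: filterS => w gw x cF.
  apply: cvg_trans (weak_cvg_semicircle gw cF); apply: near_eq_cvg.
  by apply: nearW => n; rewrite -ME (@esd_emp_mean _ (fun n => M n w)).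
suff H k q : {ae P, forall w,
    good (fun n => real_spectrum (M n w)) (cauchy_kernel (ratr q) k.+1%:R^-1)}.
  apply/ae_foralln => k.
  (* The rationals are enumerated by their codes, so that [ae_foralln] applies. *)
  have : {ae P, forall w, forall j : nat, forall q : rat, unpickle j = Some q ->
    good (fun n => real_spectrum (M n w)) (cauchy_kernel (ratr q) k.+1%:R^-1)}.
    apply/ae_foralln => j; case: unpickle => [q|].
      by apply: filterS (H k q) => w gw q' [<-].
    by apply: nearW.
  by apply: filterS => w gw q; apply: (gw (pickle q)); rewrite pickleK.
have y0 : 0 < k.+1%:R^-1 :> R by rewrite invr_gt0.
have z0 : 0 < complex.Im ((ratr q : R) +i* (k.+1%:R^-1 : R)) by [].
have [m mE m1] := stieltjes_root z0.
have : {ae P, forall w, cmod (stieltjes (ratr q +i* k.+1%:R^-1) (M n w) - m)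
    @[n --> \oo] --> (0 : R)}.
  apply: (@stieltjes_ae_cvg _ _ _ P (inv_sqrt R) (@plane_array _ _ _ A) _ _ _ _ _ _ C) => //.
  - by move=> n p _; exact: A_measurable.
  - by move=> n i j; apply: integrable_sqr_rmx => //; exact: A_variance.
  - by move=> n i j; apply: centered_rmx.
  - by move=> n i j n0; rewrite (rvar_rmx A_measurable A_hermitian A_variance) mulrC ler_wpM2r.
  - by move=> del; apply: row_sum_rmx.
  - by move=> eps; apply: tail_rmx.
by apply: filterS => w; apply: good_cauchy_kernel_of_stieltjes.
Qed.
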